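(* Let $\boldsymbol\alpha$ be a sequence compactly included in $\mathbb D$ (i.e. $\sup_n|\alpha_n|<1$), let $\mu$ be a measure on $\mathbb T$ such that $\log\mu'\notin L^1_m$, and let $(\phi_n)_{n\ge0}$ be the corresponding ORF. Let $$\mathcal V=\tilde\zeta_{\mathcal A}(\mathcal H),\qquad \mathcal A=\mathcal A(\boldsymbol\alpha),\quad \mathcal H=\mathcal H(\boldsymbol a),\quad \boldsymbol a=\mathcal S_{\boldsymbol\alpha}(\mu),$$ and let $\mathcal E$ be the spectral measure of (the unitary operator on $\ell^2$ given by) $\mathcal V$. Then $\mu=\mathcal E_{1,1}$, where $\mathcal E_{1,1}(\Delta)$ denotes the $(1,1)$ (first diagonal) entry of the matrix $\mathcal E(\Delta)$. Besides, $\operatorname{supp}\mu=\sigma(\mathcal V)$ and the mass points of $\mu$ are the eigenvalues of $\mathcal V$, which have geometric multiplicity 1. A complex number $\lambda$ (not a pole of any $\phi_n$) is a mass point of $\mu$ if and only if $(\phi_n(\lambda))_{n\ge0}\in\ell^2$. Given a mass point $\lambda$, the corresponding eigenvectors of $\mathcal V$ are spanned by $\begin{pmatrix}\phi_0(\lambda)&\phi_1(\lambda)&\cdots\end{pmatrix}^\dag$, and $$\mu(\{\lambda\})=\Big(\sum_{n=0}^\infty|\phi_n(\lambda)|^2\Big)^{-1}.$$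
   Context: $\mathbb T$ is the unit circle, $\mathbb D$ the open unit disk, $m$ the normalized Lebesgue measure on $\mathbb T$. A measure on $\mathbb T$ is a probability Borel measure $\mu$ on $\mathbb T$ whose support $\operatorname{supp}\mu$ is infinite; $\mu'=d\mu/dm$ is the density of its absolutely continuous part. $L^2_\mu$ carries the inner product $\langle f,g\rangle_\mu=\int\overline{f}\,g\,d\mu$. ORF. Let $\boldsymbol\alpha=(\alpha_n)_{n\ge1}$ be a sequence in $\mathbb D$ and set $\alpha_0=0$. For $n\ge0$ let $\varpi_n(z)=1-\overline{\alpha_n}z$, $\varpi_n^*(z)=z-\alpha_n$, $\zeta_n=\varpi_n^*/\varpi_n$. Let $B_0=1$, $B_n=\zeta_1\cdots\zeta_n$, and $f_*(z)=\overline{f(1/\overline z)}$. The orthogonal rational functions (ORF) $(\phi_n)_{n\ge0}$ of $\mu$ associated with $\boldsymbol\alpha$ are the result of orthonormalizing $(B_n)_{n\ge0}$ in $L^2_\mu$ (so $\phi_0,\dots,\phi_n$ is an orthonormal basis of $\operatorname{span}\{B_0,\dots,B_n\}$ for every $n$), with unimodular factors chosen so that $\phi_0=1$ and, with $\phi_n^*=B_n\phi_{n*}$, $$\begin{pmatrix}\phi_n\\ \phi_n^*\end{pmatrix}=e_n\frac{\varpi_{n-1}}{\varpi_n}\begin{pmatrix}1&a_n\\ \overline{a_n}&1\end{pmatrix}\begin{pmatrix}\zeta_{n-1}\phi_{n-1}\\ \phi_{n-1}^*\end{pmatrix},\quad e_n=\sqrt{\frac{\varpi_n(\alpha_n)}{\varpi_{n-1}(\alpha_{n-1})}\frac1{1-|a_n|^2}},\quad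 n\ge1,$$ for some $a_n\in\mathbb D$. This normalization exists and both $(\phi_n)$ and $\boldsymbol a=(a_n)_{n\ge1}$ are then uniquely determined; one writes $\boldsymbol a=\mathcal S_{\boldsymbol\alpha}(\mu)$. Matrices. Infinite bounded matrices are identified with operators on $\ell^2$ acting on column vectors. $\mathcal A(\boldsymbol\alpha)=\operatorname{diag}(\alpha_0,\alpha_1,\alpha_2,\dots)$. With $\rho_n=\sqrt{1-|a_n|^2}$ and the convention $a_0=1$, $\mathcal H(\boldsymbol a)=(h_{k,n})_{k,n\ge0}$ is the Hessenberg matrix with $h_{k,n}=-a_{n+1}\rho_n\rho_{n-1}\cdots\rho_{k+1}\overline{a_k}$ for $k\le n$ (for $k=n$ the product of $\rho$'s is empty), $h_{n+1,n}=\rho_{n+1}$, and $h_{k,n}=0$ for $k>n+1$. Under the hypotheses of the theorem $\mathcal V$ is unitary. Operator Möbius transformation. For bounded operators $A,T$ on a Hilbert space with $\|A\|<1$, $\|T\|\le1$, set $\eta_A=\sqrt{1-AA^\dag}$ and $\tilde\zeta_A(T)=\eta_A^{-1}(T+A)(1+A^\dag T)^{-1}\eta_{A^\dag}$. The superscript $\dag$ denotes adjoint (conjugate transpose). *)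

(* Defs.v *)
From HB Require Import structures.
From mathcomp Require Import all_boot all_order all_algebra.
From mathcomp Require Import complex ring lra.
From mathcomp Require Import all_classical all_reals all_analysis.
From mathcomp Require Import measurable_realfun.

Set Implicit Arguments.
Unset Strict Implicit.
Unset Printing Implicit Defensive.

Import Order.TTheory GRing.Theory Num.Theory.
Import numFieldNormedType.Exports.

Local Open Scope classical_set_scope.
Local Open Scope ring_scope.

(* [R[i]] carries no topology of its own: giving it the type [numClosedFieldType]
   makes the norm topology of [numFieldNormedType] available. *)
Definition cplx (R : realType) : numClosedFieldType := R[i].
Arguments cplx : simpl never.

(* The modulus with values in [R]; the norm [`|z|] of [cplx R] is valued in
   [cplx R]. *)
Definition cabs (R : realType) (z : cplx R) : R := Normc.normc z.

Definition borel_cplx (R : realType) := g_sigma_algebraType (@open (cplx R)).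

Definition unit_circle (R : realType) : set (cplx R) := [set z | `|z| = 1].

Section circle_measure.
Context {R : realType}.

Definition expi (t : R) : cplx R := Complex (cos t) (sin t).

Lemma norm_Complex_lt (a b e : R) :
  `|a| < e / 2 -> `|b| < e / 2 -> `|Complex a b : cplx R| < real_complex R e :> cplx R.
Proof.
move=> ha hb.
have e0 : 0 < e by have := le_lt_trans (normr_ge0 a) ha; lra.
rewrite [X in X < _]normc_def /= ltcR.
rewrite -(ger0_norm (ltW e0)) -sqrtr_sqr ltr_sqrt ?exprn_gt0//.
rewrite -[a ^+ 2]real_normK ?num_real// -[b ^+ 2]real_normK ?num_real//.
have := normr_ge0 a; have := normr_ge0 b.
move: ha hb; move: `|a| `|b| => {}a {}b; nra.
Qed.

Lemma continuous_expi : continuous expi.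
Proof.
move=> t; apply/cvgrPdist_lt => /= e e0.
have /andP[/eqP ei er] : (complex.Im e == 0) && (0 < complex.Re e).
  by case: e e0 => a b; rewrite ltcE /= eq_sym.
have eE : e = real_complex R (complex.Re e) by case: e {e0 er} ei => a b /= ->.
have h : 0 < complex.Re e / 2 by rewrite divr_gt0.
rewrite eE; near=> s.
have -> : expi t - expi s = Complex (cos t - cos s) (sin t - sin s) by [].
apply: norm_Complex_lt.
  by near: s; have /cvgrPdist_lt := @continuous_cos R t; apply.
by near: s; have /cvgrPdist_lt := @continuous_sin R t; apply.
Unshelve. all: by end_near. Qed.

Lemma measurable_expi : measurable_fun setT (expi : R -> borel_cplx R).
Proof.
apply: (@measurability _ _ R (borel_cplx R) setT expi (@open (cplx R))) => //.
move=> _ [U oU <-].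
rewrite setTI; apply: open_measurable.
by apply: open_comp => // t _; exact: continuous_expi.
Qed.


(* Normalized Lebesgue measure on the unit circle, as a Borel measure on the
   plane. *)
Definition circle_measure (A : set (borel_cplx R)) : \bar R :=
  (((2 * pi)^-1)%:E *
    lebesgue_measure ((expi @^-1` A) `&` `[0%R, (2 * pi)%R[))%E.

Let inv2pi_ge0 : 0 <= (2 * pi)^-1 :> R.
Proof. by rewrite invr_ge0 mulr_ge0// pi_ge0. Qed.

Let circle_measureE : circle_measure =
  pushforward (mscale (NngNum inv2pi_ge0)
    (mrestr lebesgue_measure (measurable_itv `[0%R, (2 * pi)%R[)))
    (expi : R -> borel_cplx R).
Proof. by []. Qed.

Let circle_measure0 : circle_measure set0 = 0%E.
Proof. by rewrite circle_measureE /pushforward preimage_set0 measure0. Qed.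

Let circle_measure_ge0 A : (0 <= circle_measure A)%E.
Proof. rewrite circle_measureE /pushforward; apply: measure_ge0. Qed.

Let circle_measure_sigma_additive : semi_sigma_additive circle_measure.
Proof.
rewrite circle_measureE => F mF tF mUF; rewrite /pushforward preimage_bigcup.
have m U : measurable U -> measurable ((expi : R -> borel_cplx R) @^-1` U).
  by move=> mU; rewrite -[X in measurable X]setTI; exact: measurable_expi.
apply: measure_semi_sigma_additive.
- by move=> n; exact: m.
- apply/trivIsetP => /= i j _ _ ij; rewrite -preimage_setI.
  by move/trivIsetP : tF => /(_ _ _ _ _ ij) ->//; rewrite preimage_set0.
- by rewrite -preimage_bigcup; exact: m.
Qed.

HB.instance Definition _ := isMeasure.Build _ _ _ circle_measure
  circle_measure0 circle_measure_ge0 circle_measure_sigma_additive.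

End circle_measure.

Section measures_on_circle.
Context {R : realType}.
Local Notation C := (cplx R).

Definition msupport (mu : set (borel_cplx R) -> \bar R) : set C :=
  [set z | forall U : set C, open U -> U z -> (0 < mu U)%E].

(* A Borel measure on the circle is a Borel measure on the plane carried by the
   circle. *)
Definition measure_on_circle (mu : probability (borel_cplx R) R) : Prop :=
  mu (@unit_circle R) = 1%E /\ infinite_set (msupport mu).

(* [w] is (a version of) the density of the absolutely continuous part in the
   Lebesgue decomposition of [mu] with respect to [circle_measure]. *)
Definition ac_density (mu : probability (borel_cplx R) R) (w : C -> R) : Prop :=
  [/\ measurable_fun setT (w : borel_cplx R -> R),
      forall z, 0 <= w z &
      exists mus : {measure set (borel_cplx R) -> \bar R},
        (exists S : set (borel_cplx R), [/\ measurable S,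
           circle_measure S = 0%E & mus (~` S) = 0%E]) /\
        forall D : set (borel_cplx R), measurable D ->
          mu D = (\int[circle_measure]_(z in D) (w z)%:E + mus D)%E].

(* [lne 0 = -oo], so that [log w] fails to be integrable as soon as [w]
   vanishes on a set of positive measure. *)
Definition log_integrable (w : C -> R) : Prop :=
  circle_measure.-integrable setT (fun z : borel_cplx R => lne (w z)%:E).

(* All the functions integrated below are bounded Borel functions on the
   circle. *)
Definition circle_integral (mu : {measure set (borel_cplx R) -> \bar R})
    (f : C -> C) : C :=
  Complex (\int[mu]_(z in @unit_circle R) complex.Re (f z))
          (\int[mu]_(z in @unit_circle R) complex.Im (f z)).

End measures_on_circle.

Section orthogonal_rational_functions.
Context {R : realType}.
Local Notation C := (cplx R).
Implicit Types (alpha a : nat -> C) (f : C -> C) (z : C).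

Definition varpi alpha (n : nat) z : C := 1 - (alpha n)^* * z.
Definition varpi_star alpha (n : nat) z : C := z - alpha n.
Definition zeta alpha (n : nat) z : C := varpi_star alpha n z / varpi alpha n z.
Definition blaschke alpha (n : nat) z : C := \prod_(1 <= k < n.+1) zeta alpha k z.

Definition lower_star f z : C := (f (z^*)^-1)^*.
Definition upper_star alpha (n : nat) f z : C :=
  blaschke alpha n z * lower_star f z.

(* Rational functions are represented by total functions (division by zero
   yields [0]); identities involving [zeta alpha k] and [upper_star alpha k]
   for [k <= n] are meaningful off the finite set of poles and zeros of these
   factors. *)
Definition regular_point alpha (n : nat) z : Prop :=
  forall k, (k <= n)%N -> varpi alpha k z != 0 /\ varpi_star alpha k z != 0.

Definition in_span (u : nat -> C -> C) (n : nat) f : Prop :=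
  exists c : nat -> C, forall z, f z = \sum_(0 <= k < n.+1) c k * u k z.

(* The factor e_(n+1). *)
Definition orf_norm alpha a (n : nat) : C :=
  sqrtC (varpi alpha n.+1 (alpha n.+1) / varpi alpha n (alpha n)
         * (1 - `|a n.+1| ^+ 2)^-1).

(* [phi] is the sequence of orthogonal rational functions of [mu] associated
   with [alpha], and [a] its sequence of recurrence parameters
   (the image of [mu] by the map S_alpha); [a 0 = 1] is conventional. *)
Definition is_orf (mu : probability (borel_cplx R) R) alpha
    (phi : nat -> C -> C) a : Prop :=
  [/\ forall n f, in_span phi n f <-> in_span (blaschke alpha) n f,
      forall j k, circle_integral mu (fun z => (phi j z)^* * phi k z)
                  = (j == k)%:R,
      forall z, phi 0%N z = 1,
      a 0%N = 1 &
      forall n, `|a n.+1| < 1 /\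
      forall z, regular_point alpha n.+1 z ->
        phi n.+1 z = orf_norm alpha a n * (varpi alpha n z / varpi alpha n.+1 z)
          * (zeta alpha n z * phi n z
             + a n.+1 * upper_star alpha n (phi n) z) /\
        upper_star alpha n.+1 (phi n.+1) z
          = orf_norm alpha a n * (varpi alpha n z / varpi alpha n.+1 z)
          * ((a n.+1)^* * (zeta alpha n z * phi n z)
             + upper_star alpha n (phi n) z)].

Definition is_pole f z : Prop := cabs (f t) @[t --> z^'] --> +oo.

Definition rho a (n : nat) : C := sqrtC (1 - `|a n| ^+ 2).

Definition diag_matrix alpha (k n : nat) : C := if k == n then alpha n else 0.

Definition hessenberg a (k n : nat) : C :=
  if (k <= n)%N then
    - a n.+1 * (\prod_(k.+1 <= j < n.+1) rho a j) * (a k)^*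
  else if k == n.+1 then rho a n.+1 else 0.

End orthogonal_rational_functions.

Section square_summable_sequences.
Context {R : realType}.
Local Notation C := (cplx R).

Definition sq_sum (x : nat -> C) : \bar R :=
  (\sum_(0 <= n <oo) (cabs (x n) ^+ 2)%:E)%E.

Definition sq_summable (x : nat -> C) : Prop := (sq_sum x < +oo)%E.

Definition sq_summable_pred : {pred nat -> C} := fun x => `[< sq_summable x >].

Lemma cabs0 : cabs (0 : C) = 0.
Proof. exact: Normc.normc0. Qed.

Lemma cabs_sqD_le (c x y : C) :
  cabs (c * x + y) ^+ 2 <= 2 * cabs c ^+ 2 * cabs x ^+ 2 + 2 * cabs y ^+ 2.
Proof.
have sq (z : C) : cabs z ^+ 2 = complex.Re z ^+ 2 + complex.Im z ^+ 2.
  by case: z => u v; rewrite /cabs /= sqr_sqrtr// addr_ge0 ?sqr_ge0.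
rewrite -mulrA -exprMn -[cabs c * _]Normc.normcM -/(cabs _).
move: (c * x) => {c}x; rewrite !sq.
case: x => a b; case: y => c d /=.
have := sqr_ge0 (a - c); have := sqr_ge0 (b - d).
rewrite !sqrrD !sqrrN; nra.
Qed.

Lemma sq_summable_submod : GRing.submod_closed sq_summable_pred.
Proof.
split=> [|c x y].
  rewrite unfold_in /sq_summable_pred; apply/asboolP; rewrite /sq_summable /sq_sum.
  by rewrite eseries0 ?ltry// => n _ _; rewrite cabs0 expr0n.
rewrite !unfold_in /sq_summable_pred => /asboolP xs /asboolP ys; apply/asboolP.
rewrite /sq_summable /sq_sum.
apply: (@le_lt_trans _ _ (\sum_(0 <= n <oo)
    ((2 * cabs c ^+ 2)%:E * (cabs (x n) ^+ 2)%:E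
     + 2%:E * (cabs (y n) ^+ 2)%:E))%E).
  apply: lee_nneseries => [n _ _|n _]; first by rewrite lee_fin sqr_ge0.
  by rewrite -!EFinM -EFinD lee_fin; exact: cabs_sqD_le.
rewrite nneseriesD; last 2 first.
- move=> n _ _; rewrite -EFinM lee_fin.
  exact: mulr_ge0 (mulr_ge0 (ler0n _ 2) (sqr_ge0 _)) (sqr_ge0 _).
- move=> n _ _; rewrite -EFinM lee_fin.
  exact: mulr_ge0 (ler0n _ 2) (sqr_ge0 _).
rewrite !nneseriesZl//; last 2 first.
- by move=> n _; rewrite lee_fin sqr_ge0.
- by move=> n _; rewrite lee_fin sqr_ge0.
rewrite lte_add_pinfty// lte_mul_pinfty// lee_fin.
exact: mulr_ge0 (ler0n _ 2) (sqr_ge0 _).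
Qed.

HB.instance Definition _ :=
  GRing.isSubmodClosed.Build C (nat -> C) sq_summable_pred sq_summable_submod.

Record l2 := L2 { l2val :> nat -> C ; _ : l2val \in sq_summable_pred }.
HB.instance Definition _ := [isSub for l2val].
HB.instance Definition _ := [Choice of l2 by <:].
HB.instance Definition _ := [SubChoice_isSubLmodule of l2 by <:].
End square_summable_sequences.

Arguments l2 : clear implicits.

Section operators.
Context {R : realType}.
Local Notation C := (cplx R).
Local Notation l2 := (l2 R).
Implicit Types (S T : l2 -> l2) (x y : l2).

Definition l2norm x : R := Num.sqrt (fine (sq_sum x)).

Definition l2dot x y : C := limn (series (fun n => (x n)^* * y n)).

Definition bounded_op T : Prop :=
  linear T /\ exists M : R, forall x, l2norm (T x) <= M * l2norm x.

Definition is_adjoint T S : Prop := forall x y, l2dot (T x) y = l2dot x (S y).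

Definition is_inverse T S : Prop :=
  [/\ bounded_op S, T \o S = idfun & S \o T = idfun].

Definition is_positive_sqrt T S : Prop :=
  [/\ bounded_op S, forall x, 0 <= l2dot x (S x) & S \o S = T].

(* In each case the operator with the given property is unique if it exists;
   otherwise the result is the zero operator. *)
Definition adjoint T : l2 -> l2 := xget 0 [set S | is_adjoint T S].
Definition inverse T : l2 -> l2 := xget 0 [set S | is_inverse T S].
Definition positive_sqrt T : l2 -> l2 := xget 0 [set S | is_positive_sqrt T S].

(* The operator given by an infinite matrix acting on column vectors (meant for
   matrices [M] such that [M x] is defined and in [l2] for all [x] in [l2]). *)
Definition matrix_op (M : nat -> nat -> C) : l2 -> l2 := fun x =>
  insubd 0 (fun k => limn (series (fun n => M k n * x n))).

Lemma sq_summable_unit (n : nat) :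
  (fun k => (k == n)%:R : C) \in sq_summable_pred.
Proof.
rewrite unfold_in; apply/asboolP; rewrite /sq_summable /sq_sum.
rewrite (nneseries_split 0 n.+1)/=; last by move=> k _; rewrite lee_fin sqr_ge0.
rewrite [X in (_ + X)%E]eseries0 => [|k kn _]; last first.
  by rewrite gtn_eqF// cabs0 expr0n.
by rewrite adde0 sumEFin ltry.
Qed.

Definition unit_vector (n : nat) : l2 := L2 (sq_summable_unit n).

Definition matrix_entry T (k n : nat) : C := T (unit_vector n) k.

Definition defect (A : l2 -> l2) : l2 -> l2 :=
  positive_sqrt (idfun - (A \o adjoint A)).

Definition mobius (A T : l2 -> l2) : l2 -> l2 :=
  inverse (defect A) \o (T + A) \o inverse (idfun + (adjoint A \o T))
    \o defect (adjoint A).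

Definition unitary_op T : Prop :=
  [/\ bounded_op T, adjoint T \o T = idfun & T \o adjoint T = idfun].

Definition spectrum T : set C :=
  [set lambda | ~ exists S, is_inverse ((fun x => lambda *: x) - T) S].

Definition op_eigenspace T (lambda : C) : set l2 := [set x | T x = lambda *: x].

Definition is_eigenvalue T (lambda : C) : Prop :=
  exists2 x, x != 0 & op_eigenspace T lambda x.

Definition spanned_line (x : l2) : set l2 := [set y | exists c : C, y = c *: x].

Definition is_mass_point (mu : set (borel_cplx R) -> \bar R) (lambda : C) : Prop :=
  (0 < mu [set lambda])%E.

Definition geometric_multiplicity_one T (lambda : C) : Prop :=
  exists2 x, x != 0 & op_eigenspace T lambda = spanned_line x.

Definition orthogonal_projection P : Prop :=
  [/\ bounded_op P, P \o P = P & is_adjoint P P].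

(* Resolution of the identity [E] on the Borel subsets of the plane, carried by
   the circle, with [T = \int z dE(z)] in the weak sense.  By polarization it
   suffices to consider the positive measures [D |-> <x, E(D) x>]. *)
Definition is_spectral_measure T (E : set (borel_cplx R) -> l2 -> l2) : Prop :=
  [/\ forall D, measurable D -> orthogonal_projection (E D),
      E (@unit_circle R) = idfun,
      forall D D', measurable D -> measurable D' ->
        E (D `&` D') = E D \o E D' &
      forall x, exists nu : {measure set (borel_cplx R) -> \bar R},
        (forall D, measurable D ->
           nu D \is a fin_num /\ l2dot x (E D x) = real_complex R (fine (nu D))) /\
        l2dot x (T x) = circle_integral nu idfun].

End operators.

(* Main.v *)
(* Mathematical idea.  Since [log mu'] is not integrable, Szego's theorem puts [z^-1] in the
   [L2(mu)]-closure of the polynomials, hence polynomials are dense in [L2(mu)].  As the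
   [alpha n] stay away from the circle, the span of the Blaschke products is uniformly
   dense in the polynomials (Cauchy kernels are uniform limits of their interpolants), so
   the ORF form an orthonormal basis and identify [L2(mu)] with [l2].

   The ORF recurrence reads
     [(z - alpha_n) phi_n / eta_n = \sum_k h_kn (1 - alpha_k^* z) phi_k / eta_k],
   that is, [M (1 + A^* H) = H + A] up to conjugation by [eta], where [M] is the matrix of
   multiplication by [z]: the Moebius transform [V] of [H] is multiplication by [z] in the
   basis of the ORF.  Its functional calculus [g |-> M_g], for bounded Borel [g], then
   gives the spectrum and the eigenvectors [1_{lambda}].  If [(phi_n(lambda))_n] is in
   [l2] and [lambda] is not a pole, the recurrence makes it a left eigenvector of [V],
   hence an eigenvector since [V] is unitary.

   For a spectral measure [E] of [V], induction on [k] gives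
   [<x, V^k y> = \int z^k d<x, E y>], so [<e_0, E e_0>] and [mu] have the same moments and
   coincide on the circle. *)

(* No quotient space L2(mu) is formed: functions are bounded Borel functions on the circle, and
   identities between operators on [l2] are checked on unit vectors. A vector of [l2] need not come
   from a bounded function, so multiplication operators are given by their matrices. Approximation
   rests on one fact: on the circle, real parts of polynomials generate all bounded Borel functions
   by iterated bounded pointwise limits. This carries the inequality J <= exp (int u dm) * int exp
   (- u) dmu from polynomials to the truncated logarithm of mu', gives density of the polynomials
   once conj z is in their closure, and determines a measure from its moments of order k >= 0.

   The inverse inside the Moebius transform exists as a Neumann series, since ||A|| < 1 and ||H|| <=
   1. It is never computed: each use multiplies it out. In the criterion on the sequence
   phi_n(lambda), lambda may lie off the circle, even at a zero of some B_n, where multiplication by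
   z on the circle says nothing; the recurrence is extended there by continuity and read as an
   identity for a functional on [l2]. *)
Require Import Defs.
From HB Require Import structures.
From mathcomp Require Import all_boot all_order all_algebra.
From mathcomp Require Import complex ring lra.
From mathcomp Require Import all_classical all_reals all_analysis.
From mathcomp Require Import measurable_realfun.

Set Implicit Arguments.
Unset Strict Implicit.
Unset Printing Implicit Defensive.

Import Order.TTheory GRing.Theory Num.Theory.
Import numFieldNormedType.Exports.

Local Open Scope classical_set_scope.
Local Open Scope ring_scope.

(** * Complex moduli and limits *)

Section complex_modulus.
Context {R : realType}.
Local Notation C := (cplx R).
Local Notation toC := (real_complex R).
Implicit Types (x y z c : C) (r s : R).

Lemma ReD x y : complex.Re (x + y) = complex.Re x + complex.Re y.
Proof. by case: x y => a b [c d]. Qed.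

Lemma ImD x y : complex.Im (x + y) = complex.Im x + complex.Im y.
Proof. by case: x y => a b [c d]. Qed.

Lemma ReN x : complex.Re (- x) = - complex.Re x.
Proof. by case: x. Qed.

Lemma ImN x : complex.Im (- x) = - complex.Im x.
Proof. by case: x. Qed.

Lemma ReB x y : complex.Re (x - y) = complex.Re x - complex.Re y.
Proof. by rewrite ReD ReN. Qed.

Lemma ImB x y : complex.Im (x - y) = complex.Im x - complex.Im y.
Proof. by rewrite ImD ImN. Qed.

Lemma ReM x y : complex.Re (x * y) =
  complex.Re x * complex.Re y - complex.Im x * complex.Im y.
Proof. by case: x y => a b [c d]. Qed.

Lemma ImM x y : complex.Im (x * y) =
  complex.Re x * complex.Im y + complex.Im x * complex.Re y.
Proof. by case: x y => a b [c d]. Qed.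

Lemma ReC r : complex.Re (toC r) = r. Proof. by []. Qed.
Lemma ImC r : complex.Im (toC r) = 0. Proof. by []. Qed.

Lemma cplx_eq x y : complex.Re x = complex.Re y -> complex.Im x = complex.Im y ->
  x = y.
Proof. by case: x y => a b [c d] /= -> ->. Qed.

Lemma Re_conj x : complex.Re (x^*) = complex.Re x.
Proof. by case: x. Qed.

Lemma Im_conj x : complex.Im (x^*) = - complex.Im x.
Proof. by case: x. Qed.

Lemma Re_sum (I : Type) (s : seq I) (P : pred I) (F : I -> C) :
  complex.Re (\sum_(i <- s | P i) F i) = \sum_(i <- s | P i) complex.Re (F i).
Proof. by apply: (big_morph (fun z : C => complex.Re z) ReD). Qed.

Lemma Im_sum (I : Type) (s : seq I) (P : pred I) (F : I -> C) :
  complex.Im (\sum_(i <- s | P i) F i) = \sum_(i <- s | P i) complex.Im (F i).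
Proof. by apply: (big_morph (fun z : C => complex.Im z) ImD). Qed.

Lemma toC_sum (I : Type) (s : seq I) (P : pred I) (F : I -> R) :
  toC (\sum_(i <- s | P i) F i) = \sum_(i <- s | P i) toC (F i) :> C.
Proof. exact: (rmorph_sum (real_complex R)). Qed.

Lemma toCM r s : toC (r * s) = toC r * toC s :> C.
Proof. exact: (rmorphM (real_complex R)). Qed.
Lemma toCD r s : toC (r + s) = toC r + toC s :> C.
Proof. exact: (rmorphD (real_complex R)). Qed.
Lemma toCB r s : toC (r - s) = toC r - toC s :> C.
Proof. exact: (rmorphB (real_complex R)). Qed.
Lemma toCX r n : toC (r ^+ n) = toC r ^+ n :> C.
Proof. exact: (rmorphXn (real_complex R)). Qed.
Lemma conj_toC r : (toC r : C)^* = toC r.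
Proof. by apply: cplx_eq; rewrite ?Re_conj ?Im_conj //= oppr0. Qed.

Lemma cabsE x : cabs x = Num.sqrt (complex.Re x ^+ 2 + complex.Im x ^+ 2).
Proof. by case: x. Qed.

Lemma sqr_cabs x : cabs x ^+ 2 = complex.Re x ^+ 2 + complex.Im x ^+ 2.
Proof. by rewrite cabsE sqr_sqrtr// addr_ge0 ?sqr_ge0. Qed.

Lemma cabs_ge0 x : 0 <= cabs x. Proof. by rewrite cabsE sqrtr_ge0. Qed.

Lemma normE x : `|x| = toC (cabs x). Proof. by rewrite cabsE; exact: normc_def. Qed.

Lemma cabsM x y : cabs (x * y) = cabs x * cabs y.
Proof. exact: Normc.normcM. Qed.
Lemma cabsV x : cabs x^-1 = (cabs x)^-1.
Proof. exact: Normc.normcV. Qed.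
Lemma cabsN x : cabs (- x) = cabs x.
Proof. by rewrite !cabsE ReN ImN !sqrrN. Qed.
Lemma cabsBC x y : cabs (x - y) = cabs (y - x).
Proof. by rewrite -cabsN opprB. Qed.
Lemma cabs1 : cabs (1 : C) = 1.
Proof. exact: Normc.normc1. Qed.
Lemma cabsD x y : cabs (x + y) <= cabs x + cabs y.
Proof. exact: le_normcD. Qed.
Lemma cabsX x n : cabs (x ^+ n) = cabs x ^+ n.
Proof. by elim: n => [|n IH]; rewrite ?expr0 ?cabs1// !exprS cabsM IH. Qed.
Lemma cabs_conj x : cabs (x^*) = cabs x.
Proof. by rewrite !cabsE Re_conj Im_conj sqrrN. Qed.
Lemma cabs_toC r : cabs (toC r : C) = `|r|.
Proof. by rewrite cabsE /= expr0n addr0 sqrtr_sqr. Qed.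
Lemma cabs_eq0 x : (cabs x == 0) = (x == 0).
Proof.
apply/eqP/eqP => [|->]; last exact: cabs0.
exact: Normc.eq0_normc.
Qed.
Lemma cabs_gt0 x : (0 < cabs x) = (x != 0).
Proof. by rewrite lt_neqAle cabs_ge0 andbT eq_sym cabs_eq0. Qed.

Lemma Re_le_cabs x : `|complex.Re x| <= cabs x.
Proof.
rewrite -sqrtr_sqr cabsE; apply: ler_wsqrtr.
by rewrite lerDl sqr_ge0.
Qed.
Lemma Im_le_cabs x : `|complex.Im x| <= cabs x.
Proof.
rewrite -sqrtr_sqr cabsE; apply: ler_wsqrtr.
by rewrite lerDr sqr_ge0.
Qed.
Lemma cabs_le_ReIm x : cabs x <= `|complex.Re x| + `|complex.Im x|.
Proof.
rewrite -(@ler_pXn2r _ 2) ?nnegrE ?addr_ge0 ?cabs_ge0// sqr_cabs.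
rewrite -[complex.Re x ^+ 2]real_normK ?num_real// -[complex.Im x ^+ 2]real_normK ?num_real//.
have := normr_ge0 (complex.Re x); have := normr_ge0 (complex.Im x).
nra.
Qed.

Lemma conjM_cabs x : x^* * x = toC (cabs x ^+ 2).
Proof.
apply: cplx_eq; rewrite ?ReM ?ImM Re_conj Im_conj /= ?sqr_cabs//; ring.
Qed.

Lemma norm_lt_toC x (e : C) : 0 < e -> (`|x| < e) = (cabs x < complex.Re e).
Proof.
rewrite normE; case: e => a b; rewrite !ltcE /= => /andP[/eqP b0 _].
by rewrite b0 eqxx.
Qed.

Lemma norm_lt1 x : (`|x| < 1) = (cabs x < 1).
Proof. by rewrite norm_lt_toC// ltr01. Qed.

Lemma norm_eq1 x : `|x| = 1 <-> cabs x = 1.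
Proof.
rewrite normE; split=> [|->]; last by [].
by move/(congr1 (@complex.Re R)).
Qed.

Lemma conj_sum (I : Type) (s : seq I) (P : pred I) (F : I -> C) :
  (\sum_(i <- s | P i) F i)^* = \sum_(i <- s | P i) (F i)^*.
Proof. exact: rmorph_sum. Qed.

Lemma conjM x y : (x * y)^* = x^* * y^*.
Proof. exact: rmorphM. Qed.
Lemma conjD x y : (x + y)^* = x^* + y^*.
Proof. exact: rmorphD. Qed.
Lemma conjB x y : (x - y)^* = x^* - y^*.
Proof. exact: rmorphB. Qed.
Lemma conjV x : (x^-1)^* = (x^*)^-1.
Proof. exact: fmorphV. Qed.
Lemma cvg_cplx (u : nat -> C) (l : C) :
  (fun n => complex.Re (u n)) @ \oo --> complex.Re l ->
  (fun n => complex.Im (u n)) @ \oo --> complex.Im l ->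
  u @ \oo --> l.
Proof.
move=> /cvgrPdist_lt cr /cvgrPdist_lt ci.
apply/cvgrPdist_lt => e e0.
have er : 0 < complex.Re e / 2.
  by rewrite divr_gt0//; move: e0; rewrite ltcE => /andP[].
near=> n; rewrite norm_lt_toC//.
apply: le_lt_trans (cabs_le_ReIm _) _; rewrite ReB ImB [ltRHS]splitr ltrD//.
  by near: n; exact: cr.
by near: n; exact: ci.
Unshelve. all: by end_near. Qed.

Lemma cvg_cplx_cabs (u : nat -> C) (l : C) (b : nat -> R) :
  (forall n, cabs (l - u n) <= b n) -> b @ \oo --> 0 -> u @ \oo --> l.
Proof.
move=> ub /cvgrPdist_lt b0; apply/cvgrPdist_lt => e e0.
have er : 0 < complex.Re e by move: e0; rewrite ltcE => /andP[].
near=> n; rewrite norm_lt_toC//.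
apply: le_lt_trans (ub n) _.
have : `|0 - b n| < complex.Re e by near: n; exact: b0.
by rewrite sub0r normrN; apply: le_lt_trans; rewrite ler_norm.
Unshelve. all: by end_near. Qed.

Lemma cvg_cplx_cabsP (u : nat -> C) (l : C) :
  u @ \oo --> l -> (fun n => cabs (l - u n)) @ \oo --> (0 : R).
Proof.
move=> /cvgrPdist_lt cu; apply/cvgrPdist_lt => e e0.
near=> n; rewrite sub0r normrN ger0_norm ?cabs_ge0//.
have : `|l - u n| < toC e by near: n; apply: cu; rewrite ltcR.
by rewrite norm_lt_toC// ltcR.
Unshelve. all: by end_near. Qed.

Lemma cvg_Re (u : nat -> C) (l : C) :
  u @ \oo --> l -> (fun n => complex.Re (u n)) @ \oo --> complex.Re l.
Proof.
move=> /cvg_cplx_cabsP/cvgrPdist_lt cu; apply/cvgrPdist_lt => e e0.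
near=> n; rewrite -ReB; apply: le_lt_trans (Re_le_cabs _) _.
rewrite -[cabs _]ger0_norm ?cabs_ge0// -[X in `|X|]opprK normrN -sub0r.
by near: n; exact: cu.
Unshelve. all: by end_near. Qed.

Lemma cvg_Im (u : nat -> C) (l : C) :
  u @ \oo --> l -> (fun n => complex.Im (u n)) @ \oo --> complex.Im l.
Proof.
move=> /cvg_cplx_cabsP/cvgrPdist_lt cu; apply/cvgrPdist_lt => e e0.
near=> n; rewrite -ImB; apply: le_lt_trans (Im_le_cabs _) _.
rewrite -[cabs _]ger0_norm ?cabs_ge0// -[X in `|X|]opprK normrN -sub0r.
by near: n; exact: cu.
Unshelve. all: by end_near. Qed.

Lemma cvg_cabs (u : nat -> C) (l : C) :
  u @ \oo --> l -> (fun n => cabs (u n)) @ \oo --> cabs l.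
Proof.
move=> /cvg_cplx_cabsP/cvgrPdist_lt cu; apply/cvgrPdist_lt => e e0.
near=> n.
have h : cabs (l - u n) < e.
  rewrite -[cabs _]ger0_norm ?cabs_ge0// -[X in `|X|]opprK normrN -sub0r.
  by near: n; exact: cu.
apply: le_lt_trans h; rewrite ler_norml; apply/andP; split.
  rewrite cabsBC lerNl opprB lerBlDr; apply: le_trans (cabsD _ _).
  by rewrite subrK.
by rewrite lerBlDr; apply: le_trans (cabsD _ _); rewrite subrK.
Unshelve. all: by end_near. Qed.

End complex_modulus.

(** * Bounded Borel functions on the circle *)

Section bounded_borel.
Context {R : realType}.
Local Notation C := (cplx R).
Local Notation T := (borel_cplx R).
Local Notation circ := (@unit_circle R : set (borel_cplx R)).

Lemma open_measurable_cplx (U : set C) : open U -> measurable (U : set T).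
Proof. by move=> oU; apply: sub_gen_smallest. Qed.

Lemma continuous_cplx_measurable (f : C -> R) : continuous f ->
  measurable_fun setT (f : T -> R).
Proof.
move=> cf; apply: (measurability _ (RGenOpens.measurableE R)) => _ [_ [a [b ->]] <-].
rewrite setTI; apply: open_measurable_cplx.
by apply: open_comp => [z _|]; [exact: cf|exact: interval_open].
Qed.

Lemma nbhs_cplx (z : C) (e : R) : 0 < e -> nbhs z [set t | cabs (z - t) < e].
Proof.
move=> e0.
have e0' : 0 < real_complex R e :> C by rewrite ltcR.
have H : (fun t : C => t) t @[t --> z] --> z by exact: cvg_id.
have := @cvgr_dist_lt C C C (nbhs z) (nbhs_filter z) (fun t => t) z H _ e0'.
by apply: filterS => t; rewrite norm_lt_toC.
Qed.

Lemma continuous_Re : continuous (fun z : C => complex.Re z).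
Proof.
move=> z; apply/(@cvgrPdist_lt _ _ _ _ (nbhs_filter z)) => e e0.
apply: (filterS _ (nbhs_cplx z e0)) => t /= h.
by rewrite -ReB; apply: le_lt_trans (Re_le_cabs _) h.
Qed.

Lemma continuous_Im : continuous (fun z : C => complex.Im z).
Proof.
move=> z; apply/(@cvgrPdist_lt _ _ _ _ (nbhs_filter z)) => e e0.
apply: (filterS _ (nbhs_cplx z e0)) => t /= h.
by rewrite -ImB; apply: le_lt_trans (Im_le_cabs _) h.
Qed.

Lemma measurable_Re : measurable_fun setT (fun z : T => complex.Re (z : C)).
Proof. exact: continuous_cplx_measurable continuous_Re. Qed.
Lemma measurable_Im : measurable_fun setT (fun z : T => complex.Im (z : C)).
Proof. exact: continuous_cplx_measurable continuous_Im. Qed.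

Lemma measurable_cabs (D : set T) (f : T -> C) :
  measurable_fun D (fun z => complex.Re (f z)) ->
  measurable_fun D (fun z => complex.Im (f z)) ->
  measurable_fun D (fun z => cabs (f z)).
Proof.
move=> fr fi.
have -> : (fun z => cabs (f z)) = Num.sqrt \o
    (fun z => complex.Re (f z) ^+ 2 + complex.Im (f z) ^+ 2).
  by apply/funext => z /=; rewrite cabsE.
apply: measurableT_comp.
  by apply: continuous_measurable_fun; exact: sqrt_continuous.
by apply: measurable_funD; apply: measurable_funX.
Qed.

Lemma measurable_circ : measurable circ.
Proof.
have mc : measurable_fun setT (fun z : T => cabs (z : C)).
  by apply: measurable_cabs; [exact: measurable_Re|exact: measurable_Im].
have -> : circ = setT `&` (fun z : T => cabs (z : C)) @^-1` [set 1].
  by rewrite setTI; apply/seteqP; split => z; rewrite /unit_circle/= norm_eq1.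
exact: mc.
Qed.

Lemma measurable_point (l : C) : measurable ([set l] : set T).
Proof.
have mc : measurable_fun setT (fun z : T => cabs ((z : C) - l)).
  apply: measurable_cabs.
    under eq_fun do rewrite ReB.
    by apply: measurable_funB => //; exact: measurable_Re.
  under eq_fun do rewrite ImB.
  by apply: measurable_funB => //; exact: measurable_Im.
have -> : [set l] = setT `&` (fun z : T => cabs ((z : C) - l)) @^-1` [set 0].
  rewrite setTI; apply/seteqP; split => z /=; first by move=> ->; rewrite subrr cabs0.
  by move/eqP; rewrite cabs_eq0 subr_eq0 => /eqP.
exact: mc.
Qed.

(** Nothing is asked off the circle: rational functions have poles there, and every integral is
    taken over the circle. *)
Definition bB (f : C -> R) := measurable_fun circ (f : T -> R) /\
  exists M, forall z, circ z -> `|f z| <= M.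

Lemma bB_cst r : bB (fun=> r).
Proof. by split=> //; exists `|r|. Qed.

Lemma bBD f g : bB f -> bB g -> bB (fun z => f z + g z).
Proof.
move=> [mf [M fM]] [mg [N gN]]; split; first exact: measurable_funD.
by exists (M + N) => z cz; rewrite (le_trans (ler_normD _ _))// lerD ?fM ?gN.
Qed.

Lemma bBM f g : bB f -> bB g -> bB (fun z => f z * g z).
Proof.
move=> [mf [M fM]] [mg [N gN]]; split; first exact: measurable_funM.
by exists (M * N) => z cz; rewrite normrM ler_pM ?fM ?gN.
Qed.

Lemma bBZ r f : bB f -> bB (fun z => r * f z).
Proof. by move=> bf; apply: bBM => //; exact: bB_cst. Qed.

Lemma bBN f : bB f -> bB (fun z => - f z).
Proof. 
move=> bf; have := bBZ (-1) bf.
by under [X in bB X -> _]eq_fun do rewrite mulN1r.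
Qed.

Lemma bBB f g : bB f -> bB g -> bB (fun z => f z - g z).
Proof. by move=> bf bg; apply: (bBD bf); exact: bBN. Qed.

Lemma bBX f n : bB f -> bB (fun z => f z ^+ n).
Proof.
move=> bf; elim: n => [|n IH]; first exact: bB_cst.
by under eq_fun do rewrite exprS; exact: bBM.
Qed.

Lemma bB_sum (I : Type) (s : seq I) (F : I -> C -> R) :
  (forall i, bB (F i)) -> bB (fun z => \sum_(i <- s) F i z).
Proof.
move=> bF; elim: s => [|i s IH].
  by under eq_fun do rewrite big_nil; exact: bB_cst.
by under eq_fun do rewrite big_cons; exact: bBD.
Qed.

Lemma bB_comp (h : R -> R) f : measurable_fun setT h ->
  (forall r, exists M, forall x, `|x| <= r -> `|h x| <= M) ->
  bB f -> bB (fun z => h (f z)).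
Proof.
move=> mh bh [mf [M fM]]; split; first exact: (measurableT_comp mh).
by have [N hN] := bh M; exists N => z cz; exact/hN/fM.
Qed.

Lemma bB_ext f g : (forall z, circ z -> f z = g z) -> bB f -> bB g.
Proof.
move=> fg [mf [M fM]]; split.
  apply: eq_measurable_fun mf => z; rewrite inE => cz; exact: fg.
by exists M => z cz; rewrite -fg// fM.
Qed.

Lemma bB_ind (D : set T) : measurable D -> bB (\1_D : C -> R).
Proof.
move=> mD; split; first exact: measurable_indic.
by exists 1 => z _; rewrite indicE; case: (_ \in _); rewrite ?normr1 ?normr0.
Qed.

Lemma bB_Re : bB (fun z => complex.Re z).
Proof.
split; first by apply: measurable_funTS; exact: measurable_Re.
by exists 1 => z; rewrite /unit_circle/= norm_eq1 => <-; exact: Re_le_cabs.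
Qed.

Lemma bB_Im : bB (fun z => complex.Im z).
Proof.
split; first by apply: measurable_funTS; exact: measurable_Im.
by exists 1 => z; rewrite /unit_circle/= norm_eq1 => <-; exact: Im_le_cabs.
Qed.

Lemma bB_lim (f : nat -> C -> R) g M : (forall n, bB (f n)) ->
  (forall n z, circ z -> `|f n z| <= M) ->
  (forall z, circ z -> f n z @[n --> \oo] --> g z) -> bB g.
Proof.
move=> bf fM fg; split.
  apply: (@measurable_fun_cvg _ T R circ (fun n => f n : T -> R)) => // n.
  by case: (bf n).
exists M => z cz.
have h : `|f n z| @[n --> \oo] --> `|g z| by apply: cvg_norm; exact: fg.
by apply: (cvgr_to_le h); apply: nearW => n; exact: fM.
Qed.

Definition cint (m : {measure set T -> \bar R}) (f : C -> R) : R :=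
  \int[m]_(z in circ) f z.

Section finite_measure_integral.
Context (m : {measure set T -> \bar R}) (mfin : (m circ < +oo)%E).

Lemma bB_integrable f : bB f -> m.-integrable circ (EFin \o f : T -> \bar R).
Proof.
move=> [mf [M fM]]; apply: measurable_bounded_integrable => //.
- exact: measurable_circ.
- exists M; split; first by rewrite num_real.
  by move=> y My z cz /=; rewrite (le_trans (fM _ cz))// ltW.
Qed.

Lemma cintD f g : bB f -> bB g -> cint m (fun z => f z + g z) = cint m f + cint m g.
Proof.
by move=> bf bg; rewrite /cint RintegralD//; try exact: bB_integrable; exact: measurable_circ.
Qed.

Lemma cintZ r f : bB f -> cint m (fun z => r * f z) = r * cint m f.
Proof.
by move=> bf; rewrite /cint RintegralZl//; try exact: bB_integrable; exact: measurable_circ.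
Qed.

Lemma cintN f : bB f -> cint m (fun z => - f z) = - cint m f.
Proof.
move=> bf; rewrite -mulN1r -cintZ//; congr cint.
by apply/funext => z; rewrite mulN1r.
Qed.

Lemma cintB f g : bB f -> bB g -> cint m (fun z => f z - g z) = cint m f - cint m g.
Proof. by move=> bf bg; rewrite cintD ?cintN//; exact: bBN. Qed.

Lemma cint_sum (I : Type) (s : seq I) (F : I -> C -> R) :
  (forall i, bB (F i)) ->
  cint m (fun z => \sum_(i <- s) F i z) = \sum_(i <- s) cint m (F i).
Proof.
move=> bF; elim: s => [|i s IH].
  rewrite big_nil /cint; under eq_Rintegral do rewrite big_nil.
  by rewrite Rintegral_cst ?mul0r//; exact: measurable_circ.
rewrite big_cons -IH -cintD//; last exact: bB_sum.
by congr cint; apply/funext => z; rewrite big_cons.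
Qed.

Lemma cint_le f g : bB f -> bB g -> (forall z, circ z -> f z <= g z) ->
  cint m f <= cint m g.
Proof.
move=> bf bg fg; apply: le_Rintegral => //; try exact: bB_integrable.
exact: measurable_circ.
Qed.

Lemma cint_ge0 f : (forall z, circ z -> 0 <= f z) -> 0 <= cint m f.
Proof. by move=> fg; apply: Rintegral_ge0. Qed.

Lemma cint_ext f g : (forall z, circ z -> f z = g z) -> cint m f = cint m g.
Proof. by move=> fg; apply: eq_Rintegral => z; rewrite inE => cz; exact: fg. Qed.

Lemma cint_cst r : cint m (fun=> r) = r * fine (m circ).
Proof. by rewrite /cint Rintegral_cst//; exact: measurable_circ. Qed.

Lemma cint_ind (D : set T) : measurable D -> cint m (\1_D : C -> R) = fine (m (D `&` circ)).
Proof.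
by move=> mD; rewrite /cint /Rintegral integral_indic//; exact: measurable_circ.
Qed.

Lemma cint_cvg (f : nat -> C -> R) g M : (forall n, bB (f n)) ->
  (forall n z, circ z -> `|f n z| <= M) ->
  (forall z, circ z -> f n z @[n --> \oo] --> g z) ->
  cint m (f n) @[n --> \oo] --> cint m g.
Proof.
move=> bf fM fg; have bg := bB_lim bf fM fg.
have cE : {ae m, forall z, circ z -> (f n z)%:E @[n --> \oo] --> (g z)%:E}.
  apply: aeW => z cz; apply: cvg_EFin; first exact: nearW.
  exact: fg.
have dE : {ae m, forall z n, circ z -> (`|(f n z)%:E| <= (fun=> M%:E) z)%E}.
  by apply: aeW => z n cz; exact: fM.
have [_ _] := dominated_convergence measurable_circ
  (fun n => measurable_int _ (bB_integrable (bf n)))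
  (measurable_int _ (bB_integrable bg)) cE (bB_integrable (bB_cst M)) dE.
move=> h; apply: fine_cvg; rewrite fineK//.
by apply: integrable_fin_num => //; [exact: measurable_circ|exact: bB_integrable].
Qed.

Lemma bB_norm f : bB f -> bB (fun z => `|f z|).
Proof.
move=> [mf [M fM]]; split; first exact: measurableT_comp.
by exists M => z cz; rewrite normr_id fM.
Qed.

Lemma cint_null f (N : set T) : measurable N -> m N = 0%E -> bB f ->
  (forall z, circ z -> ~ N z -> f z = 0) -> cint m f = 0.
Proof.
move=> mN N0 bf f0; have [_ [M fM]] := bf.
have NC0 : fine (m (N `&` circ)) = 0.
  rewrite (_ : m (N `&` circ) = 0%E)//; apply/eqP; rewrite eq_le measure_ge0 andbT.
  rewrite -N0 le_measure ?inE//.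
  by apply: measurableI => //; exact: measurable_circ.
have bM : bB (fun z => M * \1_N z) by apply: bBZ; exact: bB_ind.
have H z : circ z -> `|f z| <= M * \1_N z.
  move=> cz; rewrite indicE; case: (boolP (z \in N)) => [_|/negP]; rewrite ?mulr1 ?fM//.
  by rewrite inE => Nz; rewrite f0// normr0 mulr0.
have I0 : cint m (fun z => M * \1_N z) = 0.
  by rewrite cintZ ?cint_ind ?NC0 ?mulr0//; exact: bB_ind.
apply/eqP; rewrite -normr_le0 ler_norml oppr0; apply/andP; split.
  rewrite -oppr0 -I0 -cintN//; apply: cint_le => //; first exact: bBN.
  by move=> z cz; rewrite lerNl (le_trans _ (H z cz))// -normrN ler_norm.
rewrite -I0; apply: cint_le => // z cz.
by rewrite (le_trans _ (H z cz))// ler_norm.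
Qed.

End finite_measure_integral.
End bounded_borel.

(** * Complex bounded Borel functions and the class generated by polynomials *)

Section complex_bounded_borel.
Context {R : realType}.
Local Notation C := (cplx R).
Local Notation T := (borel_cplx R).
Local Notation circ := (@unit_circle R : set (borel_cplx R)).

Definition cB (f : C -> C) :=
  bB (fun z => complex.Re (f z)) /\ bB (fun z => complex.Im (f z)).

Lemma cB_cst c : cB (fun=> c).
Proof. by split; exact: bB_cst. Qed.

Lemma cB_id : cB (fun z => z).
Proof. by split; [exact: bB_Re|exact: bB_Im]. Qed.

Lemma cBD f g : cB f -> cB g -> cB (fun z => f z + g z).
Proof.
move=> [fr fi] [gr gi]; split.
  by under eq_fun do rewrite ReD; exact: bBD.
by under eq_fun do rewrite ImD; exact: bBD.
Qed.

Lemma cBN f : cB f -> cB (fun z => - f z).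
Proof.
move=> [fr fi]; split.
  by under eq_fun do rewrite ReN; exact: bBN.
by under eq_fun do rewrite ImN; exact: bBN.
Qed.

Lemma cBB f g : cB f -> cB g -> cB (fun z => f z - g z).
Proof. by move=> bf bg; apply: (cBD bf); exact: cBN. Qed.

Lemma cBM f g : cB f -> cB g -> cB (fun z => f z * g z).
Proof.
move=> [fr fi] [gr gi]; split.
  by under eq_fun do rewrite ReM; apply: bBB; exact: bBM.
by under eq_fun do rewrite ImM; apply: bBD; exact: bBM.
Qed.

Lemma cB_conj f : cB f -> cB (fun z => (f z)^*).
Proof.
move=> [fr fi]; split.
  by under eq_fun do rewrite Re_conj.
by under eq_fun do rewrite Im_conj; exact: bBN.
Qed.

Lemma cBX f n : cB f -> cB (fun z => f z ^+ n).
Proof.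
move=> bf; elim: n => [|n IH]; first exact: cB_cst.
by under eq_fun do rewrite exprS; exact: cBM.
Qed.

Lemma cB_sum (I : Type) (s : seq I) (F : I -> C -> C) :
  (forall i, cB (F i)) -> cB (fun z => \sum_(i <- s) F i z).
Proof.
move=> bF; elim: s => [|i s IH].
  by under eq_fun do rewrite big_nil; exact: cB_cst.
by under eq_fun do rewrite big_cons; exact: cBD.
Qed.

Lemma cB_poly (p : {poly C}) : cB (fun z => p.[z]).
Proof.
under eq_fun do rewrite horner_coef.
by apply: cB_sum => i; apply: cBM; [exact: cB_cst|apply: cBX; exact: cB_id].
Qed.

Lemma cB_ext f g : (forall z, circ z -> f z = g z) -> cB f -> cB g.
Proof.
by move=> fg [fr fi]; split; [apply: (bB_ext _ fr)|apply: (bB_ext _ fi)] => z cz;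
  rewrite fg.
Qed.

Lemma cB_toC f : bB f -> cB (fun z => real_complex R (f z)).
Proof. by move=> bf; split => //=; exact: bB_cst. Qed.

Lemma bB_cabs2 f : cB f -> bB (fun z => cabs (f z) ^+ 2).
Proof.
by move=> [fr fi]; under eq_fun do rewrite sqr_cabs; apply: bBD; exact: bBX.
Qed.

Lemma cB_bound f : cB f -> exists2 M, 0 <= M & forall z, circ z -> cabs (f z) <= M.
Proof.
move=> [[_ [M fM]] [_ [N fN]]]; exists (`|M| + `|N|); first by rewrite addr_ge0.
move=> z cz.
rewrite (le_trans (cabs_le_ReIm _))// lerD// (le_trans _ (ler_norm _))//.
  exact: fM.
exact: fN.
Qed.

Lemma circ_conjM (z : C) : circ z -> z^* * z = 1.
Proof. by rewrite /unit_circle/= norm_eq1 conjM_cabs => ->; rewrite expr1n. Qed.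

Lemma circ_cabs (z : C) : circ z <-> cabs z = 1.
Proof. by rewrite /unit_circle/= norm_eq1. Qed.

(* This class contains all bounded Borel functions ([bB_bcl] below), a substitute for
   the theorems of Weierstrass and Lusin. *)
Inductive bcl : (C -> R) -> Prop :=
| bcl_poly (p : {poly C}) : bcl (fun z => complex.Re p.[z])
| bcl_lim (f : nat -> C -> R) g M :
    (forall n, bcl (f n)) -> (forall n z, circ z -> `|f n z| <= M) ->
    (forall z, circ z -> f n z @[n --> \oo] --> g z) -> bcl g.

Lemma bcl_bB f : bcl f -> bB f.
Proof.
elim=> [p|{}f g M _ bf fM fg]; first by case: (cB_poly p).
exact: (bB_lim bf fM fg).
Qed.

Lemma bcl_ext f g : (forall z, circ z -> f z = g z) -> bcl f -> bcl g.
Proof.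
move=> fg bf; have [_ [M fM]] := bcl_bB bf.
apply: (@bcl_lim (fun=> f) g M) => // z cz; rewrite fg//.
exact: cvg_cst.
Qed.

Lemma bcl_cst r : bcl (fun=> r).
Proof.
by apply: bcl_ext (bcl_poly (real_complex R r)%:P) => z _; rewrite hornerC.
Qed.

(** Two nested inductions: a limit in the first argument is passed with [g] arbitrary; what remains,
    a polynomial plus [g], is an induction on [g]. [bclM] has the same scheme. *)
Lemma bclD f g : bcl f -> bcl g -> bcl (fun z => f z + g z).
Proof.
move=> bf; elim: bf g => [p|{}f h M bf IH fM fh] g bg; last first.
  have [_ [N gN]] := bcl_bB bg.
  apply: (@bcl_lim (fun n z => f n z + g z) _ (M + N)) => [n|n z cz|z cz].
  - exact: IH.
  - by rewrite (le_trans (ler_normD _ _))// lerD ?fM ?gN.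
  - by apply: cvgD; [exact: fh|exact: cvg_cst].
elim: bg => [q|{}g h N bg IH gN gh].
  by apply: bcl_ext (bcl_poly (p + q)) => z _; rewrite hornerD ReD.
have [_ [M pM]] := bcl_bB (bcl_poly p).
apply: (@bcl_lim (fun n z => complex.Re p.[z] + g n z) _ (M + N)) => [n|n z cz|z cz].
- exact: IH.
- by rewrite (le_trans (ler_normD _ _))// lerD ?pM ?gN.
- by apply: cvgD; [exact: cvg_cst|exact: gh].
Qed.

(** Re x * Re y = Re (x y + x conj y) / 2, and on the circle conj z = 1 / z, so for k <= j the
    product x conj y is again a monomial, of degree j - k. This is what makes real parts of
    polynomials an algebra on the circle. *)
Lemma Re_mul_mono (a b : C) (j k : nat) : exists r : {poly C},
  forall z, circ z -> complex.Re (a * z ^+ j) * complex.Re (b * z ^+ k) =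
    complex.Re r.[z].
Proof.
wlog jk : a b j k / (k <= j)%N => [H|].
  have [/H//|/ltnW/(H b a)[r rE]] := leqP k j.
  by exists r => z cz; rewrite -rE// mulrC.
exists ((real_complex R (2^-1))%:P * ((a * b) *: 'X^(j + k) + (a * b^*) *: 'X^(j - k))).
move=> z cz; rewrite hornerM hornerC hornerD !hornerZ !hornerXn.
have -> : a * b^* * z ^+ (j - k) = (a * z ^+ j) * (b * z ^+ k)^*.
  rewrite rmorphM/= rmorphXn/= mulrACA; congr (_ * _).
  rewrite -[in RHS](subnK jk) exprD -mulrA -exprMn [z * _]mulrC circ_conjM//.
  by rewrite expr1n mulr1.
have -> : a * b * z ^+ (j + k) = (a * z ^+ j) * (b * z ^+ k) by rewrite exprD mulrACA.
move: (a * _) (b * _) => x y.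
rewrite ReM ReD !ReM Re_conj Im_conj ReC ImC; lra.
Qed.

Lemma Re_mul_poly (p q : {poly C}) : exists r : {poly C},
  forall z, circ z -> complex.Re p.[z] * complex.Re q.[z] = complex.Re r.[z].
Proof.
rewrite -[p]coefK poly_def; apply: (big_ind (fun p : {poly C} => exists r : {poly C},
  forall z, circ z -> complex.Re p.[z] * complex.Re q.[z] = complex.Re r.[z])).
- by exists 0 => z _; rewrite horner0 mul0r.
- move=> f g [r rE] [s sE]; exists (r + s) => z cz.
  by rewrite !hornerD !ReD mulrDl rE// sE.
move=> i _; rewrite -[q]coefK poly_def.
apply: (big_ind (fun q : {poly C} => exists r : {poly C},
  forall z, circ z -> complex.Re (p`_i *: 'X^i).[z] * complex.Re q.[z] = complex.Re r.[z])).
- by exists 0 => z _; rewrite horner0 mulr0.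
- move=> f g [r rE] [s sE]; exists (r + s) => z cz.
  by rewrite !hornerD !ReD mulrDr rE// sE.
move=> j _; have [r rE] := Re_mul_mono p`_i q`_j i j.
by exists r => z cz; rewrite !hornerZ !hornerXn rE.
Qed.

Lemma bclM f g : bcl f -> bcl g -> bcl (fun z => f z * g z).
Proof.
move=> bf; elim: bf g => [p|{}f h M bf IH fM fh] g bg; last first.
  have [_ [N gN]] := bcl_bB bg.
  apply: (@bcl_lim (fun n z => f n z * g z) _ (M * N)) => [n|n z cz|z cz].
  - exact: IH.
  - by rewrite normrM ler_pM ?fM ?gN.
  - by apply: cvgM; [exact: fh|exact: cvg_cst].
elim: bg => [q|{}g h N bg IH gN gh].
  have [r rE] := Re_mul_poly p q.
  by apply: bcl_ext (bcl_poly r) => z cz; rewrite rE.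
have [_ [M pM]] := bcl_bB (bcl_poly p).
apply: (@bcl_lim (fun n z => complex.Re p.[z] * g n z) _ (M * N)) => [n|n z cz|z cz].
- exact: IH.
- by rewrite normrM ler_pM ?pM ?gN.
- by apply: cvgM; [exact: cvg_cst|exact: gh].
Qed.

(* [x |-> (3 x - x ^ 3) / 2] maps [-1, 1] into itself, and its iterates converge
   there pointwise to the sign of [x]. *)
Definition smooth_sign (x : R) := (3 * x - x ^+ 3) / 2.

Lemma smooth_signN x : smooth_sign (- x) = - smooth_sign x.
Proof. by rewrite /smooth_sign; ring. Qed.

Lemma iter_smooth_signN n x : iter n smooth_sign (- x) = - iter n smooth_sign x.
Proof. by elim: n => //= n ->; exact: smooth_signN. Qed.

(** 1 - [smooth_sign x] is (1 - x) times 1 - (x + x^2) / 2, and on [x0, 1] the second factor is at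
    most 1 - x0 / 2: under iteration the distance to 1 decays geometrically. *)
Lemma smooth_sign_pos x0 x : 0 < x0 -> x0 <= x <= 1 ->
  x0 <= smooth_sign x <= 1 /\ 1 - smooth_sign x <= (1 - x) * (1 - x0 / 2).
Proof.
move=> x00 /andP[x0x x1]; rewrite /smooth_sign.
have E : 1 - (3 * x - x ^+ 3) / 2 = (1 - x) * (1 - (x + x ^+ 2) / 2) by field.
have E2 : (3 * x - x ^+ 3) / 2 - x = x * (1 - x) * (1 + x) / 2 by field.
have H1 : 0 <= x * (1 - x) * (1 + x) / 2.
  by rewrite divr_ge0// !mulr_ge0//; lra.
have H2 : 0 <= (1 - x) * (1 - (x + x ^+ 2) / 2).
  by rewrite mulr_ge0//; nra.
split; first by lra.
rewrite E ler_wpM2l//; nra.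
Qed.

Lemma iter_smooth_sign_pos n x : 0 < x <= 1 ->
  x <= iter n smooth_sign x <= 1 /\ 1 - iter n smooth_sign x <= (1 - x / 2) ^+ n.
Proof.
move=> /andP[x0 x1]; elim: n => [|n [IH1 IH2]] /=; first by rewrite lexx x1 expr0; split=> //; lra.
have [H1 H2] := smooth_sign_pos x0 IH1; split=> //.
by rewrite (le_trans H2)// exprSr ler_wpM2r//; lra.
Qed.

Lemma iter_smooth_sign_bound n x : `|x| <= 1 -> `|iter n smooth_sign x| <= 1.
Proof.
have pos y : 0 < y -> y <= 1 -> `|iter n smooth_sign y| <= 1.
  move=> y0 y1; have [|/andP[h1 h2] _] := @iter_smooth_sign_pos n y; first by rewrite y0.
  by rewrite ger0_norm// ltW// (lt_le_trans y0).
have [x0|x0|->] := ltgtP x 0.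
- by rewrite ltr0_norm// => /(pos _ _); rewrite oppr_gt0 => /(_ x0); rewrite iter_smooth_signN normrN.
- by rewrite gtr0_norm//; exact: pos.
- move=> _; suff -> : iter n smooth_sign 0 = 0 by rewrite normr0.
  by elim: n {pos} => //= n ->; rewrite /smooth_sign expr0n /= mulr0 subr0 mul0r.
Qed.

Lemma cvg_iter_smooth_sign x : `|x| <= 1 ->
  iter n smooth_sign x @[n --> \oo] --> Num.sg x.
Proof.
have pos y : 0 < y -> y <= 1 -> iter n smooth_sign y @[n --> \oo] --> (1 : R).
  move=> y0 y1; have yy : 0 < y <= 1 by rewrite y0.
  have h1 : (fun n => 1 - (1 - y / 2) ^+ n) @ \oo --> (1 : R).
    rewrite -[X in _ --> X]subr0; apply: cvgB; first exact: cvg_cst.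
    by apply: cvg_expr; rewrite ger0_norm; lra.
  apply: (squeeze_cvgr _ h1 (@cvg_cst _ _ _ _ _)); apply: nearW => n.
  have [/andP[_ ->] h] := iter_smooth_sign_pos n yy.
  by rewrite andbT; lra.
have [x0|x0|->] := ltgtP x 0.
- rewrite ltr0_norm// => x1; rewrite ltr0_sg//.
  have -> : (fun n => iter n smooth_sign x) = (fun n => - iter n smooth_sign (- x)).
    by apply/funext => n; rewrite iter_smooth_signN opprK.
  by apply: cvgN; apply: pos => //; rewrite oppr_gt0.
- by rewrite gtr0_norm// gtr0_sg//; exact: pos.
- move=> _; rewrite sgr0.
  suff -> : (fun n => iter n smooth_sign 0) = (fun=> 0) by exact: cvg_cst.
  apply/funext => n.
  by elim: n {pos} => //= n ->; rewrite /smooth_sign expr0n /= mulr0 subr0 mul0r.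
Qed.

Lemma bclB f g : bcl f -> bcl g -> bcl (fun z => f z - g z).
Proof.
move=> bf bg; apply: (bcl_ext _ (bclD bf (bclM (bcl_cst (-1)) bg))) => z _.
by rewrite mulN1r.
Qed.

(** Scaled into [-1, 1] by [k], [f] can be fed to the iterates of [smooth_sign], which are
    polynomials in [f]. Their limit is the sign s of [f], and the indicator is (s^2 + s) / 2. *)
Lemma bcl_pos f : bcl f -> bcl (\1_[set z | 0 < f z] : C -> R).
Proof.
move=> bf; have [_ [M fM]] := bcl_bB bf.
pose k := (1 + `|M|)^-1.
have k0 : 0 < k by rewrite invr_gt0 ltr_pwDl.
have bkf : bcl (fun z => k * f z) by apply: bclM => //; exact: bcl_cst.
have kf1 z : circ z -> `|k * f z| <= 1.
  move=> cz; rewrite normrM gtr0_norm// /k mulrC ler_pdivrMr ?ltr_pwDl// mul1r.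
  by rewrite (le_trans (fM z cz))// (le_trans (ler_norm M))// lerDr.
have bs : bcl (fun z => Num.sg (f z)).
  apply: (@bcl_lim (fun n z => iter n smooth_sign (k * f z)) _ 1) => [|n z cz|z cz].
  - elim=> //= n IH; rewrite /smooth_sign.
    apply: bclM (bcl_cst _); apply: bclB; first by apply: bclM => //; exact: bcl_cst.
    by apply: bcl_ext (bclM IH (bclM IH IH)) => z _; rewrite !exprS expr0 mulr1.
  - by apply: iter_smooth_sign_bound; exact: kf1.
  - have := cvg_iter_smooth_sign (kf1 z cz).
    by rewrite sgrM gtr0_sg// mul1r.
apply: (bcl_ext _ (bclM (bcl_cst 2^-1) (bclD (bclM bs bs) bs))) => z _.
rewrite indicE; case: (ltgtP (f z) 0) => f0.
- by rewrite memNset /=; [rewrite ltr0_sg//; lra|apply/negP; rewrite -leNgt ltW].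
- by rewrite mem_set//= gtr0_sg//; lra.
- by rewrite memNset /= ?f0 ?ltxx// sgr0; lra.
Qed.

End complex_bounded_borel.

Import HBNNSimple.

(** * Every bounded Borel function lies in the class *)

Section bcl_borel.
Context {R : realType}.
Local Notation C := (cplx R).
Local Notation T := (borel_cplx R).
Local Notation circ := (@unit_circle R : set (borel_cplx R)).

Lemma bclC (A : set T) : bcl (\1_A : C -> R) -> bcl (\1_(~` A) : C -> R).
Proof.
move=> bA; apply: (bcl_ext _ (bclB (bcl_cst 1) bA)) => z _.
by rewrite !indicE in_setC; case: (z \in A); rewrite /= ?subrr ?subr0.
Qed.

Lemma bclU (A B : set T) : bcl (\1_A : C -> R) -> bcl (\1_B : C -> R) ->
  bcl (\1_(A `|` B) : C -> R).
Proof.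
move=> bA bB; apply: (bcl_ext _ (bclB (bclD bA bB) (bclM bA bB))) => z _.
rewrite !indicE in_setU; case: (z \in A); case: (z \in B) => /=; lra.
Qed.

Lemma bcl_bigcup (A : nat -> set T) : (forall n, bcl (\1_(A n) : C -> R)) ->
  bcl (\1_(\bigcup_n A n) : C -> R).
Proof.
move=> bA; apply: (@bcl_lim _ (fun n => \1_(\big[setU/set0]_(i < n) A i) : C -> R) _ 1).
- elim=> [|n IH].
    by rewrite big_ord0; apply: (bcl_ext _ (bcl_cst 0)) => z _; rewrite indicE in_set0.
  by rewrite big_ord_recr; exact: bclU.
- by move=> n z _; rewrite indicE; case: (_ \in _); rewrite ?normr1 ?normr0.
move=> z _; have [[n _ Anz]|nA] := pselect ((\bigcup_n A n) z).
  apply: cvg_near_cst; exists n.+1 => // m /= nm.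
  rewrite !indicE !mem_set//; first by exists n.
  rewrite -bigcup_mkord; exists n => //.
rewrite indicE memNset//; apply: cvg_near_cst; apply: nearW => n.
rewrite indicE memNset//; rewrite -bigcup_mkord => -[m _ Amz].
by apply: nA; exists m.
Qed.

(** Where |z| = 1, the condition |z - c|^2 < r is linear in z: it reads Re (r - 1 - |c|^2 + 2 conj c
    z) > 0, so [bcl_pos] applies to a polynomial of degree one. *)
Lemma bcl_disc (a b r : R) : bcl (\1_[set z : C | cabs (z - Complex a b) ^+ 2 < r] : C -> R).
Proof.
pose p : {poly C} := (real_complex R (r - 1 - a ^+ 2 - b ^+ 2))%:P +
  (real_complex R 2 * (Complex a b)^*) *: 'X.
apply: (bcl_ext _ (bcl_pos (bcl_poly p))) => z /circ_cabs cz.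
have z1 := sqr_cabs z; rewrite cz expr1n in z1.
congr ((_ : bool)%:R); apply/idP/idP; rewrite !inE /= /p hornerD hornerC hornerZ hornerX
  !ReD !ReM !ImM ReC ImC Re_conj Im_conj /= sqr_cabs ReB ImB /=; lra.
Qed.

(** Second countability: an open set is the union of the discs contained in it that have a rational
    centre and a rational squared radius, enumerated through [unpickle]. *)
Lemma bcl_open (U : set C) : open U -> bcl (\1_U : C -> R).
Proof.
move=> oU.
pose D (t : rat * rat * rat) : set T :=
  [set z : C | cabs (z - Complex (ratr t.1.1) (ratr t.1.2)) ^+ 2 < ratr t.2].
pose F (n : nat) : set T := if unpickle n is Some t then
  (if `[< D t `<=` U >] then D t else set0) else set0.
suff -> : U = \bigcup_n F n :> set T.
  apply: bcl_bigcup => n; rewrite /F; case: unpickle => [t|].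
    case: ifP => _; first exact: bcl_disc.
    by apply: (bcl_ext _ (bcl_cst 0)) => z _; rewrite indicE in_set0.
  by apply: (bcl_ext _ (bcl_cst 0)) => z _; rewrite indicE in_set0.
apply/seteqP; split => z; last first.
  move=> [n _]; rewrite /F; case: unpickle => [t|//].
  by case: ifP => // /asboolP; exact.
move=> Uz.
have [e e0 He] : exists2 e : R, 0 < e & forall t : C, cabs (z - t) < e -> U t.
  have /nbhs_ballP[e /= e0 He] : nbhs z U by exact: open_nbhs_nbhs.
  exists (complex.Re e); first by move: e0; rewrite ltcE => /andP[].
  by move=> t zt; apply: He; rewrite -ball_normE /= norm_lt_toC.
have [a] := @rat_in_itvoo R (complex.Re z - e / 4) (complex.Re z + e / 4) ltac:(lra).
have [b] := @rat_in_itvoo R (complex.Im z - e / 4) (complex.Im z + e / 4) ltac:(lra).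
rewrite !in_itv /= => /andP[b1 b2] /andP[a1 a2].
pose c : C := Complex (ratr a) (ratr b).
have zc : cabs (z - c) < e / 2.
  rewrite (le_lt_trans (cabs_le_ReIm _))// ReB ImB /=.
  have : `|complex.Re z - ratr a| < e / 4 by rewrite ltr_norml; apply/andP; split; lra.
  have : `|complex.Im z - ratr b| < e / 4 by rewrite ltr_norml; apply/andP; split; lra.
  lra.
have zc2 : cabs (z - c) ^+ 2 < (e / 2) ^+ 2.
  by rewrite ltr_pXn2r// nnegrE ?cabs_ge0//; lra.
(* [D] compares squared distances, so the rational is chosen between two squares. *)
have [r] := @rat_in_itvoo R _ _ zc2; rewrite in_itv /= => /andP[r1 r2].
have FE t : F (pickle t) = if `[< D t `<=` U >] then D t else set0.
  by rewrite /F pickleK.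
have DU : D (a, b, r) `<=` U.
  move=> t; rewrite /D /= -/c => tr; apply: He.
  have tc : cabs (t - c) < e / 2.
    rewrite -(@ltr_pXn2r _ 2) ?nnegrE ?cabs_ge0//; last lra.
    exact: lt_trans tr r2.
  have -> : z - t = (z - c) + (c - t) by ring.
  by rewrite (le_lt_trans (cabsD _ _))// [cabs (c - t)]cabsBC [e]splitr ltrD.
by exists (pickle (a, b, r)); [exact: I|rewrite FE asboolT].
Qed.

Lemma bcl_measurable (D : set T) : measurable D -> bcl (\1_D : C -> R).
Proof.
apply: (@smallest_sub _ (sigma_algebra setT) open [set D | bcl (\1_D : C -> R)]).
  split => /=.
  - by apply: (bcl_ext _ (bcl_cst 0)) => z _; rewrite indicE in_set0.
  - by move=> A; rewrite setTD; exact: bclC.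
  - exact: bcl_bigcup.
exact: bcl_open.
Qed.

(** Functional monotone class principle. Indicators and linearity give simple functions, and
    increasing simple approximations give nonnegative bounded functions by a bounded limit. *)
Lemma bB_rect (P : (C -> R) -> Prop) :
  (forall f g, (forall z, circ z -> f z = g z) -> P f -> P g) ->
  (forall D : set T, measurable D -> P (\1_D : C -> R)) ->
  (forall r f g, bB f -> bB g -> P f -> P g -> P (fun z => r * f z + g z)) ->
  (forall (f : nat -> C -> R) g M, (forall n, bB (f n)) -> (forall n, P (f n)) ->
    (forall n z, circ z -> `|f n z| <= M) ->
    (forall z, circ z -> f n z @[n --> \oo] --> g z) -> P g) ->
  forall f, bB f -> P f.
Proof.
move=> Pext Pind Plin Plim.
have P0 : P (fun=> 0).
  by apply: (Pext _ _ _ (Pind set0 measurable0)) => z _; rewrite indicE in_set0.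
have P1 : P (fun=> 1).
  by apply: (Pext _ _ _ (Pind setT measurableT)) => z _; rewrite indicE in_setT.
have Psum (s : seq R) (D : R -> set T) : (forall y, measurable (D y)) ->
    P (fun z => \sum_(y <- s) y * \1_(D y) z) /\ bB (fun z => \sum_(y <- s) y * \1_(D y) z).
  move=> mD; split; last by apply: bB_sum => y; apply: bBZ; exact: bB_ind.
  elim: s => [|y s IH]; first by apply: Pext P0 => z _; rewrite big_nil.
  apply: Pext (Plin y _ _ (bB_ind (mD y)) _ (Pind _ (mD y)) IH) => [z _|].
    by rewrite big_cons.
  by apply: bB_sum => ?; apply: bBZ; exact: bB_ind.
have Ppos f M : bB f -> (forall z, circ z -> 0 <= f z <= M) -> P f.
  move=> bf f0; have mf : measurable_fun circ (EFin \o (f : T -> R)).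
    by apply: measurableT_comp => //; case: bf.
  have f0' (z : T) : circ z -> (0 <= (EFin \o (f : T -> R)) z)%E.
    by move=> /f0/andP[]; rewrite lee_fin.
  pose g := nnsfun_approx measurable_circ mf.
  have gcv z : circ z -> g n z @[n --> \oo] --> f z.
    move=> cz; have := @cvg_nnsfun_approx _ T R _ measurable_circ _ mf f0' z cz.
    by move=> /fine_cvgP[].
  have gf n z : circ z -> g n z <= f z.
    move=> cz; have := @nondecreasing_cvgn_le R (fun n => g n z).
    have nd : nondecreasing_seq (fun n => g n z).
      by move=> i j ij; have /lefP := nd_nnsfun_approx measurable_circ mf ij; exact.
    move=> /(_ nd (cvgP _ (gcv z cz)) n).
    by rewrite (cvg_lim _ (gcv z cz)).
  have gE n : exists s : seq R, (g n : T -> R) = fun z => \sum_(y <- s) y * \1_(g n @^-1` [set y]) z.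
    exists (finmap.enum_fset (fset_set (range (g n)))); apply/funext => z.
    by rewrite {1}(fimfunE (g n) z) fsbig_finite.
  have mg n y : measurable (g n @^-1` [set y] : set T).
    by rewrite -[X in measurable X]setTI; exact: (measurable_funP (g n)).
  apply: (Plim (fun n => g n : C -> R) f M) => // n.
  - by have [s ->] := gE n; case: (Psum s (fun y => g n @^-1` [set y]) (mg n)).
  - by have [s ->] := gE n; case: (Psum s (fun y => g n @^-1` [set y]) (mg n)).
  - move=> z cz; rewrite ger0_norm ?fun_ge0// (le_trans (gf n z cz))//.
    by have /andP[] := f0 z cz.
move=> f bf; have [mf [M fM]] := bf.
(* Simple approximation needs a nonnegative function, so [f] is shifted by its bound and the
   constant removed by linearity. *)
have bfM : bB (fun z => f z + M) by apply: bBD => //; exact: bB_cst.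
have PM : P (fun z => f z + M).
  apply: (Ppos _ (M + M)) => // z cz; have := fM z cz.
  by rewrite ler_norml => /andP[h1 h2]; apply/andP; split; lra.
apply: Pext (Plin (- M) _ _ (bB_cst 1) bfM P1 PM) => z _.
by rewrite mulr1; ring.
Qed.

Lemma bB_bcl (f : C -> R) : bB f -> bcl f.
Proof.
move: f; apply: (bB_rect (P := @bcl R)) => [f g fg|D|r f g _ _ bf bg|f g M _].
- exact: bcl_ext.
- exact: bcl_measurable.
- by apply: bclD => //; apply: bclM => //; exact: bcl_cst.
- exact: bcl_lim.
Qed.

End bcl_borel.

(** * Szego's theorem *)

Section circle_measure_integral.
Context {R : realType}.
Local Notation C := (cplx R).
Local Notation T := (borel_cplx R).
Local Notation circ := (@unit_circle R : set (borel_cplx R)).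
Local Notation cm := (@circle_measure R : {measure set T -> \bar R}).

Lemma expi_circ (t : R) : circ (expi t).
Proof. by apply/circ_cabs; rewrite cabsE /= cos2Dsin2 sqrtr1. Qed.

Lemma expiD (s t : R) : expi (s + t) = expi s * expi t :> C.
Proof. by apply: cplx_eq; rewrite ?ReM ?ImM /= ?cosD ?sinD//; ring. Qed.

Lemma expiX (t : R) n : expi t ^+ n = expi (n%:R * t) :> C.
Proof.
elim: n => [|n IH]; first by rewrite mul0r /expi cos0 sin0.
by rewrite exprS IH -expiD -natr1 mulrDl mul1r addrC.
Qed.

Lemma cm_circ : circle_measure circ = 1%E.
Proof.
rewrite /circle_measure.
have -> : (expi @^-1` circ) = @setT R.
  by apply/seteqP; split=> // t _; exact: expi_circ.
rewrite setTI lebesgue_measure_itv /= lte_fin mulr_gt0 ?pi_gt0//.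
by rewrite oppr0 adde0 -EFinM mulVf// gt_eqF// mulr_gt0// pi_gt0.
Qed.

Let A : set R := `[0%R, (2 * pi)%R[%classic.

Let mA : measurable A. Proof. exact: measurable_itv. Qed.

Let Afin : (lebesgue_measure A < +oo)%E.
Proof. by rewrite lebesgue_measure_itv /=; case: ifP => _; rewrite ltry. Qed.

Lemma bB_expi_measurable (f : C -> R) : bB f ->
  measurable_fun setT (fun t : R => f (expi t)).
Proof.
move=> [mf _]; apply: (measurable_comp measurable_circ _ mf (@measurable_expi R)).
by move=> _ [t _ <-]; exact: expi_circ.
Qed.

Lemma bB_expi_integrable (f : C -> R) : bB f ->
  lebesgue_measure.-integrable A (fun t : R => (f (expi t))%:E).
Proof.
move=> bf; apply: measurable_bounded_integrable => //.
  by apply: measurable_funTS; exact: bB_expi_measurable.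
have [_ [M fM]] := bf; exists M; split; first by rewrite num_real.
by move=> y My z cz /=; rewrite (le_trans (fM _ (expi_circ _)))// ltW.
Qed.

(** Change of variables z = [expi t]: for indicators it is the definition of [circle_measure], and
    dominated convergence on both sides carries it through [bB_rect]. *)
Lemma cint_circle_measure (f : C -> R) : bB f ->
  cint cm f = (2 * pi)^-1 * \int[lebesgue_measure]_(t in A) f (expi t).
Proof.
have cmfin : (cm circ < +oo)%E by rewrite /= cm_circ ltry.
move: f; apply: bB_rect => [f g fg|D mD|r f g bf bg|f g M bf].
- rewrite (cint_ext cm fg) => ->; congr (_ * _).
  by apply: eq_Rintegral => t _; rewrite fg//; exact: expi_circ.
- rewrite cint_ind//= /circle_measure.
  have -> : \int[lebesgue_measure]_(t in A) \1_D (expi t) =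
      fine (lebesgue_measure (expi @^-1` (D `&` circ) `&` A)).
    rewrite /Rintegral; congr fine.
    have -> : (\int[lebesgue_measure]_(t in A) (\1_D (expi t))%:E)%E =
       (\int[lebesgue_measure]_(t in A) (\1_((expi : R -> T) @^-1` D) t)%:E)%E by [].
    rewrite integral_indic//; last first.
      by rewrite -[X in measurable X]setTI; exact: measurable_expi.
    congr (lebesgue_measure (_ `&` _)); apply/seteqP; split=> t //=.
      by move=> Dt; split=> //; exact: expi_circ.
    by case.
  rewrite fineM//= -/A ge0_fin_numE//; apply: le_lt_trans Afin.
  apply: le_measure; rewrite ?inE//; apply: measurableI => //.
  rewrite -[X in measurable X]setTI; apply: measurable_expi => //.
  by apply: measurableI => //; exact: measurable_circ.
- move=> IHf IHg.
  rewrite cintD ?cintZ ?IHf ?IHg//; last exact: bBZ.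
  rewrite RintegralD//; last 2 first.
  + exact: (bB_expi_integrable (bBZ r bf)).
  + exact: bB_expi_integrable.
  rewrite RintegralZl//; last exact: bB_expi_integrable.
  by move: (2 * pi)^-1 => k; rewrite mulrDr [in RHS]mulrCA.
- move=> IH fM fg.
  have cf := cint_cvg cmfin bf fM fg.
  have bg := bB_lim bf fM fg.
  have cE : {ae lebesgue_measure, forall t, A t ->
      (f n (expi t))%:E @[n --> \oo] --> (g (expi t))%:E}.
    apply: aeW => t _; apply: cvg_EFin; first exact: nearW.
    by apply: fg; exact: expi_circ.
  have dE : {ae lebesgue_measure, forall t n, A t ->
      (`|(f n (expi t))%:E| <= (fun=> M%:E) t)%E}.
    by apply: aeW => t n _; apply: fM; exact: expi_circ.
  have [_ _ h] := @dominated_convergence _ _ R lebesgue_measure A mA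
    (fun n t => (f n (expi t))%:E) (fun t => (g (expi t))%:E) (fun=> M%:E)
    (fun n => measurable_int _ (bB_expi_integrable (bf n)))
    (measurable_int _ (bB_expi_integrable bg)) cE
    (bB_expi_integrable (bB_cst M)) dE.
  have h' : (2 * pi)^-1 * \int[lebesgue_measure]_(t in A) f n (expi t) @[n --> \oo] -->
     (2 * pi)^-1 * \int[lebesgue_measure]_(t in A) g (expi t).
    apply: cvgMl_tmp; apply: fine_cvg; rewrite fineK//.
    by apply: integrable_fin_num => //; exact: bB_expi_integrable.
  have fE : (fun n => cint cm (f n)) =
      (fun n => (2 * pi)^-1 * \int[lebesgue_measure]_(t in A) f n (expi t)).
    by apply/funext => n; exact: IH.
  rewrite fE in cf.
  exact: (cvg_unique _ cf h').
Qed.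

(** In the variable t the integrand is a trigonometric function of frequency n + 1, integrated over
    a whole number of periods by means of its explicit primitive [F]. *)
Lemma cint_mono0 (a : C) n : cint cm (fun z => complex.Re (a * z ^+ n.+1)) = 0.
Proof.
have b : bB (fun z : C => complex.Re (a * z ^+ n.+1)).
  by case: (cBM (cB_cst a) (cBX n.+1 (@cB_id R))).
rewrite cint_circle_measure//.
have pi2 : 0 < 2 * pi :> R by rewrite mulr_gt0// pi_gt0.
pose k : R := n.+1%:R.
have k0 : k != 0 by rewrite pnatr_eq0.
pose F (t : R) := complex.Re a / k * sin (k * t) + complex.Im a / k * cos (k * t).
pose f (t : R) := complex.Re a * cos (k * t) - complex.Im a * sin (k * t).
have fE t : complex.Re (a * expi t ^+ n.+1) = f t.
  by rewrite expiX ReM.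
have dF (t : R) : is_derive t (1 : R) F (f t).
  rewrite /F; apply: is_derive_eq.
  rewrite /f /GRing.scale /= ; field.
  by rewrite addrC natr1.
have cf : continuous f.
  move=> s; apply: cvgB; apply: cvgM; (try exact: cvg_cst).
    by apply: continuous_comp; [exact: mulrl_continuous|exact: continuous_cos].
  by apply: continuous_comp; [exact: mulrl_continuous|exact: continuous_sin].
have cF : continuous F.
  move=> s; apply: differentiable_continuous; apply/derivable1_diffP.
  by case: (dF s).
rewrite (_ : \int[_]_(_ in _) _ = 0) ?mulr0// /Rintegral.
rewrite (_ : integral _ _ _ = 0%E)//.
rewrite (_ : integral _ _ _ = (\int[lebesgue_measure]_(t in A) (f t)%:E)%E); last first.
  by apply: eq_integral => t _; rewrite fE.
rewrite /A integral_itv_bndo_bndc; last first.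
  by apply/measurable_EFinP; apply: measurable_funTS; exact: continuous_measurable_fun.
rewrite (@continuous_FTC2 _ f F)//.
(* At both ends 0 and 2 pi one has [expi t = 1], hence the same value of [F]. *)
- have E (t : R) : expi t = 1 -> F t = complex.Im a / k.
    move=> t1; have := expiX t n.+1; rewrite t1 expr1n => -[c s].
    by rewrite /F /k -c -s mulr0 mulr1 add0r.
  rewrite !E ?subee//.
  + by rewrite /expi cos0 sin0.
  + by rewrite /expi mulrC mulr_natr cos2pi sin2pi.
- by apply: continuous_subspaceT.
- split=> [t _||].
  + by case: (dF t).
  + by apply: cvg_at_right_filter; exact: cF.
  + by apply: cvg_at_left_filter; exact: cF.
- by move=> t _; rewrite derive1E; exact: (@derive_val _ _ _ _ _ _ _ (dF t)).
Qed.

(** Mean value property at the origin: only the constant coefficient survives [cint_mono0]. *)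
Lemma cint_Re_poly (p : {poly C}) : cint cm (fun z => complex.Re p.[z]) = complex.Re p`_0.
Proof.
have cmfin : (cm circ < +oo)%E by rewrite /= cm_circ ltry.
have -> : (fun z => complex.Re p.[z]) =
    fun z => \sum_(i < (size p).+1) complex.Re (p`_i * z ^+ i).
  apply/funext => z; rewrite (horner_coef_wide z (leqnSn _)) Re_sum//.
rewrite cint_sum//; last first.
  by move=> i; case: (cBM (cB_cst p`_i) (cBX i (@cB_id R))).
rewrite big_ord_recl big1 ?addr0 => [|i _]; last exact: cint_mono0.
under eq_fun do rewrite mulr1.
by rewrite cint_cst/= cm_circ mulr1.
Qed.

End circle_measure_integral.

Lemma poly_at0_1 (F : fieldType) (p : {poly F}) : p.[0] = 1 ->
  exists h : {poly F}, p = 1 + h * 'X.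
Proof.
move=> p0; have : root (p - 1) 0 by rewrite /root hornerD hornerN hornerC p0 subrr.
by move/factor_theorem => [h]; rewrite subr0 => hE; exists h; rewrite -hE addrC subrK.
Qed.

(** * The Szego inequality for bounded Borel exponents *)

Section szego.
Context {R : realType}.
Local Notation C := (cplx R).
Local Notation T := (borel_cplx R).
Local Notation circ := (@unit_circle R : set (borel_cplx R)).
Local Notation cm := (@circle_measure R : {measure set T -> \bar R}).
Context (mu : {measure set T -> \bar R}) (mufin : (mu circ < +oo)%E).

Let cmfin : (cm circ < +oo)%E. Proof. by rewrite /= cm_circ ltry. Qed.

Lemma bB_expR (f : C -> R) : bB f -> bB (fun z => expR (f z)).
Proof.
apply: bB_comp; first exact: measurable_expR.
move=> r; exists (expR r) => x xr; rewrite ger0_norm ?expR_ge0// ler_expR.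
by rewrite (le_trans (ler_norm x)).
Qed.

Context (J : R)
  (hJ : forall h : {poly C}, J <= cint mu (fun z => cabs (1 + z * h.[z]) ^+ 2)).

(* [(1 - q / N) ^ N] plays the role of [exp (- q)]. *)
Lemma szego_poly (q : {poly C}) : q.[0] = 0 ->
  J <= cint mu (fun z => expR (- 2 * complex.Re q.[z])).
Proof.
move=> q0.
have [B B0 qB] := cB_bound (cB_poly q).
have bq : bB (fun z => complex.Re q.[z]) by case: (cB_poly q).
set I := cint mu _.
have bI : bB (fun z => expR (- 2 * complex.Re q.[z])) by apply: bB_expR; exact: bBZ.
(* With k = n + 1, |1 - x / k|^2 = 1 - 2 Re x / k + |x|^2 / k^2 is at most exp (- 2 Re x / k + B^2 /
   k^2). The k-th power costs a factor exp (B^2 / k), which tends to 1. As q vanishes at 0, the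
   polynomial [p] equals 1 there and so has the shape required by [hJ]. *)
have H n : J <= expR (B ^+ 2 / n.+1%:R) * I.
  pose k : R := n.+1%:R.
  have k0 : 0 < k by rewrite ltr0n.
  pose p : {poly C} := (1 - (real_complex R k^-1)%:P * q) ^+ n.+1.
  have p0 : p.[0] = 1.
    rewrite /p horner_exp hornerD hornerN hornerM !hornerC q0.
    by rewrite mulr0 subr0 expr1n.
  have [h hE] := poly_at0_1 p0.
  apply: (le_trans (hJ h)); rewrite -cintZ//; apply: cint_le => //.
  - by apply: bB_cabs2; apply: cBD (cB_cst 1) _; apply: cBM (@cB_id R) (cB_poly h).
  - exact: bBZ.
  move=> z cz; rewrite [z * _]mulrC.
  have -> : 1 + h.[z] * z = p.[z] by rewrite hE hornerD hornerM hornerX hornerC.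
  rewrite /p horner_exp hornerD hornerN hornerM !hornerC cabsX.
  rewrite -exprM mulnC exprM.
  set x := q.[z].
  have -> : cabs (1 - real_complex R k^-1 * x) ^+ 2 =
     1 + (- 2 * complex.Re x / k + cabs x ^+ 2 / k ^+ 2).
    rewrite !sqr_cabs ReB ImB ReM ImM ReC ImC /=; field.
    by rewrite gt_eqF.
  have -> : expR (B ^+ 2 / k) * expR (- 2 * complex.Re x) =
      expR (- 2 * complex.Re x / k + B ^+ 2 / k ^+ 2) ^+ n.+1.
    rewrite -expRM_natl -expRD; congr expR; rewrite -/k; field.
    by rewrite gt_eqF.
  apply: lerXn2r; rewrite ?nnegrE ?expR_ge0//.
    have -> : 1 + (- 2 * complex.Re x / k + cabs x ^+ 2 / k ^+ 2) =
        cabs (1 - real_complex R k^-1 * x) ^+ 2.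
      rewrite !sqr_cabs ReB ImB ReM ImM ReC ImC /=; field.
      by rewrite gt_eqF.
    exact: sqr_ge0.
  rewrite (le_trans (expR_ge1Dx _))// ler_expR lerD2l.
  rewrite ler_wpM2r ?invr_ge0 ?exprn_ge0 ?(ltW k0)//.
  by rewrite lerXn2r ?nnegrE ?cabs_ge0// qB.
have cv : (fun n => expR (B ^+ 2 / n.+1%:R) * I) @ \oo --> expR (B ^+ 2 * 0) * I.
  apply: cvgM; last exact: cvg_cst.
  apply: continuous_cvg; first exact: continuous_expR.
  by apply: cvgM; [exact: cvg_cst|exact: cvg_harmonic].
rewrite mulr0 expR0 mul1r in cv.
by apply: (cvgr_to_ge cv); apply: nearW.
Qed.

(** For u = Re p, apply [szego_poly] to q = (p - p(0)) / 2: then - 2 Re q = Re p(0) - u, and Re p(0)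
    is the mean of u. Both sides are continuous under bounded pointwise limits, which reach every
    bounded Borel u. *)
Lemma szego_bB (u : C -> R) : bB u ->
  J <= expR (cint cm u) * cint mu (fun z => expR (- u z)).
Proof.
move/bB_bcl; elim=> [p|f g M bf IH fM fg].
  rewrite cint_Re_poly.
  pose q := (real_complex R 2^-1)%:P * (p - (p`_0)%:P).
  have q0 : q.[0] = 0.
    by rewrite /q hornerM hornerD hornerN !hornerC horner_coef0 subrr mulr0.
  rewrite -(cintZ mufin); last first.
    by apply: bB_expR; apply: bBN; case: (cB_poly p).
  apply: (le_trans (szego_poly q0)); rewrite le_eqVlt; apply/orP; left; apply/eqP.
  apply: cint_ext => z _; rewrite -expRD; congr expR.
  by rewrite /q hornerM hornerD hornerN !hornerC ReM ReB ReC ImC /=; field.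
have bfn n := bcl_bB (bf n).
have c1 := cint_cvg cmfin bfn fM fg.
have c2 : (fun n => cint mu (fun z => expR (- f n z))) @ \oo -->
    cint mu (fun z => expR (- g z)).
  apply: (@cint_cvg _ _ mufin _ _ (expR M)) => [n|n z cz|z cz].
  - by apply: bB_expR; exact: bBN.
  - rewrite ger0_norm ?expR_ge0// ler_expR.
    by rewrite (le_trans _ (fM n z cz))// -normrN ler_norm.
  - apply: continuous_cvg; first exact: continuous_expR.
    by apply: cvgN; exact: fg.
have c3 : (fun n => expR (cint cm (f n)) * cint mu (fun z => expR (- f n z))) @ \oo -->
    expR (cint cm g) * cint mu (fun z => expR (- g z)).
  apply: cvgM c2; apply: continuous_cvg c1; exact: continuous_expR.
by apply: (cvgr_to_ge c3); apply: nearW.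
Qed.

End szego.

(** * Integrability of the logarithm of the density *)

Section szego_density.
Context {R : realType}.
Local Notation C := (cplx R).
Local Notation T := (borel_cplx R).
Local Notation circ := (@unit_circle R : set (borel_cplx R)).
Local Notation cm := (@circle_measure R : {measure set T -> \bar R}).

(** Here v is the logarithm of x clamped to [exp (- L), exp L], p is its positive part and [|v - p|]
    its negative part. The bound p <= x controls the mean of p by that of the density, and the last
    inequality bounds the integral of exp (- v) against the density. *)
Lemma ln_clampE (x L : R) : 0 <= x -> 0 < L ->
  let v := ln (Num.max (expR (- L)) (Num.min x (expR L))) in
  let p := ln (Num.max 1 (Num.min x (expR L))) in
  [/\ `|v| <= L, v = p - `|v - p|, `|v| = p + `|v - p|, 0 <= p <= x & expR (- v) * x <= 1 + x].
Proof.
move=> x0 L0.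
have eL : 1 < expR L by rewrite expR_gt1.
have eL' : expR (- L) < 1 by rewrite -expR0 ltr_expR oppr_lt0.
have eN0 := expR_gt0 (- L).
have [x1|x1] /= := leP x 1.
  have -> : Num.min x (expR L) = x by apply: min_l; lra.
  have -> : Num.max 1 x = 1 by apply: max_l.
  have [xe|xe] := leP x (expR (- L)).
    rewrite expRK ln1 normrN gtr0_norm// opprK subr0 normrN gtr0_norm//.
    split; rewrite ?x0 ?lexx//; [lra|lra|].
    have : expR L * x <= expR L * expR (- L) by rewrite ler_wpM2l// expR_ge0.
    rewrite -expRD subrr expR0; lra.
  have xp : 0 < x by lra.
  have l0 : ln x <= 0 by rewrite -ln1 ler_ln ?posrE.
  have lL : - L <= ln x by rewrite -(expRK (- L)) ler_ln ?posrE// ltW.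
  rewrite ln1 subr0 ler0_norm//; split; rewrite ?x0 ?lexx//; [lra|lra|lra|].
  by rewrite expRN lnK ?posrE// mulVf ?gt_eqF//; lra.
set m := Num.min x (expR L).
have m1 : 1 < m by rewrite /m lt_min x1 eL.
have -> : Num.max (expR (- L)) m = m by apply: max_r; lra.
have -> : Num.max 1 m = m by apply: max_r; lra.
have mx : m <= x by rewrite /m ge_min lexx.
have mL : m <= expR L by rewrite /m ge_min lexx orbT.
have l0 : 0 < ln m by rewrite ln_gt0.
rewrite subrr normr0 gtr0_norm//; split; rewrite ?addr0 ?subr0//.
- by rewrite -(expRK L) ler_ln ?posrE ?expR_gt0//; lra.
- by rewrite ltW//= (le_trans _ mx)// ltW// ln_sublinear//; lra.
- rewrite expRN lnK ?posrE; last lra.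
  rewrite /m; have [xL|xL] := leP x (expR L); first by rewrite mulVf ?gt_eqF//; lra.
  rewrite -[leRHS]mul1r; apply: (le_trans (y := 1 * x)); last by rewrite ler_wpM2l//; lra.
  by rewrite ler_wpM2r// -[leRHS]invr1 lef_pV2 ?posrE//; lra.
Qed.

(** At 0 the clamped logarithm is - (n + 1), in accordance with [lne 0 = -oo]; for x > 0 the clamp
    is inactive once n exceeds [|ln x|]. *)
Lemma cvg_ln_clamp (x : R) : 0 <= x ->
  (ln (Num.max (expR (- n.+1%:R)) (Num.min x (expR n.+1%:R))))%:E @[n --> \oo]
   --> lne x%:E.
Proof.
rewrite le_eqVlt => /orP[/eqP<-|x0].
  rewrite le0_lneNy//.
  have -> : (fun n : nat => (ln (Num.max (expR (- n.+1%:R)) (Num.min 0 (expR n.+1%:R))) : R)%:E) =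
    (fun n : nat => (- (n.+1%:R : R))%:E).
    apply/funext => n; congr EFin.
    rewrite (min_l (expR_ge0 _)) max_l ?expR_ge0 ?expRK//.
  apply/cvgeNyPle => A; near=> n.
  rewrite lee_fin lerNl.
  have : (`|A| <= n%:R) by near: n; exact: nbhs_infty_ger.
  rewrite -natr1; have := ler_norm (- A); rewrite normrN; lra.
rewrite lne_EFin//; apply: cvg_near_cst.
have [N hN] : exists N : nat, `|ln x| <= N%:R.
  by exists (Num.bound `|ln x|); rewrite ltW// archi_boundP.
near=> n.
have : N%:R <= n%:R :> R by rewrite ler_nat; near: n; exact: nbhs_infty_ge.
move=> Nn.
have := ler_norm (ln x); have := ler_norm (- ln x); rewrite normrN => h1 h2.
have n1 : n%:R <= n.+1%:R :> R by rewrite ler_nat.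
congr EFin; congr ln.
rewrite min_l; last by rewrite -[leLHS]lnK ?posrE// ler_expR; lra.
rewrite max_r//; last by rewrite -[leRHS]lnK ?posrE// ler_expR; lra.
Unshelve. all: by end_near. Qed.

Context (mu : probability T R) (w : C -> R).
Context (mu1 : mu circ = 1%E) (hw : ac_density mu w).
(* [J] is a lower bound for the squared distance in [L2(mu)] from [1] to the
   polynomials vanishing at the origin. *)
Context (J : R) (J0 : 0 < J)
  (hJ : forall h : {poly C}, J <= cint mu (fun z => cabs (1 + z * h.[z]) ^+ 2)).

Let cmfin : (cm circ < +oo)%E. Proof. by rewrite /= cm_circ ltry. Qed.
Let mufin : (mu circ < +oo)%E. Proof. by rewrite mu1 ltry. Qed.

Let mw : measurable_fun setT (w : T -> R). Proof. by case: hw. Qed.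
Let w0 z : 0 <= w z. Proof. by case: hw. Qed.

Let v (n : nat) (z : C) : R :=
  ln (Num.max (expR (- n.+1%:R)) (Num.min (w z) (expR n.+1%:R))).
Let p (n : nat) (z : C) : R := ln (Num.max 1 (Num.min (w z) (expR n.+1%:R))).

Let vpE n z := @ln_clampE (w z) n.+1%:R (w0 z) (ltr0Sn R n).

Let mv n : measurable_fun setT (v n : T -> R).
Proof.
apply: (measurableT_comp (@measurable_ln R)).
by apply: measurable_maxr => //; apply: measurable_minr.
Qed.

Let mp n : measurable_fun setT (p n : T -> R).
Proof.
apply: (measurableT_comp (@measurable_ln R)).
by apply: measurable_maxr => //; apply: measurable_minr.
Qed.

Let bv n : bB (v n).
Proof.
split; first exact: measurable_funTS.
by exists n.+1%:R => z _; case: (vpE n z).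
Qed.

Let bp n : bB (p n).
Proof.
split; first exact: measurable_funTS.
exists (n.+1%:R + n.+1%:R) => z _.
have [h1 h2 h3 /andP[h4 _] _] := vpE n z; rewrite -/(v n z) -/(p n z) in h1 h2 h3 h4.
rewrite ger0_norm//; have := normr_ge0 (v n z - p n z); have := ler0n R n.+1; lra.
Qed.

Let w_int : cm.-integrable circ (fun z : T => (w z)%:E).
Proof.
case: hw => _ _ [mus [_ muE]]; apply/integrableP; split.
  by apply/measurable_EFinP; exact: measurable_funTS.
rewrite (eq_integral (fun z : T => (w z)%:E)); last by move=> z _ /=; rewrite ger0_norm.
apply: le_lt_trans (ltry 1); rewrite -mu1 muE; last exact: measurable_circ.
by rewrite leeDl// measure_ge0.
Qed.

Let w_le1 : \int[cm]_(z in circ) w z <= 1.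
Proof.
case: hw => _ _ [mus [_ muE]]; rewrite /Rintegral -lee_fin fineK; last first.
  by apply: integrable_fin_num => //; exact: measurable_circ.
rewrite -mu1 muE; last exact: measurable_circ.
by rewrite leeDl// measure_ge0.
Qed.

(** [ac_density] decomposes [mu] on sets only; [bB_rect] extends the decomposition to integrals. The
    mass of the singular part is at most 1 because [mu] has mass 1 on the circle. *)
Lemma cint_density : exists mus : {measure set T -> \bar R},
  [/\ exists S : set T, [/\ measurable S, cm S = 0%E & mus (~` S) = 0%E],
      (mus circ <= 1)%E &
      forall g, bB g -> cint mu g = \int[cm]_(z in circ) (g z * w z) + cint mus g].
Proof.
case: hw => _ _ [mus [hS muE]]; exists mus.
have mus1 : (mus circ <= 1)%E.
  rewrite -mu1 muE; last exact: measurable_circ.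
  by rewrite leeDr// integral_ge0// => z _; rewrite lee_fin.
have musfin : (mus circ < +oo)%E by apply: le_lt_trans mus1 _; rewrite ltry.
split=> // g.
have gw_int (h : C -> R) : bB h -> cm.-integrable circ (fun z : T => (h z * w z)%:E).
  move=> [mh [M hM]].
  have : cm.-integrable circ ((fun z : T => (w z)%:E) \* (EFin \o (h : T -> R)))%E.
    apply: integrableMl => //; first exact: measurable_circ.
    exists M; split; first by rewrite num_real.
    by move=> y My z cz /=; rewrite (le_trans (hM _ cz))// ltW.
  by apply: eq_integrable => [|z _]; [exact: measurable_circ|rewrite /= mulrC].
move: g; apply: bB_rect => [f g fg|D mD|r f g bf bg|f g M bf].
- rewrite (cint_ext _ fg) (cint_ext mus fg) => ->; congr (_ + _).
  by apply: eq_Rintegral => t; rewrite inE => ct; rewrite fg.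
- have mDc : measurable (D `&` circ) by apply: measurableI => //; exact: measurable_circ.
  rewrite !cint_ind//.
  have -> : fine (mu (D `&` circ)) =
      fine (\int[cm]_(z in D `&` circ) (w z)%:E + mus (D `&` circ))%E.
    by congr fine; exact: muE.
  have E : (\int[cm]_(z in circ) (\1_D z * w z)%:E = \int[cm]_(z in D `&` circ) (w z)%:E)%E.
    rewrite [in RHS]setIC integral_mkcondr; apply: eq_integral => z _.
    by rewrite patchE indicE; case: ifP; rewrite ?mul1r ?mul0r.
  rewrite /Rintegral E fineD//.
    rewrite -E; apply: integrable_fin_num; first exact: measurable_circ.
    by apply: gw_int; exact: bB_ind.
  rewrite ge0_fin_numE//; apply: le_lt_trans musfin.
  by apply: le_measure; rewrite ?inE//; exact: measurable_circ.
- move=> IHf IHg.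
  rewrite !cintD ?cintZ ?IHf ?IHg//; try exact: bBZ.
  have -> : \int[cm]_(z in circ) ((r * f z + g z) * w z) =
     \int[cm]_(z in circ) (r * (f z * w z) + g z * w z).
    by apply: eq_Rintegral => z _; ring.
  rewrite RintegralD//; last 3 first.
  + exact: measurable_circ.
  + have -> : (EFin \o (fun x : T => r * (f x * w x))) = (fun x => ((r * f x) * w x)%:E).
      by apply/funext => x /=; rewrite mulrA.
    exact: gw_int (bBZ r bf).
  + exact: gw_int.
  rewrite RintegralZl//; last 2 first.
  + exact: measurable_circ.
  + exact: gw_int.
  ring.
- move=> IH fM fg.
  have c1 := cint_cvg mufin bf fM fg.
  have c2 := cint_cvg musfin bf fM fg.
  have bg := bB_lim bf fM fg.
  have cE : {ae cm, forall z, circ z ->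
      (f n z * w z)%:E @[n --> \oo] --> (g z * w z)%:E}.
    apply: aeW => z cz; apply: cvg_EFin; first exact: nearW.
    by apply: cvgM (@cvg_cst _ _ _ _ _); exact: fg.
  have dE : {ae cm, forall z n, circ z -> (`|(f n z * w z)%:E| <= (M * w z)%:E)%E}.
    apply: aeW => z n cz; rewrite /= lee_fin normrM (ger0_norm (w0 z)).
    by rewrite ler_wpM2r// fM.
  have [_ _ h] := dominated_convergence measurable_circ
    (fun n => measurable_int _ (gw_int _ (bf n)))
    (measurable_int _ (gw_int _ bg)) cE (gw_int _ (bB_cst M)) dE.
  have h' : \int[cm]_(z in circ) (f n z * w z) @[n --> \oo] -->
     \int[cm]_(z in circ) (g z * w z).
    apply: fine_cvg; rewrite fineK//.
    by apply: integrable_fin_num; [exact: measurable_circ|exact: gw_int].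
  have c3 : (fun n => cint mu (f n)) @ \oo -->
      \int[cm]_(z in circ) (g z * w z) + cint mus g.
    under eq_fun do rewrite IH.
    exact: cvgD h' c2.
  exact: (cvg_unique _ c1 c3).
Qed.

(** The inequality [szego_bB] with the truncated logarithm as exponent. The 3 bounds the integral of
    exp (- u): at most 2 from 1 + w on the absolutely continuous part, and at most 1 from the
    singular part. *)
Let v_lower n : ln (J / 3) <= cint cm (v n).
Proof.
have [mus [[S [mS S0 mS0]] mus1 muE]] := cint_density.
have musfin : (mus circ < +oo)%E by apply: le_lt_trans mus1 _; rewrite ltry.
(* The exponent is set to 0 on the null set [S] carrying the singular part: its mean does not
   change, and exp (- u) = 1 there. *)
pose u (z : C) := \1_(~` S) z * v n z.
have bu : bB u by apply: bBM => //; apply: bB_ind; exact: measurableC.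
have cu : cint cm u = cint cm (v n).
  apply/eqP; rewrite -subr_eq0 -cintB//; apply/eqP.
  apply: (cint_null cmfin mS S0); first exact: bBB.
  by move=> z cz Sz; rewrite /u indicE mem_set//= mul1r subrr.
have be : bB (fun z => expR (- u z)) by apply: bB_expR; exact: bBN.
have mus_le : cint mus (fun z => expR (- u z)) <= 1.
  have -> : cint mus (fun z => expR (- u z)) = cint mus (fun=> 1).
    apply/eqP; rewrite -subr_eq0 -cintB//; last exact: bB_cst.
    apply/eqP; apply: (cint_null musfin (measurableC mS) mS0).
      by apply: bBB => //; exact: bB_cst.
    move=> z cz /contrapT Sz; rewrite /u indicE in_setC mem_set//=.
    by rewrite mul0r oppr0 expR0 subrr.
  rewrite cint_cst mul1r -lee_fin fineK// ge0_fin_numE//.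
have cm_le : \int[cm]_(z in circ) (expR (- u z) * w z) <= 2.
  have -> : 2 = 1 + 1 :> R by [].
  have I1 : \int[cm]_(z in circ) (1 + w z) = 1 + \int[cm]_(z in circ) w z.
    rewrite (@RintegralD _ _ _ cm circ (fun=> 1) w (@measurable_circ R)
      (bB_integrable cmfin (bB_cst 1)) w_int).
    by have := cint_cst cm 1; rewrite /cint => ->; rewrite /= cm_circ mul1r.
  apply: (le_trans (y := 1 + \int[cm]_(z in circ) w z)); last by rewrite lerD2l.
  rewrite -I1; apply: le_Rintegral.
  - exact: measurable_circ.
  - have [me [M eM]] := be.
    have : cm.-integrable circ ((fun z : T => (w z)%:E) \* (EFin \o (fun z : T => expR (- u z))))%E.
      apply: integrableMl => //; first exact: measurable_circ.
      exists M; split; first by rewrite num_real.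
      by move=> y My z cz /=; rewrite (le_trans (eM _ cz))// ltW.
    by apply: eq_integrable => [|z _]; [exact: measurable_circ|rewrite /= mulrC].
  - apply: (@integrableD _ _ _ cm circ _ (EFin \o (fun=> 1)) (EFin \o (w : T -> R))) => //.
      exact: measurable_circ.
    exact: (bB_integrable cmfin (bB_cst 1)).
  - move=> z cz; rewrite /u indicE; case: (z \in _); rewrite ?mul1r ?mul0r.
      by case: (vpE n z).
    by rewrite oppr0 expR0 mul1r lerDr.
have : J <= expR (cint cm (v n)) * 3.
  rewrite -cu; apply: (le_trans (szego_bB mufin hJ bu)).
  by rewrite ler_wpM2l ?expR_ge0// muE//; lra.
rewrite -ler_pdivrMr// => h; rewrite -[leRHS]expRK ler_ln// posrE ?expR_gt0//.
by rewrite divr_gt0.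
Qed.

(** Since [|v| = 2 p - v], a lower bound on the mean of v and the bound 1 on the mean of p control
    the mean of [|v|], uniformly in n. *)
Let v_abs n : cint cm (fun z => `|v n z|) <= 2 - ln (J / 3).
Proof.
have h z : `|v n z| = 2 * p n z - v n z.
  by have [h1 h2 h3 _ _] := vpE n z; rewrite -/(v n z) -/(p n z) in h1 h2 h3 *; lra.
under [X in cint cm X]eq_fun do rewrite h.
rewrite cintB ?cintZ//; last exact: bBZ.
have : cint cm (p n) <= 1.
  apply: le_trans w_le1; apply: le_Rintegral => //.
  - exact: measurable_circ.
  - exact: bB_integrable.
  - by move=> z _; case: (vpE n z) => _ _ _ /andP[].
have := v_lower n; lra.
Qed.

(** The contrapositive of the half of Szego's theorem in use: a positive distance [J] forces log w
    to be integrable. The uniform bound [v_abs] passes to the limit by Fatou; the complement of the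
    circle is null for [circle_measure]. *)
Lemma szego_log_integrable : log_integrable w.
Proof.
have cv z : (v n z)%:E @[n --> \oo] --> lne (w z)%:E by exact: cvg_ln_clamp.
have ml : measurable_fun setT (fun z : T => lne (w z)%:E).
  apply: (@emeasurable_fun_cvg _ T R setT (fun n z => (v n z)%:E)) => [n|z _].
    by apply/measurable_EFinP; exact: mv.
  exact: cv.
have il : cm.-integrable circ (fun z : T => lne (w z)%:E).
  apply/integrableP; split; first exact: measurable_funTS.
  have mav n : measurable_fun circ (fun z : T => `|(v n z)%:E|%E).
    by apply: measurableT_comp => //; apply/measurable_EFinP; exact: measurable_funTS.
  have := @fatou _ T R cm circ measurable_circ (fun n z => `|(v n z)%:E|%E) mav
    (fun n z _ => abse_ge0 _).
  have -> : (\int[cm]_(z in circ) limn_einf (fun n => `|(v n z)%:E|) =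
      \int[cm]_(z in circ) `|lne (w z)%:E|)%E.
    apply: eq_integral => z _.
    have cva : (fun n => `|(v n z)%:E|%E) @ \oo --> `|lne (w z)%:E|%E.
      by apply: cvg_abse; exact: cv.
    by have [-> _] := cvg_limn_einf_sup cva.
  move=> h; apply: le_lt_trans (ltry (2 - ln (J / 3))); apply: (le_trans h).
  rewrite limn_einf_lim; apply: lime_le; first exact: is_cvg_einfs.
  apply: nearW => n; apply: (le_trans (y := (\int[cm]_(z in circ) `|(v n z)%:E|)%E)).
    by apply: ereal_inf_lbound; exists n => /=.
  have bav := bB_norm (bv n).
  have := v_abs n; rewrite /cint /Rintegral -lee_fin fineK//.
  by apply: integrable_fin_num; [exact: measurable_circ|exact: bB_integrable].
rewrite /log_integrable; apply/integrableP; split=> //.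
have mc := @measurable_circ R.
have mcC : measurable (~` circ) by exact: measurableC.
have cmC : cm (~` circ) = 0%E.
  rewrite /= /circle_measure (_ : expi @^-1` _ = set0) ?set0I ?measure0 ?mule0//.
  by apply/seteqP; split=> // t; apply; exact: expi_circ.
have mal : measurable_fun setT (fun z : T => `|lne (w z)%:E|%E).
  exact: measurableT_comp.
have malU : measurable_fun (circ `|` ~` circ) (fun z : T => `|lne (w z)%:E|%E).
  by rewrite setUv.
have E := ge0_integral_setU cm mc mcC malU (fun z _ => abse_ge0 _).
rewrite setUv in E; rewrite E; last by rewrite disj_set2E setICr.
rewrite [X in (_ + X)%E](_ : _ = 0%E) ?adde0; first by case/integrableP: il.
by apply: null_set_integral => //; exact: measurable_funTS.
Qed.
End szego_density.

(** * Density of the polynomials and of the rational functions *)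

Section square_norm.
Context {R : realType}.
Local Notation C := (cplx R).
Local Notation T := (borel_cplx R).
Local Notation circ := (@unit_circle R : set (borel_cplx R)).
Context (m : {measure set T -> \bar R}) (mfin : (m circ < +oo)%E).
Implicit Types (f g h : C -> C) (c : C).

Lemma ciE f : circle_integral m f =
  Complex (cint m (fun z => complex.Re (f z))) (cint m (fun z => complex.Im (f z))).
Proof. by []. Qed.

Lemma ci_ext f g : (forall z, circ z -> f z = g z) ->
  circle_integral m f = circle_integral m g.
Proof.
by move=> fg; rewrite !ciE; congr Complex; apply: cint_ext => z cz; rewrite fg.
Qed.

Lemma ciD f g : cB f -> cB g ->
  circle_integral m (fun z => f z + g z) = circle_integral m f + circle_integral m g.
Proof.
move=> [fr fi] [gr gi]; rewrite !ciE; apply: cplx_eq; rewrite ?ReD ?ImD /=.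
  by under eq_fun do rewrite ReD; exact: cintD.
by under eq_fun do rewrite ImD; exact: cintD.
Qed.

Lemma ciZ c f : cB f ->
  circle_integral m (fun z => c * f z) = c * circle_integral m f.
Proof.
move=> [fr fi]; rewrite !ciE; apply: cplx_eq; rewrite ?ReM ?ImM /=.
  under eq_fun do rewrite ReM.
  by rewrite cintB ?cintZ//; exact: bBZ.
under eq_fun do rewrite ImM.
by rewrite cintD ?cintZ//; exact: bBZ.
Qed.

Lemma ci_conj f : cB f ->
  circle_integral m (fun z => (f z)^*) = (circle_integral m f)^*.
Proof.
move=> [fr fi]; rewrite !ciE; apply: cplx_eq; rewrite ?Re_conj ?Im_conj /=.
  by under eq_fun do rewrite Re_conj.
by under eq_fun do rewrite Im_conj; rewrite cintN.
Qed.

Lemma ci0 : circle_integral m (fun=> 0) = 0.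
Proof. by rewrite ciE !cint_cst !mul0r. Qed.

Lemma ci_sum (I : Type) (s : seq I) (F : I -> C -> C) :
  (forall i, cB (F i)) ->
  circle_integral m (fun z => \sum_(i <- s) F i z) = \sum_(i <- s) circle_integral m (F i).
Proof.
move=> bF; elim: s => [|i s IH].
  by rewrite big_nil; apply: etrans ci0; apply: ci_ext => z _; rewrite big_nil.
rewrite big_cons -IH -ciD//; last exact: cB_sum.
by apply: ci_ext => z _; rewrite big_cons.
Qed.

Definition nsq f : R := cint m (fun z => cabs (f z) ^+ 2).

Lemma ci_nsq f : circle_integral m (fun z => (f z)^* * f z) = real_complex R (nsq f).
Proof.
rewrite ciE; apply: cplx_eq => /=.
  by apply: cint_ext => z _; rewrite conjM_cabs.
transitivity (cint m (fun=> 0)); last by rewrite cint_cst mul0r.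
by apply: cint_ext => z _; rewrite conjM_cabs.
Qed.

Lemma nsq_ge0 f : 0 <= nsq f.
Proof. by apply: cint_ge0 => z _; exact: sqr_ge0. Qed.

Lemma nsq_ext f g : (forall z, circ z -> cabs (f z) = cabs (g z)) -> nsq f = nsq g.
Proof. by move=> fg; apply: cint_ext => z cz; rewrite fg. Qed.

Lemma nsqZ c f : cB f -> nsq (fun z => c * f z) = cabs c ^+ 2 * nsq f.
Proof.
move=> bf; rewrite -cintZ//; last exact: bB_cabs2.
by apply: cint_ext => z _; rewrite cabsM exprMn.
Qed.

Lemma nsqD f g : cB f -> cB g -> nsq (fun z => f z + g z) <= 2 * nsq f + 2 * nsq g.
Proof.
move=> bf bg; have bf2 := bB_cabs2 bf; have bg2 := bB_cabs2 bg.
rewrite -!(cintZ mfin)// -(cintD mfin); try exact: bBZ.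
apply: (cint_le mfin); first by apply: bB_cabs2; exact: cBD.
  by apply: bBD; exact: bBZ.
move=> z _; have := cabs_sqD_le 1 (f z) (g z).
by rewrite !mul1r cabs1 expr1n mulr1.
Qed.

Lemma nsqM (B : R) f g : cB f -> cB g -> (forall z, circ z -> cabs (g z) <= B) ->
  nsq (fun z => g z * f z) <= B ^+ 2 * nsq f.
Proof.
move=> bf bg gB; have bf2 := bB_cabs2 bf; rewrite -cintZ//.
apply: cint_le => //; [by apply: bB_cabs2; exact: cBM|exact: bBZ|].
move=> z cz; rewrite cabsM exprMn ler_wpM2r ?sqr_ge0//.
by rewrite lerXn2r ?nnegrE ?cabs_ge0 ?gB// (le_trans (cabs_ge0 (g z)))// gB.
Qed.

Lemma nsq_le (B : R) f : 0 <= B -> cB f -> (forall z, circ z -> cabs (f z) <= B) ->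
  nsq f <= B ^+ 2 * fine (m circ).
Proof.
move=> B0 bf fB; rewrite -cint_cst; apply: cint_le => //.
- exact: bB_cabs2.
- exact: bB_cst.
- by move=> z cz; rewrite lerXn2r ?nnegrE ?cabs_ge0 ?fB.
Qed.

Definition l2clos (X : (C -> C) -> Prop) f := forall e : R, 0 < e ->
  exists2 g, X g & cB g /\ nsq (fun z => f z - g z) < e.

Lemma l2clos_sub X f : X f -> cB f -> l2clos X f.
Proof.
move=> Xf bf e e0; exists f => //; split=> //.
rewrite (@nsq_ext _ (fun=> 0)); last by move=> z _; rewrite subrr.
by rewrite /nsq cint_cst cabs0 expr0n mul0r.
Qed.

Lemma l2clos_ext X f g : (forall z, circ z -> f z = g z) -> l2clos X f -> l2clos X g.
Proof.
move=> fg Xf e /Xf[h Xh [bh he]]; exists h => //; split=> //.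
by rewrite -(@nsq_ext (fun z => f z - h z))// => z cz; rewrite fg.
Qed.

(** Squared norms obey ||F + G||^2 <= 2 ||F||^2 + 2 ||G||^2 in place of the triangle inequality,
    hence the quarters. *)
Lemma nsq_half f g h (e : R) : cB f -> cB g -> cB h ->
  nsq (fun z => f z - g z) < e / 4 -> nsq (fun z => g z - h z) < e / 4 ->
  nsq (fun z => f z - h z) < e.
Proof.
move=> bf bg bh h1 h2.
rewrite (@nsq_ext _ (fun z => (f z - g z) + (g z - h z))); last first.
  by move=> z _; rewrite addrA subrK.
apply: le_lt_trans (nsqD (cBB bf bg) (cBB bg bh)) _; lra.
Qed.

Lemma l2clos_trans X Y f : cB f -> (forall g, X g -> cB g -> l2clos Y g) ->
  l2clos X f -> l2clos Y f.
Proof.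
move=> bf XY Xf e e0; have e4 : 0 < e / 4 by lra.
have [g Xg [bg fg]] := Xf _ e4.
have [h Yh [bh gh]] := XY g Xg bg _ e4.
by exists h => //; split=> //; exact: nsq_half fg gh.
Qed.

Lemma l2clos_lin X c f g :
  (forall c f g, X f -> X g -> X (fun z => c * f z + g z)) ->
  cB f -> cB g -> l2clos X f -> l2clos X g -> l2clos X (fun z => c * f z + g z).
Proof.
move=> Xlin bf bg Xf Xg e e0.
have c0 := sqr_ge0 (cabs c).
(* The error is at most 2 |c|^2 ||f - f'||^2 + 2 ||g - g'||^2, and each term is to stay below e / 2;
   the added 1 covers c = 0. *)
have [f' Xf' [bf' ff']] : exists2 f', X f' & cB f' /\
   nsq (fun z => f z - f' z) < e / (4 * (cabs c ^+ 2 + 1)).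
  by apply: Xf; rewrite divr_gt0// mulr_gt0//; lra.
have [g' Xg' [bg' gg']] : exists2 g', X g' & cB g' /\ nsq (fun z => g z - g' z) < e / 4.
  by apply: Xg; lra.
exists (fun z => c * f' z + g' z); first exact: Xlin.
split; first by apply: cBD => //; apply: cBM => //; exact: cB_cst.
rewrite (@nsq_ext _ (fun z => c * (f z - f' z) + (g z - g' z))); last first.
  by move=> z _; congr cabs; ring.
have bff := cBB bf bf'; have bgg := cBB bg bg'.
apply: le_lt_trans (nsqD (cBM (cB_cst c) bff) bgg) _; rewrite nsqZ//.
move: ff'; rewrite ltr_pdivlMr ?mulr_gt0//; last lra.
have := nsq_ge0 (fun z => f z - f' z).
move: (nsq _) (nsq _) gg' c0 => x y; move: (cabs c ^+ 2) => d; nra.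
Qed.

(** Bounded pointwise convergence implies convergence in L2 of a finite measure, so closures inherit
    the induction over [bcl]. *)
Lemma l2clos_lim X (f : nat -> C -> C) g (M : R) : (forall n, cB (f n)) -> cB g ->
  (forall n, l2clos X (f n)) ->
  (forall n z, circ z -> cabs (g z - f n z) <= M) ->
  (forall z, circ z -> cabs (g z - f n z) @[n --> \oo] --> 0) -> l2clos X g.
Proof.
move=> bf bg Xf fM fg e e0.
have cv : (fun n => nsq (fun z => g z - f n z)) @ \oo --> cint m (fun=> 0).
  apply: (@cint_cvg _ _ mfin _ _ (M ^+ 2)) => [n|n z cz|z cz].
  - by apply: bB_cabs2; exact: cBB.
  - have := fM n z cz; have := cabs_ge0 (g z - f n z); rewrite ger0_norm ?sqr_ge0//.
    by move=> h1 h2; rewrite lerXn2r ?nnegrE// (le_trans h1).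
  - have -> : 0 = (0 : R) * 0 by rewrite mulr0.
    by apply: cvgM; exact: fg.
rewrite cint_cst mul0r in cv.
have e4 : 0 < e / 4 by lra.
have /cvgrPdist_lt/(_ _ e4)[N _ /(_ N (leqnn N))] := cv.
rewrite sub0r normrN ger0_norm ?nsq_ge0// => h1.
have [h Xh [bh fh]] := Xf N _ e4.
by exists h => //; split=> //; exact: nsq_half h1 fh.
Qed.

End square_norm.

(** * Density of the polynomials when log mu' is not integrable *)

Section polynomial_density.
Context {R : realType}.
Local Notation C := (cplx R).
Local Notation T := (borel_cplx R).
Local Notation circ := (@unit_circle R : set (borel_cplx R)).
Context (mu : probability T R) (w : C -> R).
Context (mu1 : mu circ = 1%E) (hw : ac_density mu w) (nlog : ~ log_integrable w).

Let mufin : (mu circ < +oo)%E. Proof. by rewrite mu1 ltry. Qed.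

Definition is_poly_fun (f : C -> C) := exists p : {poly C}, forall z, f z = p.[z].

Local Notation clos := (l2clos mu is_poly_fun).

Lemma is_poly_fun_lin (c : C) f g : is_poly_fun f -> is_poly_fun g ->
  is_poly_fun (fun z => c * f z + g z).
Proof.
by move=> [p pE] [q qE]; exists (c *: p + q) => z; rewrite hornerD hornerZ pE qE.
Qed.

Let cB_conjz : cB (fun z : C => z^*).
Proof. exact: cB_conj (@cB_id R). Qed.

(** On the circle |conj z + h| = |1 + z h|: the distance from conj z to the polynomials is the
    distance from 1 to the polynomials vanishing at 0. Were it positive, [szego_log_integrable]
    would contradict [nlog]. *)
Lemma clos_conjz : clos (fun z => z^*).
Proof.
move=> e e0.
have [h he] : exists h : {poly C}, cint mu (fun z => cabs (1 + z * h.[z]) ^+ 2) < e.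
  apply: contrapT => nh; apply: nlog; apply: (szego_log_integrable mu1 hw e0) => h.
  by rewrite leNgt; apply/negP => he; apply: nh; exists h.
exists (fun z => (- h).[z]); first by exists (- h).
split; first exact: cB_poly.
rewrite (@nsq_ext _ _ _ (fun z => 1 + z * h.[z]))// => z cz.
rewrite hornerN opprK.
have -> : z^* + h.[z] = z^* * (1 + z * h.[z]).
  by rewrite mulrDr mulr1 mulrA circ_conjM// mul1r.
by rewrite cabsM cabs_conj (circ_cabs z).1// mul1r.
Qed.

(** Multiplication by conj z is isometric on the circle and maps q z + c to q + c conj z, which
    [clos_conjz] places in the closure. The auxiliary class [X] holds the images of the
    polynomials. *)
Lemma clos_mul_conjz f : cB f -> clos f -> clos (fun z => z^* * f z).
Proof.
move=> bf cf.
pose X (g : C -> C) := exists p : {poly C}, forall z, g z = z^* * p.[z].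
apply: (@l2clos_trans _ _ mufin X); first exact: cBM.
  move=> g [p gE] bg.
  have [q [c pE]] : exists (q : {poly C}) (c : C), p = q * 'X + c%:P.
    elim/poly_ind: p {gE} => [|q c _]; last by exists q, c.
    by exists 0, 0; rewrite mul0r add0r.
  apply: (@l2clos_ext _ _ _ (fun z => c * z^* + q.[z])).
    move=> z cz; rewrite gE pE hornerD hornerM hornerX hornerC mulrDr addrC.
    congr (_ + _); last exact: mulrC.
    by rewrite [z^* * _]mulrCA circ_conjM ?mulr1.
  apply: (@l2clos_lin _ _ mufin _ c (fun z => z^*) (fun z => q.[z]) is_poly_fun_lin) => //.
  - exact: cB_poly.
  - exact: clos_conjz.
  by apply: l2clos_sub; [exists q|exact: cB_poly].
move=> e e0; have [g [p gE] [bg fg]] := cf e e0.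
exists (fun z => z^* * g z); first by exists p => z; rewrite gE.
split; first exact: cBM.
rewrite (@nsq_ext _ _ _ (fun z => f z - g z))// => z cz.
by rewrite -mulrBr cabsM cabs_conj (circ_cabs z).1// mul1r.
Qed.

Lemma clos_conjzX n : clos (fun z => (z^*) ^+ n).
Proof.
elim: n => [|n IH].
  by apply: l2clos_sub (cB_cst 1); exists 1 => z; rewrite hornerC.
apply: (@l2clos_ext _ _ _ (fun z => z^* * (z^*) ^+ n)).
  by move=> z _; rewrite exprS.
by apply: clos_mul_conjz IH; exact: cBX.
Qed.

Lemma clos_conj_poly (p : {poly C}) : clos (fun z => (p.[z])^*).
Proof.
rewrite -[p]coefK poly_def.
apply: (big_ind (fun p : {poly C} => clos (fun z => (p.[z])^*))).
- by apply: l2clos_sub; [exists 0 => z; rewrite horner0 conjC0|under eq_fun do rewrite horner0; exact: cB_cst].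
- move=> f g cf cg; apply: (@l2clos_ext _ _ _ (fun z => 1 * (f.[z])^* + (g.[z])^*)).
    by move=> z _; rewrite mul1r hornerD rmorphD.
  apply: (@l2clos_lin _ _ mufin _ 1 (fun z => (f.[z])^*) (fun z => (g.[z])^*)
    is_poly_fun_lin) => //; apply: cB_conj; exact: cB_poly.
move=> i _; apply: (@l2clos_ext _ _ _ (fun z => (p`_i)^* * (z^*) ^+ i + 0)).
  by move=> z _; rewrite addr0 hornerZ hornerXn rmorphM rmorphXn.
apply: (@l2clos_lin _ _ mufin _ _ (fun z => (z^*) ^+ i) (fun=> 0) is_poly_fun_lin).
- exact: cBX.
- exact: cB_cst.
- exact: clos_conjzX.
- by apply: l2clos_sub (cB_cst 0); exists 0 => z; rewrite horner0.
Qed.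

(** Since Re p = (p + conj p) / 2, the base of the induction over [bcl] needs conjugates of
    polynomials in the closure; this is where non-integrability of the logarithm enters. *)
Lemma clos_real (f : C -> R) : bB f -> clos (fun z => real_complex R (f z)).
Proof.
move/bB_bcl; elim=> [p|{}f g M bf IH fM fg].
  pose h : C := real_complex R 2^-1.
  apply: (@l2clos_ext _ _ _ (fun z => h * (p.[z])^* + (h *: p).[z])).
    by move=> z _; rewrite hornerZ; apply: cplx_eq;
      rewrite ?ReD ?ImD ?ReM ?ImM ?Re_conj ?Im_conj /=; field.
  apply: (@l2clos_lin _ _ mufin _ h (fun z => (p.[z])^*)
    (fun z => (h *: p).[z]) is_poly_fun_lin).
  - by apply: cB_conj; exact: cB_poly.
  - exact: cB_poly.
  - exact: clos_conj_poly.
  - by apply: l2clos_sub (cB_poly _); exists (h *: p).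
have bfn n := bcl_bB (bf n).
have bg := bB_lim bfn fM fg.
have [_ [N gN]] := bg.
apply: (@l2clos_lim _ _ mufin _ (fun n z => real_complex R (f n z)) _ (N + M)) => //.
- by move=> n; exact: cB_toC.
- exact: cB_toC.
- move=> n z cz; rewrite -toCB cabs_toC (le_trans (ler_normB _ _))// lerD ?gN ?fM//.
move=> z cz; under eq_fun do rewrite -toCB cabs_toC.
rewrite -(normr0 R) -(subrr (g z)); apply: cvg_norm; apply: cvgB (fg z cz).
exact: cvg_cst.
Qed.

Lemma poly_dense (f : C -> C) : cB f -> clos f.
Proof.
move=> [fr fi].
apply: (@l2clos_ext _ _ _ (fun z => Complex 0 1 * real_complex R (complex.Im (f z))
  + real_complex R (complex.Re (f z)))).
  by move=> z _; apply: cplx_eq; rewrite ?ReD ?ImD ?ReM ?ImM /=; ring.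
by apply: (@l2clos_lin _ _ mufin _ _ (fun z => real_complex R (complex.Im (f z)))
  (fun z => real_complex R (complex.Re (f z))) is_poly_fun_lin);
  (try exact: cB_toC); exact: clos_real.
Qed.

End polynomial_density.

Section reciprocal.
Context {R : realType}.
Local Notation C := (cplx R).
Local Notation T := (borel_cplx R).
Local Notation circ := (@unit_circle R : set (borel_cplx R)).

(** 1 / f = conj f / |f|^2, and 1 / |f|^2 is written exp (- ln |f|^2), a composition of measurable
    functions. *)
Lemma cB_inv (f : C -> C) (d : R) : 0 < d -> cB f ->
  (forall z, circ z -> d <= cabs (f z)) -> cB (fun z => (f z)^-1).
Proof.
move=> d0 bf fd.
pose g (z : C) : R := expR (- ln (cabs (f z) ^+ 2)).
have c0 z : circ z -> 0 < cabs (f z) by move=> cz; rewrite (lt_le_trans d0)// fd.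
have gE z : circ z -> g z = (cabs (f z) ^+ 2)^-1.
  by move=> cz; rewrite /g expRN lnK// posrE exprn_gt0// c0.
have bg : bB g.
  have [mf _] := bB_cabs2 bf; split.
    apply: measurableT_comp; first exact: measurable_expR.
    apply: measurableT_comp => //.
    by apply: measurableT_comp => //; exact: measurable_ln.
  exists (d ^+ 2)^-1 => z cz; rewrite gE// ger0_norm ?invr_ge0 ?sqr_ge0//.
  rewrite lef_pV2 ?posrE ?exprn_gt0 ?c0//.
  by rewrite lerXn2r ?nnegrE ?cabs_ge0 ?fd// ltW.
apply: (@cB_ext _ (fun z => (f z)^* * real_complex R (g z))); last first.
  by apply: cBM; [exact: cB_conj|exact: cB_toC].
move=> z cz; have f0 : f z != 0 by rewrite -cabs_gt0 c0.
apply: (mulIf f0); rewrite mulVf// mulrAC conjM_cabs gE// -toCM mulfV//.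
by rewrite expf_neq0// gt_eqF// c0.
Qed.

End reciprocal.

(** * Uniform approximation of polynomials by rational functions *)

Section rational_density.
Context {R : realType}.
Local Notation C := (cplx R).
Local Notation T := (borel_cplx R).
Local Notation circ := (@unit_circle R : set (borel_cplx R)).
Context (alpha : nat -> C)
  (alpha_disk : forall n, `|alpha n| < 1)
  (alpha_compact : sup (range (fun n => cabs (alpha n))) < 1).

Lemma alpha_cabs n : cabs (alpha n) < 1.
Proof. by rewrite -norm_lt1. Qed.

Lemma alpha_bound : exists2 r : R, 0 <= r < 1 & forall n, cabs (alpha n) <= r.
Proof.
have h n : cabs (alpha n) <= sup (range (fun n => cabs (alpha n))).
  apply: ub_le_sup; last by exists n.
  by exists 1 => _ [k _ <-]; rewrite ltW// alpha_cabs.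
exists (sup (range (fun n => cabs (alpha n)))) => //.
by rewrite alpha_compact andbT (le_trans _ (h 0%N))// cabs_ge0.
Qed.

Lemma varpi_cabs_ge n z : cabs z <= 1 -> 1 - cabs (alpha n) <= cabs (varpi alpha n z).
Proof.
move=> z1; rewrite /varpi lerBlDr.
have -> : 1 = cabs ((1 - (alpha n)^* * z) + (alpha n)^* * z) by rewrite subrK cabs1.
rewrite (le_trans (cabsD _ _))// lerD2l cabsM cabs_conj.
by rewrite ler_piMr// cabs_ge0.
Qed.

Lemma varpi_neq0 n z : cabs z <= 1 -> varpi alpha n z != 0.
Proof.
move=> z1; rewrite -cabs_gt0 (lt_le_trans _ (varpi_cabs_ge n z1))// subr_gt0.
exact: alpha_cabs.
Qed.

Lemma varpi_circ n z : circ z -> varpi alpha n z != 0.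
Proof. by move=> /circ_cabs z1; apply: varpi_neq0; rewrite z1. Qed.

Lemma varpi_star_circ n z : circ z -> varpi_star alpha n z != 0.
Proof.
move=> /circ_cabs z1; rewrite /varpi_star subr_eq0; apply/eqP => za.
by have := alpha_cabs n; rewrite -za z1 ltxx.
Qed.

Lemma cB_varpi n : cB (varpi alpha n).
Proof. by apply: cBB (cB_cst 1) _; apply: cBM (cB_cst _) (@cB_id R). Qed.

Lemma cB_varpi_star n : cB (varpi_star alpha n).
Proof. exact: cBB (@cB_id R) (cB_cst _). Qed.

Lemma cB_zeta n : cB (zeta alpha n).
Proof.
apply: cBM (cB_varpi_star n) _; apply: (@cB_inv _ _ (1 - cabs (alpha n))).
- by rewrite subr_gt0 alpha_cabs.
- exact: cB_varpi.
- by move=> z /circ_cabs z1; apply: varpi_cabs_ge; rewrite z1.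
Qed.

Lemma blaschke0 z : blaschke alpha 0 z = 1.
Proof. by rewrite /blaschke big_geq. Qed.

Lemma blaschkeS n z : blaschke alpha n.+1 z = blaschke alpha n z * zeta alpha n.+1 z.
Proof. by rewrite /blaschke big_nat_recr. Qed.

Lemma cB_blaschke n : cB (blaschke alpha n).
Proof.
elim: n => [|n IH].
  by apply: (cB_ext _ (cB_cst 1)) => z _; rewrite blaschke0.
by apply: (cB_ext _ (cBM IH (cB_zeta n.+1))) => z _; rewrite blaschkeS.
Qed.

Lemma in_span_le (u : nat -> C -> C) n k f : (n <= k)%N ->
  in_span u n f -> in_span u k f.
Proof.
move=> nk [c fE]; exists (fun i => if (i <= n)%N then c i else 0) => z.
rewrite fE (@big_cat_nat _ _ _ n.+1 0 k.+1)//= [X in _ + X]big1_seq ?addr0.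
  by apply: eq_big_nat => i; rewrite ltnS => /andP[_ ->].
move=> i /andP[_]; rewrite mem_index_iota => /andP[ni _].
by rewrite leqNgt ni mul0r.
Qed.

Lemma in_span_lin (u : nat -> C -> C) n c f g :
  in_span u n f -> in_span u n g -> in_span u n (fun z => c * f z + g z).
Proof.
move=> [a fE] [b gE]; exists (fun k => c * a k + b k) => z.
rewrite fE gE mulr_sumr -big_split /=; apply: eq_bigr => i _.
by rewrite mulrDl mulrA.
Qed.

Lemma in_span_basis (u : nat -> C -> C) n : in_span u n (u n).
Proof.
exists (fun k => (k == n)%:R) => z.
rewrite big_nat_recr//= eqxx mul1r big1_seq ?add0r// => i /andP[_].
by rewrite mem_index_iota => /andP[_ /ltn_eqF ->]; rewrite mul0r.
Qed.

Definition rational_fun (f : C -> C) := exists n, in_span (blaschke alpha) n f.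

Lemma rational_fun_lin c f g : rational_fun f -> rational_fun g ->
  rational_fun (fun z => c * f z + g z).
Proof.
move=> [n fn] [k gk]; exists (maxn n k); apply: in_span_lin.
  exact: in_span_le fn (leq_maxl _ _) || exact: (in_span_le (leq_maxl n k) fn).
exact: (in_span_le (leq_maxr n k) gk).
Qed.

Lemma cB_rational f : rational_fun f -> cB f.
Proof.
move=> [n [c fE]]; have -> : f = fun z => \sum_(0 <= k < n.+1) c k * blaschke alpha k z.
  by apply/funext.
by apply: cB_sum => i; apply: cBM (cB_cst _) (cB_blaschke i).
Qed.

Definition unif_rational (f : C -> C) := forall e : R, 0 < e ->
  exists2 h, rational_fun h & forall z, circ z -> cabs (f z - h z) <= e.

Lemma unif_rational_lin c f g : unif_rational f -> unif_rational g ->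
  unif_rational (fun z => c * f z + g z).
Proof.
move=> uf ug e e0.
have c1 : 0 < cabs c + 1 by rewrite ltr_wpDl ?cabs_ge0.
have [|f' rf' ff'] := uf (e / 2 / (cabs c + 1)); first by rewrite !divr_gt0.
have [|g' rg' gg'] := ug (e / 2); first by rewrite divr_gt0.
exists (fun z => c * f' z + g' z); first exact: rational_fun_lin.
move=> z cz.
have -> : c * f z + g z - (c * f' z + g' z) = c * (f z - f' z) + (g z - g' z) by ring.
rewrite (le_trans (cabsD _ _))// [leRHS]splitr lerD ?gg'// cabsM.
have := ff' z cz; rewrite ler_pdivlMr// => h; apply: le_trans h; rewrite mulrC.
by rewrite ler_wpM2l ?cabs_ge0// lerDl.
Qed.

Lemma unif_rational_ext f g : (forall z, circ z -> f z = g z) ->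
  unif_rational f -> unif_rational g.
Proof.
by move=> fg uf e /uf[h rh fh]; exists h => // z cz; rewrite -fg// fh.
Qed.

Lemma unif_rational_lim f : (forall e : R, 0 < e -> exists2 h, unif_rational h &
  forall z, circ z -> cabs (f z - h z) <= e) -> unif_rational f.
Proof.
move=> uf e e0; have e2 : 0 < e / 2 by rewrite divr_gt0.
have [h uh fh] := uf _ e2; have [g rg hg] := uh _ e2.
exists g => // z cz; rewrite -[f z](subrK (h z)) -addrA.
by rewrite (le_trans (cabsD _ _))// [leRHS]splitr lerD ?fh ?hg.
Qed.

Lemma unif_rational1 : unif_rational (fun=> 1).
Proof.
move=> e e0; exists (fun=> 1); last by move=> z _; rewrite subrr cabs0 ltW.
exists 0%N; exists (fun=> 1) => z; by rewrite big_nat1 blaschke0 mul1r.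
Qed.

(** From |varpi|^2 - |varpi_star|^2 = (1 - |w|^2) (1 - |alpha_n|^2) and |varpi| <= 2, each factor
    satisfies |zeta|^2 <= 1 - d with d independent of n, because |alpha_n| <= r < 1. Hence the
    Blaschke products decay geometrically at w. *)
Lemma zeta_sqr_le (w : C) : cabs w < 1 -> exists2 s : R, 0 <= s < 1 &
  forall n, cabs (zeta alpha n w) ^+ 2 <= s.
Proof.
move=> w1; have [r /andP[r0 r1] ar] := alpha_bound.
have w0 := cabs_ge0 w.
pose d := (1 - cabs w ^+ 2) * (1 - r ^+ 2) / 4.
have hw : 0 < 1 - cabs w ^+ 2 <= 1 by apply/andP; split; nra.
have hr : 0 < 1 - r ^+ 2 <= 1 by apply/andP; split; nra.
exists (1 - d); first by rewrite /d; apply/andP; split; nra.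
move=> n; have v0 := varpi_neq0 n (ltW w1).
have E : cabs (varpi alpha n w) ^+ 2 - cabs (varpi_star alpha n w) ^+ 2 =
    (1 - cabs w ^+ 2) * (1 - cabs (alpha n) ^+ 2).
  rewrite /varpi /varpi_star !sqr_cabs !ReB !ImB !ReM !ImM !Re_conj !Im_conj /=; ring.
have vle : cabs (varpi alpha n w) <= 2.
  rewrite (le_trans (cabsD _ _))// cabs1 cabsN cabsM cabs_conj.
  have := alpha_cabs n; have := cabs_ge0 (alpha n); nra.
have vgt : 0 < cabs (varpi alpha n w) by rewrite cabs_gt0.
rewrite /zeta cabsM cabsV exprMn exprVn ler_pdivrMr ?exprn_gt0//.
have a2 : cabs (alpha n) ^+ 2 <= r ^+ 2 by rewrite lerXn2r ?nnegrE ?cabs_ge0.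
have v4 : cabs (varpi alpha n w) ^+ 2 <= 4.
  have -> : 4 = 2 ^+ 2 :> R by ring.
  by rewrite lerXn2r ?nnegrE ?cabs_ge0.
have h1 : (1 - cabs w ^+ 2) * (1 - r ^+ 2) <= (1 - cabs w ^+ 2) * (1 - cabs (alpha n) ^+ 2).
  by rewrite ler_wpM2l//; lra.
have h2 : d * cabs (varpi alpha n w) ^+ 2 <= d * 4.
  by rewrite ler_wpM2l// /d; apply: divr_ge0 => //; apply: mulr_ge0; lra.
have : d * 4 = (1 - cabs w ^+ 2) * (1 - r ^+ 2) by rewrite /d; field.
lra.
Qed.

(* [kern w n] interpolates the Cauchy kernel [1 / (1 - w^* z)] at the points
   [alpha 0, ..., alpha n] (Christoffel-Darboux). *)
Fixpoint kern (w : C) (n : nat) (z : C) : C :=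
  if n is n'.+1 then kern w n' z +
    w^* * (blaschke alpha n' w)^* / (varpi alpha n'.+1 w)^* *
    (blaschke alpha n'.+1 z + alpha n'.+1 * blaschke alpha n' z)
  else 1.

Lemma kern_rational w n : rational_fun (kern w n).
Proof.
exists n; elim: n => [|n IH].
  by exists (fun=> 1) => z; rewrite big_nat1 blaschke0 mul1r.
set c := w^* * (blaschke alpha n w)^* / (varpi alpha n.+1 w)^*.
have -> : kern w n.+1 = fun z => c * (alpha n.+1 * blaschke alpha n z +
    blaschke alpha n.+1 z) + kern w n z.
  by apply/funext => z /=; rewrite -/c addrC [X in c * X]addrC.
apply: in_span_lin; last exact: (in_span_le (leqnSn n) IH).
apply: in_span_lin; last exact: in_span_basis.
exact: (in_span_le (leqnSn n) (@in_span_basis _ n)).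
Qed.

(** The term added at each step multiplies the interpolation error by zeta(z) conj zeta(w). The
    initial error z conj w plays the part of a zeta factor at the origin. *)
Lemma kernE w n z : cabs w < 1 -> circ z ->
  kern w n z * (1 - w^* * z) = 1 - z * blaschke alpha n z * (w^* * (blaschke alpha n w)^*).
Proof.
move=> w1 cz; elim: n => [|n IH].
  by rewrite /= !blaschke0 conjC1 !mulr1 mul1r mulrC.
rewrite /= mulrDl IH.
have vz := varpi_circ n.+1 cz; have vw := varpi_neq0 n.+1 (ltW w1).
rewrite !blaschkeS !conjM.
have vw' : (varpi alpha n.+1 w)^* != 0 by rewrite conjC_eq0.
rewrite /zeta conjV.
have Evw : (varpi alpha n.+1 w)^* = 1 - alpha n.+1 * w^*.
  by rewrite /varpi conjB conjC1 conjM conjCK.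
have Ews : (varpi_star alpha n.+1 w)^* = w^* - (alpha n.+1)^*.
  by rewrite /varpi_star conjB.
rewrite Ews Evw in vw' *.
rewrite /varpi_star /varpi in vz *.
move: (blaschke alpha n z) (blaschke alpha n w)^* vz vw'.
move: (alpha n.+1) (alpha n.+1)^* (w^*) => a a' w' b b' vz vw'.
by field; rewrite vz vw'.
Qed.

Definition cauchy (w z : C) : C := (1 - w^* * z)^-1.

Lemma cauchy_den_ge w z : cabs w < 1 -> circ z -> 1 - cabs w <= cabs (1 - w^* * z).
Proof.
move=> w1 /circ_cabs z1; rewrite lerBlDr.
have -> : 1 = cabs ((1 - w^* * z) + w^* * z) by rewrite subrK cabs1.
by rewrite (le_trans (cabsD _ _))// lerD2l cabsM cabs_conj z1 mulr1.
Qed.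

Lemma cauchy_den_neq0 w z : cabs w < 1 -> circ z -> 1 - w^* * z != 0.
Proof.
move=> w1 cz; rewrite -cabs_gt0 (lt_le_trans _ (cauchy_den_ge w1 cz))//.
by rewrite subr_gt0.
Qed.

Lemma cabs_blaschke_circ n z : circ z -> cabs (blaschke alpha n z) = 1.
Proof.
move=> cz; have /circ_cabs z1 := cz.
elim: n => [|n IH]; first by rewrite blaschke0 cabs1.
rewrite blaschkeS cabsM IH mul1r /zeta cabsM cabsV.
have -> : cabs (varpi_star alpha n.+1 z) = cabs (varpi alpha n.+1 z).
  have -> : varpi_star alpha n.+1 z = (varpi alpha n.+1 z)^* * z.
    rewrite /varpi /varpi_star conjB conjC1 conjM conjCK mulrBl mul1r.
    by rewrite -mulrA circ_conjM// mulr1.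
  by rewrite cabsM cabs_conj z1 mulr1.
by rewrite mulfV// cabs_eq0 varpi_circ.
Qed.

(** On the circle |B_N(z)| = 1, so the error in [kernE] is controlled by |B_N(w)|, which tends to 0;
    dividing by 1 - conj w z costs at most 1 / (1 - |w|), whence the choice of [d]. *)
Lemma unif_cauchy w : cabs w < 1 -> unif_rational (cauchy w).
Proof.
move=> w1 e e0.
have [s /andP[s0 s1] hs] := zeta_sqr_le w1.
have Bs n : cabs (blaschke alpha n w) ^+ 2 <= s ^+ n.
  elim: n => [|n IH]; first by rewrite blaschke0 cabs1 expr1n.
  by rewrite blaschkeS cabsM exprMn [leRHS]exprSr ler_pM ?sqr_ge0.
pose d := e * (1 - cabs w).
have d0 : 0 < d by rewrite mulr_gt0// subr_gt0.
have : (fun n => s ^+ n) @ \oo --> (0 : R) by apply: cvg_expr; rewrite ger0_norm.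
have d2 : 0 < d ^+ 2 by rewrite exprn_gt0.
move=> /cvgrPdist_lt/(_ _ d2)[N _ /(_ N (leqnn N))].
rewrite sub0r normrN ger0_norm ?exprn_ge0// => sN.
exists (kern w N); first exact: kern_rational.
move=> z cz; have q0 := cauchy_den_neq0 w1 cz.
have -> : cauchy w z - kern w N z =
    z * blaschke alpha N z * (w^* * (blaschke alpha N w)^*) / (1 - w^* * z).
  apply: (mulIf q0); rewrite mulfVK// mulrBl mulVf// kernE//; ring.
have /circ_cabs z1 := cz.
rewrite !cabsM cabsV z1 cabs_blaschke_circ// !mul1r !cabs_conj.
rewrite ler_pdivrMr ?cabs_gt0//.
have BN : cabs (blaschke alpha N w) <= d.
  rewrite -(@ler_pXn2r _ 2) ?nnegrE ?cabs_ge0 ?(ltW d0)//.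
  by rewrite (le_trans (Bs N))// ltW.
apply: (le_trans (y := d)).
  by rewrite (le_trans _ BN)// ler_piMl ?cabs_ge0// ltW.
by rewrite /d ler_wpM2l ?(ltW e0)// cauchy_den_ge.
Qed.

(** Since z c_w = (c_w - 1) / conj w for the Cauchy kernel c_w, each further factor z stays in the
    uniform closure when w != 0. Letting w tend to 0 then removes the kernel and leaves the
    monomial, which feeds the next step. *)
Lemma unif_monomial n : unif_rational (fun z => z ^+ n) /\
  forall w, w != 0 -> cabs w < 1 -> unif_rational (fun z => z ^+ n * cauchy w z).
Proof.
elim: n => [|n [IH1 IH2]].
  split; first exact: unif_rational1.
  by move=> w _ w1; apply: (unif_rational_ext _ (unif_cauchy w1)) => z _; rewrite mul1r.
have H w : w != 0 -> cabs w < 1 -> unif_rational (fun z => z ^+ n.+1 * cauchy w z).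
  move=> w0 w1; have w0' : w^* != 0 by rewrite conjC_eq0.
  have u2 : unif_rational (fun z => - 1 * z ^+ n + z ^+ n * cauchy w z).
    by apply: unif_rational_lin; [exact: IH1|exact: IH2].
  have u0 : unif_rational (fun z => 0).
    apply: (unif_rational_ext _ (unif_rational_lin (-1) unif_rational1 unif_rational1)) => z _.
    by rewrite mulr1 addNr.
  apply: (unif_rational_ext _ (unif_rational_lin (w^*)^-1 u2 u0)) => z cz.
  have q0 := cauchy_den_neq0 w1 cz.
  rewrite /cauchy exprS; field.
  by rewrite q0.
split=> //; apply: unif_rational_lim => e e0.
(* The error of the kernel at w = t is at most t / (1 - t) <= 2 t <= e. *)
pose t : R := Num.min (1 / 2) (e / 2).
have t0 : 0 < t by rewrite lt_min !divr_gt0.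
have t1 : t <= 1 / 2 by rewrite ge_min lexx.
have te : t <= e / 2 by rewrite ge_min lexx orbT.
pose w : C := real_complex R t.
have wt : cabs w = t by rewrite cabs_toC gtr0_norm.
have w1 : cabs w < 1 by rewrite wt; lra.
exists (fun z => z ^+ n.+1 * cauchy w z).
  by apply: H => //; rewrite -cabs_gt0 wt.
move=> z cz; have q0 := cauchy_den_neq0 w1 cz.
have -> : z ^+ n.+1 - z ^+ n.+1 * cauchy w z = - (z ^+ n.+1 * (w^* * z)) / (1 - w^* * z).
  by rewrite /cauchy; field.
have /circ_cabs z1 := cz.
rewrite cabsM cabsN cabsV !cabsM cabsX z1 expr1n mul1r mulr1 cabs_conj wt.
rewrite ler_pdivrMr ?cabs_gt0//.
have := cauchy_den_ge w1 cz; rewrite wt; nra.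
Qed.

Lemma unif_poly (p : {poly C}) : unif_rational (fun z => p.[z]).
Proof.
rewrite -[p]coefK poly_def; apply: (big_ind (fun p : {poly C} => unif_rational (fun z => p.[z]))).
- move=> e e0; exists (fun=> 0); last by move=> z _; rewrite horner0 subrr cabs0 ltW.
  by exists 0%N, (fun=> 0) => z; rewrite big_nat1 mul0r.
- move=> f g uf ug; apply: (unif_rational_ext _ (unif_rational_lin 1 uf ug)) => z _.
  by rewrite mul1r hornerD.
move=> i _; have [u _] := unif_monomial i.
have u0 : unif_rational (fun z => 0).
  apply: (unif_rational_ext _ (unif_rational_lin (-1) unif_rational1 unif_rational1)) => z _.
  by rewrite mulr1 addNr.
apply: (unif_rational_ext _ (unif_rational_lin p`_i u u0)) => z _.
by rewrite addr0 hornerZ hornerXn.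
Qed.

Context (mu : probability T R) (w : C -> R).
Context (mu1 : mu circ = 1%E) (hw : ac_density mu w) (nlog : ~ log_integrable w).

Lemma rational_dense (f : C -> C) : cB f -> l2clos mu rational_fun f.
Proof.
move=> bf; have mufin : (mu circ < +oo)%E by rewrite mu1 ltry.
apply: (@l2clos_trans _ _ mufin (@is_poly_fun R)) => //; last exact: (poly_dense mu1 hw nlog).
move=> g [p gp] bg e e0.
(* Then d^2 <= d <= e / 2 < e, and the circle has mass 1. *)
pose d : R := Num.min 1 (e / 2).
have d0 : 0 < d by rewrite lt_min ltr01 divr_gt0.
have [h rh hE] := unif_poly p d0.
have bh := cB_rational rh.
exists h => //; split=> //.
have d1 : d <= 1 by rewrite ge_min lexx.
have de : d <= e / 2 by rewrite ge_min lexx orbT.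
apply: (@le_lt_trans _ _ (d ^+ 2 * fine (mu circ))).
  apply: (nsq_le mufin (ltW d0)); first exact: cBB.
  by move=> z cz; rewrite gp hE.
rewrite mu1 mulr1; nra.
Qed.

End rational_density.

(** * The space l2 and its operators *)

Section l2_space.
Context {R : realType}.
Local Notation C := (cplx R).
Local Notation l2 := (l2 R).
Implicit Types (x y : l2) (u : nat -> C) (c : C).

Lemma real_cvg_unique (v : nat -> R) (l l' : R) :
  v @ \oo --> l -> v @ \oo --> l' -> l = l'.
Proof. by move=> h h'; apply: (cvg_unique _ h h'). Qed.

Lemma conjN c : (- c)^* = - c^*.
Proof. exact: rmorphN. Qed.

Definition psum u n : R := \sum_(0 <= k < n) cabs (u k) ^+ 2.

Lemma psum_ge0 u n : 0 <= psum u n.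
Proof. by apply: sumr_ge0 => i _; exact: sqr_ge0. Qed.

Lemma psumS u n : psum u n.+1 = psum u n + cabs (u n) ^+ 2.
Proof. by rewrite /psum big_nat_recr. Qed.

Lemma psum_le u n k : (n <= k)%N -> psum u n <= psum u k.
Proof.
move=> nk; rewrite /psum (@big_cat_nat _ _ _ n 0 k)//= lerDl.
by apply: sumr_ge0 => i _; exact: sqr_ge0.
Qed.

Lemma psum_sq_sum u n : ((psum u n)%:E <= sq_sum u)%E.
Proof.
rewrite /psum -sumEFin; apply: nneseries_lim_ge => k _ _.
by rewrite lee_fin sqr_ge0.
Qed.

Lemma sq_sum_le u (B : R) : (forall n, psum u n <= B) -> (sq_sum u <= B%:E)%E.
Proof.
move=> uB; apply: lime_le.
  by apply: is_cvg_nneseries => k _ _; rewrite lee_fin sqr_ge0.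
by apply: nearW => n; rewrite sumEFin lee_fin uB.
Qed.

Lemma sq_sum_ge0 u : (0 <= sq_sum u)%E.
Proof. by apply: nneseries_ge0 => k _ _; rewrite lee_fin sqr_ge0. Qed.

Lemma sq_summableP u : sq_summable u <-> exists B, forall n, psum u n <= B.
Proof.
split=> [us|[B uB]]; last by apply: le_lt_trans (sq_sum_le uB) (ltry _).
exists (fine (sq_sum u)) => n; rewrite -lee_fin fineK ?psum_sq_sum//.
by rewrite ge0_fin_numE ?sq_sum_ge0.
Qed.

Lemma l2_mem u : sq_summable u -> u \in @sq_summable_pred R.
Proof. by move=> us; rewrite unfold_in; apply/asboolP. Qed.

Lemma l2_summable x : sq_summable x.
Proof. by case: x => u /=; rewrite unfold_in => /asboolP. Qed.

Lemma l2_eq x y : (forall k, x k = y k) -> x = y.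
Proof. by move=> xy; apply: val_inj; apply/funext. Qed.

Definition nrm2 x : R := fine (sq_sum x).

Lemma nrm2E x : (nrm2 x)%:E = sq_sum x.
Proof. by rewrite fineK// ge0_fin_numE ?sq_sum_ge0//; exact: l2_summable. Qed.

Lemma psum_nrm2 x n : psum x n <= nrm2 x.
Proof. by rewrite -lee_fin nrm2E psum_sq_sum. Qed.

Lemma nrm2_le x B : (forall n, psum x n <= B) -> nrm2 x <= B.
Proof. by move=> xB; rewrite -lee_fin nrm2E sq_sum_le. Qed.

Lemma nrm2_ge0 x : 0 <= nrm2 x.
Proof. by rewrite fine_ge0// sq_sum_ge0. Qed.

Lemma cvg_psum x : psum x n @[n --> \oo] --> nrm2 x.
Proof.
have : (fun n => (psum x n)%:E) @ \oo --> (nrm2 x)%:E.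
  rewrite nrm2E.
  have -> : (fun n => (psum x n)%:E) = fun n => (\sum_(0 <= k < n) (cabs (x k) ^+ 2)%:E)%E.
    by apply/funext => n; rewrite sumEFin.
  by apply: is_cvg_nneseries => k _ _; rewrite lee_fin sqr_ge0.
by move/fine_cvgP => [_].
Qed.

Lemma cabs_nrm2 x k : cabs (x k) ^+ 2 <= nrm2 x.
Proof.
by rewrite (le_trans _ (psum_nrm2 x k.+1))// psumS lerDr psum_ge0.
Qed.

Lemma l2norm_sqr x : l2norm x ^+ 2 = nrm2 x.
Proof. by rewrite /l2norm sqr_sqrtr// nrm2_ge0. Qed.

Lemma l2norm_ge0 x : 0 <= l2norm x.
Proof. exact: sqrtr_ge0. Qed.

Lemma nrm2_eq0 x : nrm2 x = 0 -> x = 0.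
Proof.
move=> x0; apply: l2_eq => k; apply/eqP; rewrite -cabs_eq0 -sqrf_eq0.
by rewrite eq_le sqr_ge0 andbT -x0 cabs_nrm2.
Qed.

Lemma nrm2_gt0 x : x != 0 -> 0 < nrm2 x.
Proof.
move=> x0; rewrite lt_neqAle nrm2_ge0 andbT eq_sym.
by apply: contraNN x0 => /eqP/nrm2_eq0 ->.
Qed.

Lemma nrm2Z c x : nrm2 (c *: x) = cabs c ^+ 2 * nrm2 x.
Proof.
have h : (fun n => psum (c *: x : l2) n) @ \oo --> cabs c ^+ 2 * nrm2 x.
  have -> : (fun n => psum (c *: x : l2) n) = (fun n => cabs c ^+ 2 * psum x n).
    apply/funext => n; rewrite /psum mulr_sumr; apply: eq_bigr => i _.
    by rewrite -exprMn -cabsM.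
  by apply: cvgM; [exact: cvg_cst|exact: cvg_psum].
exact: (real_cvg_unique (@cvg_psum (c *: x)) h).
Qed.

Lemma nrm2_0 : nrm2 (0 : l2) = 0.
Proof. by rewrite -(scale0r (0 : l2)) nrm2Z cabs0 expr0n mul0r. Qed.

Lemma nrm2N x : nrm2 (- x) = nrm2 x.
Proof. by rewrite -scaleN1r nrm2Z cabsN cabs1 expr1n mul1r. Qed.

Lemma nrm2BC x y : nrm2 (x - y) = nrm2 (y - x).
Proof. by rewrite -nrm2N opprB. Qed.

Let dotn x y n : C := \sum_(0 <= k < n) (x k)^* * y k.

Lemma cvg_dot_explicit x y : dotn x y n @[n --> \oo] -->
  (Complex ((nrm2 (x + y) - nrm2 x - nrm2 y) / 2)
    (- ((nrm2 (x + (Complex 0 1 : C) *: y) - nrm2 x - nrm2 y) / 2)) : C).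
Proof.
apply: cvg_cplx => /=.
  have -> : (fun n => complex.Re (dotn x y n)) =
      (fun n => (psum (x + y : l2) n - psum x n - psum y n) / 2).
    apply/funext => n; rewrite /dotn /psum Re_sum -!sumrB mulr_suml.
    apply: eq_bigr => i _ /=.
    by rewrite !sqr_cabs ReD ImD ReM Re_conj Im_conj; field.
  apply: cvgM; last exact: cvg_cst.
  by apply: cvgB; [apply: cvgB|]; exact: cvg_psum.
have -> : (fun n => complex.Im (dotn x y n)) =
    (fun n => - ((psum (x + (Complex 0 1 : C) *: y : l2) n - psum x n - psum y n) / 2)).
  apply/funext => n; rewrite /dotn /psum Im_sum -!sumrB mulr_suml -sumrN.
  apply: eq_bigr => i _.
  rewrite [(x + _ : l2) i](_ : _ = x i + (Complex 0 1 : C) * y i)//.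
  by rewrite !sqr_cabs ReD ImD !ImM ReM Re_conj Im_conj /=; field.
apply: cvgN; apply: cvgM; last exact: cvg_cst.
by apply: cvgB; [apply: cvgB|]; exact: cvg_psum.
Qed.

Lemma cplx_cvg_unique u (l l' : C) : u @ \oo --> l -> u @ \oo --> l' -> l = l'.
Proof.
move=> h h'; apply: cplx_eq.
  exact: (real_cvg_unique (cvg_Re h) (cvg_Re h')).
exact: (real_cvg_unique (cvg_Im h) (cvg_Im h')).
Qed.

Lemma cplx_lim u (l : C) : u @ \oo --> l -> limn u = l.
Proof. by move=> h; apply: (cplx_cvg_unique _ h); apply: cvgP h. Qed.

Lemma cvg_dot x y : dotn x y n @[n --> \oo] --> l2dot x y.
Proof.
have h := @cvg_dot_explicit x y.
by rewrite /l2dot (cplx_lim h).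
Qed.

Lemma dot_explicit x y : l2dot x y =
  (Complex ((nrm2 (x + y) - nrm2 x - nrm2 y) / 2)
    (- ((nrm2 (x + (Complex 0 1 : C) *: y) - nrm2 x - nrm2 y) / 2)) : C).
Proof. exact: cplx_lim (@cvg_dot_explicit x y). Qed.

Lemma dotDr x y z : l2dot x (y + z) = l2dot x y + l2dot x z.
Proof.
apply: (cplx_cvg_unique (@cvg_dot x (y + z))).
have -> : (fun n => dotn x (y + z : l2) n) = (fun n => dotn x y n + dotn x z n).
  apply/funext => n; rewrite /dotn -big_split; apply: eq_bigr => i _.
  by rewrite [(y + z : l2) i](_ : _ = y i + z i)// mulrDr.
exact: (cvgD (@cvg_dot x y) (@cvg_dot x z)).
Qed.

Lemma dotZr c x y : l2dot x (c *: y) = c * l2dot x y.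
Proof.
apply: (cplx_cvg_unique (@cvg_dot x (c *: y))).
have -> : (fun n => dotn x (c *: y : l2) n) = (fun n => c * dotn x y n).
  apply/funext => n; rewrite /dotn mulr_sumr; apply: eq_bigr => i _.
  by rewrite [(c *: y : l2) i](_ : _ = c * y i)// mulrCA.
exact: (cvgM (@cvg_cst _ _ _ _ _) (@cvg_dot x y)).
Qed.

Lemma dot_conj x y : (l2dot x y)^* = l2dot y x.
Proof.
apply: (cplx_cvg_unique (u := fun n => (dotn x y n)^*)).
  apply: cvg_cplx.
    under eq_fun do rewrite Re_conj.
    by rewrite Re_conj; exact: cvg_Re (@cvg_dot x y).
  under eq_fun do rewrite Im_conj.
  by rewrite Im_conj; apply: cvgN; exact: cvg_Im (@cvg_dot x y).
have -> : (fun n => (dotn x y n)^*) = (fun n => dotn y x n).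
  apply/funext => n; rewrite /dotn conj_sum; apply: eq_bigr => i _.
  by rewrite conjM conjCK mulrC.
exact: cvg_dot.
Qed.

Lemma dotNr x y : l2dot x (- y) = - l2dot x y.
Proof. by rewrite -scaleN1r dotZr mulN1r. Qed.

Lemma dotBr x y z : l2dot x (y - z) = l2dot x y - l2dot x z.
Proof. by rewrite dotDr dotNr. Qed.

Lemma dot0r x : l2dot x 0 = 0.
Proof. by rewrite -(scale0r (0 : l2)) dotZr mul0r. Qed.

Lemma dotDl x y z : l2dot (x + y) z = l2dot x z + l2dot y z.
Proof. by rewrite -dot_conj dotDr conjD !dot_conj. Qed.

Lemma dotZl c x y : l2dot (c *: x) y = c^* * l2dot x y.
Proof. by rewrite -dot_conj dotZr conjM dot_conj. Qed.

Lemma dotNl x y : l2dot (- x) y = - l2dot x y.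
Proof. by rewrite -dot_conj dotNr conjN dot_conj. Qed.

Lemma dotBl x y z : l2dot (x - y) z = l2dot x z - l2dot y z.
Proof. by rewrite dotDl dotNl. Qed.

Lemma dot_self x : l2dot x x = real_complex R (nrm2 x).
Proof.
apply: (cplx_cvg_unique (@cvg_dot x x)); apply: cvg_cplx => /=.
  have -> : (fun n => complex.Re (dotn x x n)) = psum x.
    by apply/funext => n; rewrite Re_sum; apply: eq_bigr => i _; rewrite conjM_cabs.
  exact: cvg_psum.
have -> : (fun n => complex.Im (dotn x x n)) = (fun=> 0).
  by apply/funext => n; rewrite Im_sum big1// => i _; rewrite conjM_cabs.
exact: cvg_cst.
Qed.

Lemma nrm2D x y : nrm2 (x + y) = nrm2 x + nrm2 y + 2 * complex.Re (l2dot x y).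
Proof. by rewrite dot_explicit /=; field. Qed.

Lemma nrm2D_le x y : nrm2 (x + y) <= 2 * nrm2 x + 2 * nrm2 y.
Proof.
have := nrm2_ge0 (x - y); rewrite !nrm2D nrm2N dotNr ReN; lra.
Qed.

Lemma cauchy_schwarz x y : cabs (l2dot x y) ^+ 2 <= nrm2 x * nrm2 y.
Proof.
have [->|x0] := eqVneq x 0.
  by rewrite -(scale0r (0 : l2)) dotZl conjC0 mul0r cabs0 expr0n mulr_ge0// nrm2_ge0.
have n0 := nrm2_gt0 x0.
(* Up to the factor ||x||^2, this vector is the component of y orthogonal to x. *)
have := nrm2_ge0 (real_complex R (nrm2 x) *: y - l2dot x y *: x).
rewrite nrm2D nrm2N !nrm2Z cabs_toC ger0_norm ?nrm2_ge0//  dotNr dotZr dotZl conj_toC.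
rewrite -[l2dot y x]dot_conj.
have -> : complex.Re (- (l2dot x y * (real_complex R (nrm2 x) * (l2dot x y)^*))) =
    - (nrm2 x * cabs (l2dot x y) ^+ 2).
  rewrite sqr_cabs ReN !ReM ImM Re_conj Im_conj ReC ImC; ring.
move: (cabs _ ^+ 2) => d h.
have {}h : 0 <= nrm2 x * (nrm2 x * nrm2 y - d) by nra.
by rewrite -subr_ge0; rewrite pmulr_rge0 in h.
Qed.

Lemma unit_vectorE n k : unit_vector n k = (k == n)%:R :> C.
Proof. by []. Qed.

Lemma dot_unit n x : l2dot (unit_vector n) x = x n.
Proof.
apply: (cplx_cvg_unique (@cvg_dot _ x)); apply: cvg_near_cst.
exists n.+1 => // m /= nm; rewrite /dotn (bigD1_seq n)/= ?mem_index_iota ?iota_uniq//.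
rewrite eqxx conjC1 mul1r big1 ?addr0// => i /negbTE ->.
by rewrite conjC0 mul0r.
Qed.

Lemma nrm2_unit n : nrm2 (unit_vector n) = 1.
Proof.
by have := dot_unit n (unit_vector n); rewrite dot_self unit_vectorE eqxx => -[].
Qed.

Lemma dot_eq0 x : (forall y, l2dot y x = 0) -> x = 0.
Proof. by move=> h; apply: nrm2_eq0; have := h x; rewrite dot_self => -[]. Qed.

Definition fvec (u : nat -> C) n : l2 := \sum_(0 <= k < n) u k *: unit_vector k.

Lemma l2_sumE (I : Type) (s : seq I) (F : I -> l2) k :
  (\sum_(i <- s) F i) k = \sum_(i <- s) F i k.
Proof. by elim: s => [|i s IH]; rewrite ?big_nil// !big_cons -IH. Qed.

Lemma fvecE u n k : fvec u n k = if (k < n)%N then u k else 0.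
Proof.
rewrite /fvec l2_sumE; case: ifPn => kn.
  rewrite (bigD1_seq k)/= ?mem_index_iota ?iota_uniq//.
  rewrite [X in X + _](_ : _ = u k * (k == k)%:R)// eqxx mulr1 big1 ?addr0// => i ik.
  by rewrite [LHS](_ : _ = u i * (k == i)%:R)// eq_sym (negbTE ik) mulr0.
apply: big1_seq => i /andP[_]; rewrite mem_index_iota => /andP[_ ii].
rewrite [LHS](_ : _ = u i * (k == i)%:R)//; case: eqP => [ki|]; last by rewrite mulr0.
by move: kn; rewrite ki ii.
Qed.

Lemma psum_fvec u n k : psum (fvec u n) k = psum u (minn n k).
Proof.
elim: k => [|k IH]; first by rewrite minn0 /psum !big_geq.
rewrite psumS IH fvecE; have [kn|] := boolP (k < n)%N; last rewrite -leqNgt => kn.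
 
  have -> : minn n k.+1 = k.+1 by apply/minn_idPr.
  by have -> : minn n k = k; [exact/minn_idPr/ltnW|rewrite psumS].
have -> : minn n k.+1 = n by apply/minn_idPl/leqW.
by have -> : minn n k = n; [exact/minn_idPl|rewrite cabs0 expr0n addr0].
Qed.

Lemma nrm2_fvecB x n : nrm2 (x - fvec x n) <= nrm2 x - psum x n.
Proof.
apply: nrm2_le => k.
have H m : psum (x - fvec x n : l2) m + psum x (minn n m) = psum x m.
  elim: m => [|m IH]; first by rewrite minn0 /psum !big_geq// addr0.
  rewrite !psumS [(x - fvec x n : l2) m](_ : _ = x m - fvec x n m)// fvecE.
  have [mn|] := boolP (m < n)%N; last rewrite -leqNgt => mn.
      have -> : minn n m.+1 = m.+1 by apply/minn_idPr.
    have E : minn n m = m by exact/minn_idPr/ltnW.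
    by rewrite E in IH; rewrite psumS subrr cabs0 expr0n addr0 addrA IH.
  have -> : minn n m.+1 = n by apply/minn_idPl/leqW.
  have E : minn n m = n by exact/minn_idPl.
  by rewrite E in IH; rewrite subr0 addrAC IH.
have [kn|] := boolP (k <= n)%N; last rewrite -ltnNge => nk.
  by have := H k; rewrite (minn_idPr kn); have := @psum_nrm2 x n; lra.
by have := H k; rewrite (minn_idPl (ltnW nk)); have := @psum_nrm2 x k; lra.
Qed.

Lemma cvg_fvec x : nrm2 (x - fvec x n) @[n --> \oo] --> 0.
Proof.
have h : (fun n => nrm2 x - psum x n) @ \oo --> (0 : R).
  rewrite -(subrr (nrm2 x)); apply: cvgB; [exact: cvg_cst|exact: cvg_psum].
apply: (squeeze_cvgr _ (@cvg_cst _ _ _ _ _) h).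
by apply: nearW => n; rewrite nrm2_ge0 nrm2_fvecB.
Qed.

(** The truncations [fvec x n] converge to x in norm. This is the tool that extends every identity
    from unit vectors to [l2]. *)
Lemma functional_eq0 (L : l2 -> C) (B : R) :
  (forall c x y, L (c *: x + y) = c * L x + L y) ->
  (forall x, cabs (L x) ^+ 2 <= B * nrm2 x) ->
  (forall n, L (unit_vector n) = 0) -> forall x, L x = 0.
Proof.
move=> Llin LB Le x.
have L0 : L 0 = 0 by have := Llin (-1) 0 0; rewrite scaler0 addr0 mulN1r addNr.
have Lf n : L (fvec x n) = 0.
  rewrite /fvec; elim: n => [|n IH]; first by rewrite big_geq.
  by rewrite big_nat_recr//= addrC Llin IH Le mulr0 addr0.
apply/eqP; rewrite -cabs_eq0 -sqrf_eq0 eq_le sqr_ge0 andbT.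
have h : (fun n => B * nrm2 (x - fvec x n)) @ \oo --> B * 0.
  by apply: cvgM; [exact: cvg_cst|exact: cvg_fvec].
rewrite mulr0 in h; apply: (cvgr_to_ge h); apply: nearW => n.
apply: le_trans (LB _); rewrite addrC -scaleN1r Llin Lf mulr0 add0r.
exact: lexx.
Qed.

End l2_space.

(** * Bounded operators: matrices, adjoints, inverses, square roots *)

Section operator_theory.
Context {R : realType}.
Local Notation C := (cplx R).
Local Notation l2 := (l2 R).
Implicit Types (x y : l2) (u : nat -> C) (c : C) (S T : l2 -> l2).

Lemma l2norm_le x (B : R) : 0 <= B -> (l2norm x <= B) = (nrm2 x <= B ^+ 2).
Proof.
by move=> B0; rewrite -l2norm_sqr ler_pXn2r// nnegrE// l2norm_ge0.
Qed.

Lemma l2normD x y : l2norm (x + y) <= l2norm x + l2norm y.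
Proof.
rewrite l2norm_le ?addr_ge0 ?l2norm_ge0// nrm2D sqrrD !l2norm_sqr.
have h : complex.Re (l2dot x y) <= l2norm x * l2norm y.
  rewrite (le_trans (ler_norm _))// (le_trans (Re_le_cabs _))//.
  rewrite -(@ler_pXn2r _ 2) ?nnegrE ?cabs_ge0 ?mulr_ge0 ?l2norm_ge0//.
  by rewrite exprMn !l2norm_sqr; exact: cauchy_schwarz.
rewrite mulr2n; lra.
Qed.

Lemma cvg_psum_coord (v : nat -> nat -> C) u K :
  (forall k, v n k @[n --> \oo] --> u k) -> psum (v n) K @[n --> \oo] --> psum u K.
Proof.
move=> vu; elim: K => [|K IH].
  have E w : psum w 0 = 0 by rewrite /psum big_geq.
  by rewrite E; under eq_fun do rewrite E; exact: cvg_cst.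
rewrite psumS; under eq_fun do rewrite psumS.
by apply: cvgD IH _; under eq_fun do rewrite expr2; apply: cvgM; apply: cvg_cabs.
Qed.

(** For fixed [K] only finitely many coordinates occur; bounds uniform in [K] then transfer from
    approximations to coordinatewise limits. *)
Lemma fatou_psum (v : nat -> nat -> C) u (B : R) K :
  (forall k, v n k @[n --> \oo] --> u k) ->
  (\forall n \near \oo, psum (v n) K <= B) -> psum u K <= B.
Proof. by move=> vu vB; apply: (cvgr_to_le (@cvg_psum_coord v u K vu)). Qed.

Lemma geometric_cvg (u : nat -> R) (q B : R) : 0 <= q < 1 ->
  (forall n, `|u n.+1 - u n| <= B * q ^+ n) -> exists l : R, u @ \oo --> l.
Proof.
move=> /andP[q0 q1] uB.
have uE n : u n = u 0%N + series (fun j => u j.+1 - u j) n.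
  elim: n => [|n IH]; first by rewrite /series /= big_geq// addr0.
  rewrite {1}(_ : u n.+1 = u n + (u n.+1 - u n)); last by rewrite addrC subrK.
  by rewrite {1}IH -addrA /series /= big_nat_recr.
have cs : cvgn (series (fun j => u j.+1 - u j)).
  apply: normed_cvg; apply: (@series_le_cvg _ _ (geometric B q)) => [n|n|n|].
  - exact: normr_ge0.
  - by rewrite /geometric /= (le_trans _ (uB n)).
  - exact: uB.
  - by apply: is_cvg_geometric_series; rewrite ger0_norm.
exists (u 0%N + limn (series (fun j => u j.+1 - u j))).
have h : (fun n => u 0%N + series (fun j => u j.+1 - u j) n) @ \oo -->
    u 0%N + limn (series (fun j => u j.+1 - u j)).
  by apply: cvgD; [exact: cvg_cst|].
have uE' : (fun n => u 0%N + series (fun j => u j.+1 - u j) n) = u.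
  by apply/funext => n; rewrite -uE.
by move: h; rewrite uE'.
Qed.

(** Completeness in the only form required, for geometrically decreasing increments: the limit is
    built coordinate by coordinate and its norm bounded by [fatou_psum]. It lies in [l2] because its
    difference with [x 0] does. *)
Lemma l2_complete (x : nat -> l2) (q B : R) : 0 <= q < 1 -> 0 <= B ->
  (forall n, l2norm (x n.+1 - x n) <= B * q ^+ n) ->
  exists y, forall n, l2norm (y - x n) <= B * q ^+ n / (1 - q).
Proof.
move=> q01 B0 xB; have /andP[q0 q1] := q01.
have q1' : 0 < 1 - q by rewrite subr_gt0.
have xnm n i : l2norm (x (i + n)%N - x n) <= B * q ^+ n / (1 - q) * (1 - q ^+ i).
  elim: i => [|i IH].
    rewrite add0n subrr expr0 subrr mulr0 l2norm_le// nrm2_0 expr0n; exact: lexx.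
  rewrite -[x (i.+1 + n)%N](subrK (x (i + n)%N)) -addrA.
  apply: (le_trans (l2normD _ _)); apply: (le_trans (lerD (xB (i + n)%N) IH)).
  rewrite exprD exprS le_eqVlt; apply/orP; left; apply/eqP; field.
  by rewrite gt_eqF.
have xnm' n m : (n <= m)%N -> l2norm (x m - x n) <= B * q ^+ n / (1 - q).
  move=> nm; rewrite -(subnK nm); apply: (le_trans (xnm _ _)).
  rewrite ler_piMr//; first by rewrite divr_ge0 ?mulr_ge0 ?exprn_ge0// ltW.
  by rewrite lerBlDr lerDl exprn_ge0.
have cx n k : cabs ((x n.+1) k - (x n) k) <= B * q ^+ n.
  rewrite -(@ler_pXn2r _ 2) ?nnegrE ?cabs_ge0 ?mulr_ge0 ?exprn_ge0//.
  apply: (le_trans (cabs_nrm2 (x n.+1 - x n) k)).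
  by rewrite -l2norm_le ?mulr_ge0 ?exprn_ge0.
have cu k : exists l : C, (x n) k @[n --> \oo] --> l.
  have [||r hr] := @geometric_cvg (fun n => complex.Re ((x n) k)) q B.
  - exact: q01.
  - by move=> n; rewrite -ReB; apply: le_trans (Re_le_cabs _) (cx n k).
  have [||i hi] := @geometric_cvg (fun n => complex.Im ((x n) k)) q B.
  - exact: q01.
  - by move=> n; rewrite -ImB; apply: le_trans (Im_le_cabs _) (cx n k).
  by exists (Complex r i); apply: cvg_cplx.
pose u k : C := sval (cid (cu k)).
have uE k : (x n) k @[n --> \oo] --> u k by exact: (svalP (cid (cu k))).
have Hn n K : psum (fun k => u k - (x n) k) K <= (B * q ^+ n / (1 - q)) ^+ 2.
  apply: (@fatou_psum (fun m k => (x m) k - (x n) k)).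
    by move=> k /=; exact: (cvgB (uE k) (@cvg_cst _ _ _ _ _)).
  exists n => // m /= nm; apply: (le_trans (psum_nrm2 (x m - x n) K)).
  by rewrite -l2norm_le ?xnm'// divr_ge0 ?mulr_ge0 ?exprn_ge0// ltW.
have z0 : (fun k => u k - (x 0%N) k) \in @sq_summable_pred R.
  by apply: l2_mem; apply/sq_summableP; eexists; exact: (Hn 0%N).
exists (L2 z0 + x 0%N) => n.
rewrite l2norm_le; last by rewrite divr_ge0 ?mulr_ge0 ?exprn_ge0// ltW.
apply: nrm2_le => K; apply: le_trans (Hn n K).
rewrite /psum; apply: ler_sum => k _.
rewrite [(L2 z0 + x 0%N - x n : l2) k](_ : _ = (u k - (x 0%N) k + (x 0%N) k) - (x n) k)//.
by rewrite subrK.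
Qed.

Definition opb (B : R) T := [/\ 0 <= B, linear T & forall x, nrm2 (T x) <= B ^+ 2 * nrm2 x].

Lemma bounded_opP T : bounded_op T <-> exists B, opb B T.
Proof.
split=> [[Tlin [M TM]]|[B [B0 Tlin TB]]].
  exists `|M|; split=> // x.
  have := TM x; move/(le_trans)/(_ (ler_wpM2r (l2norm_ge0 x) (ler_norm M))) => h.
  by rewrite -l2norm_sqr -[nrm2 x]l2norm_sqr -exprMn lerXn2r ?nnegrE ?l2norm_ge0 ?mulr_ge0 ?l2norm_ge0.
split=> //; exists B => x.
by rewrite l2norm_le ?mulr_ge0 ?l2norm_ge0// exprMn l2norm_sqr.
Qed.

Section opb_lemmas.
Context (B : R) T (hT : opb B T).

Lemma opb_lin c x y : T (c *: x + y) = c *: T x + T y.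
Proof. by case: hT => _ + _; apply. Qed.
Lemma opbD x y : T (x + y) = T x + T y.
Proof. by have := opb_lin 1 x y; rewrite !scale1r. Qed.
Lemma opb0 : T 0 = 0.
Proof.
have := opb_lin (-1) 0 0; rewrite scaler0 addr0 => ->.
by rewrite scaleN1r addNr.
Qed.
Lemma opbZ c x : T (c *: x) = c *: T x.
Proof. by have := opb_lin c x 0; rewrite opb0 !addr0. Qed.
Lemma opbN x : T (- x) = - T x.
Proof. by rewrite -scaleN1r opbZ scaleN1r. Qed.
Lemma opbB x y : T (x - y) = T x - T y.
Proof. by rewrite opbD opbN. Qed.
Lemma opb_sum (I : Type) (s : seq I) (F : I -> l2) :
  T (\sum_(i <- s) F i) = \sum_(i <- s) T (F i).
Proof. by elim: s => [|i s IH]; rewrite ?big_nil ?opb0// !big_cons opbD IH. Qed.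
End opb_lemmas.

Lemma opb_id : opb 1 idfun.
Proof. by split=> // x; rewrite expr1n mul1r. Qed.

Lemma opb_comp A B S T : opb A S -> opb B T -> opb (A * B) (S \o T).
Proof.
move=> hS hT; have [A0 _ SA] := hS; have [B0 _ TB] := hT; split.
- exact: mulr_ge0.
- by move=> c x y /=; rewrite (opb_lin hT) (opb_lin hS).
- move=> x /=; apply: (le_trans (SA _)).
  have -> : (A * B) ^+ 2 * nrm2 x = A ^+ 2 * (B ^+ 2 * nrm2 x) by rewrite exprMn mulrA.
  by apply: ler_wpM2l; [exact: sqr_ge0|exact: TB].
Qed.

Lemma opb_add A B S T : opb A S -> opb B T -> opb (A + B) (S + T).
Proof.
move=> hS hT; have [A0 _ SA] := hS; have [B0 _ TB] := hT; split.
- exact: addr_ge0.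
- move=> c x y; rewrite [LHS](_ : _ = S (c *: x + y) + T (c *: x + y))//.
  rewrite [RHS](_ : _ = c *: (S x + T x) + (S y + T y))//.
  by rewrite (opb_lin hT) (opb_lin hS) scalerDr addrACA.
- move=> x; rewrite [(S + T) x](_ : _ = S x + T x)//.
  rewrite -l2norm_sqr -[nrm2 x]l2norm_sqr -exprMn.
  rewrite lerXn2r ?nnegrE ?l2norm_ge0 ?mulr_ge0 ?addr_ge0 ?l2norm_ge0//.
  rewrite (le_trans (l2normD _ _))// mulrDl lerD//.
    by rewrite l2norm_le ?mulr_ge0 ?l2norm_ge0// exprMn l2norm_sqr.
  by rewrite l2norm_le ?mulr_ge0 ?l2norm_ge0// exprMn l2norm_sqr.
Qed.

Lemma opb_scale c B T : opb B T -> opb (cabs c * B) (fun x => c *: T x).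
Proof.
move=> hT; have [B0 _ TB] := hT; split.
- by rewrite mulr_ge0 ?cabs_ge0.
- by move=> d x y; rewrite (opb_lin hT) scalerDr !scalerA mulrC.
- move=> x; rewrite nrm2Z.
  have -> : (cabs c * B) ^+ 2 * nrm2 x = cabs c ^+ 2 * (B ^+ 2 * nrm2 x) by rewrite exprMn mulrA.
  by apply: ler_wpM2l; [exact: sqr_ge0|exact: TB].
Qed.

Lemma opb_ext A B S T : opb A S -> opb B T ->
  (forall n, S (unit_vector n) = T (unit_vector n)) -> S = T.
Proof.
move=> hS hT ST; have [A0 _ SA] := hS; have [B0 _ TB] := hT.
apply/funext => x; apply: l2_eq => k; apply/eqP; rewrite -subr_eq0; apply/eqP.
apply: (@functional_eq0 _ (fun x => (S x) k - (T x) k) (2 * A ^+ 2 + 2 * B ^+ 2)).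
- move=> c y z; rewrite (opb_lin hS) (opb_lin hT).
  rewrite [(c *: S y + S z : l2) k](_ : _ = c * (S y) k + (S z) k)//.
  rewrite [(c *: T y + T z : l2) k](_ : _ = c * (T y) k + (T z) k)//; ring.
- move=> y; apply: (le_trans (cabs_nrm2 (S y - T y) k)).
  apply: (le_trans (nrm2D_le _ _)); rewrite nrm2N.
  have := SA y; have := TB y; nra.
- by move=> n; rewrite ST subrr.
Qed.

Section contraction_matrix.
Context (M : nat -> nat -> C) (B : R) (B0 : 0 <= B)
  (hM : forall u N K,
    psum (fun k => \sum_(0 <= n < N) M k n * u n) K <= B ^+ 2 * psum u N).

(** Tested on the conjugate of row k, truncated at N with squared norm s, the bound [hM] gives s^2
    <= B^2 s. So the rows lie in [l2], and the series defining [matrix_op] converge as inner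
    products. *)
Let row_psum k N : psum (fun n => (M k n)^*) N <= B ^+ 2.
Proof.
set s := psum _ N; have s0 : 0 <= s by exact: psum_ge0.
have : s ^+ 2 <= B ^+ 2 * s.
  apply: le_trans (hM (fun n => (M k n)^*) N k.+1); rewrite psumS.
  rewrite ler_wpDl ?psum_ge0//.
  have -> : \sum_(0 <= n < N) M k n * (M k n)^* = real_complex R s.
    by rewrite toC_sum; apply: eq_bigr => i _; rewrite cabs_conj -conjM_cabs mulrC.
  by rewrite cabs_toC ger0_norm.
have := sqr_ge0 B; nra.
Qed.

Let row_mem k : (fun n => (M k n)^*) \in @sq_summable_pred R.
Proof. by apply: l2_mem; apply/sq_summableP; exists (B ^+ 2); exact: row_psum. Qed.

Let row k : l2 := L2 (row_mem k).

Let row_cvg x k : \sum_(0 <= n < N) M k n * x n @[N --> \oo] --> l2dot (row k) x.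
Proof.
have := @cvg_dot _ (row k) x.
by under eq_fun do under eq_bigr do rewrite /= conjCK.
Qed.

Let im_psum x K : psum (fun k => l2dot (row k) x) K <= B ^+ 2 * nrm2 x.
Proof.
apply: (@fatou_psum (fun N k => \sum_(0 <= n < N) M k n * x n)).
  by move=> k; exact: row_cvg.
apply: nearW => N; apply: (le_trans (hM _ _ _)).
by rewrite ler_wpM2l ?sqr_ge0// psum_nrm2.
Qed.

Let matrix_opE' x k : matrix_op M x k = l2dot (row k) x.
Proof.
have hx : (fun k => limn (series (fun n => M k n * x n))) = (fun k => l2dot (row k) x).
  by apply/funext => j; apply: cplx_lim; exact: row_cvg.
rewrite /matrix_op hx val_insubd ifT//.
by apply: l2_mem; apply/sq_summableP; exists (B ^+ 2 * nrm2 x); exact: im_psum.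
Qed.

Lemma matrix_op_cvg x k :
  \sum_(0 <= n < N) M k n * x n @[N --> \oo] --> matrix_op M x k.
Proof. by rewrite matrix_opE'; exact: row_cvg. Qed.

Lemma matrix_op_opb : opb B (matrix_op M).
Proof.
split=> //.
  move=> c x y; apply: l2_eq => k.
  rewrite [(c *: matrix_op M x + matrix_op M y : l2) k](_ : _ =
    c * matrix_op M x k + matrix_op M y k)//.
  by rewrite !matrix_opE' dotDr dotZr.
move=> x; apply: nrm2_le => K.
by rewrite (_ : psum _ K = psum (fun k => l2dot (row k) x) K) ?im_psum//;
  apply: eq_bigr => k _; rewrite matrix_opE'.
Qed.

Lemma matrix_op_unit n k : matrix_op M (unit_vector n) k = M k n.
Proof.
rewrite matrix_opE' -dot_conj dot_unit /=.
by rewrite conjCK.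
Qed.

End contraction_matrix.

Lemma diag_bound (d : nat -> C) (B : R) : (forall n, cabs (d n) <= B) ->
  forall u N K, psum (fun k => \sum_(0 <= n < N) diag_matrix d k n * u n) K <=
    B ^+ 2 * psum u N.
Proof.
move=> dB u N K; have B0 : 0 <= B by rewrite (le_trans (cabs_ge0 (d 0%N))).
pose v k := if (k < N)%N then d k * u k else 0.
have -> : psum (fun k => \sum_(0 <= n < N) diag_matrix d k n * u n) K = psum v K.
  apply: eq_bigr => k _; congr (cabs _ ^+ 2); rewrite /v.
  case: ifPn => kN.
    rewrite (bigD1_seq k)/= ?mem_index_iota ?iota_uniq// /diag_matrix eqxx.
    by rewrite big1 ?addr0// => i; rewrite eq_sym => /negbTE ->; rewrite mul0r.
  apply: big1_seq => i /andP[_]; rewrite mem_index_iota => /andP[_ iN].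
  rewrite /diag_matrix; case: eqP => [ki|_]; last by rewrite mul0r.
  by move: kN; rewrite ki iN.
have vv k : cabs (v k) ^+ 2 <= B ^+ 2 * cabs (if (k < N)%N then u k else 0) ^+ 2.
  rewrite /v; case: ifP => _; last by rewrite cabs0 expr0n mulr0.
  by rewrite cabsM exprMn ler_wpM2r ?sqr_ge0// lerXn2r ?nnegrE ?cabs_ge0.
have -> : psum u N = psum (fvec u N) (maxn N K).
  by rewrite psum_fvec; have /minn_idPl -> := leq_maxl N K.
apply: (le_trans (psum_le v (leq_maxr N K))); rewrite /psum mulr_sumr.
by apply: ler_sum => k _; rewrite fvecE; exact: vv.
Qed.

Lemma diag_opb (d : nat -> C) (B : R) : (forall n, cabs (d n) <= B) ->
  opb B (matrix_op (diag_matrix d)).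
Proof.
move=> dB; apply: matrix_op_opb (diag_bound dB).
by rewrite (le_trans (cabs_ge0 (d 0%N))).
Qed.

Lemma diag_opE (d : nat -> C) (B : R) : (forall n, cabs (d n) <= B) ->
  forall x k, matrix_op (diag_matrix d) x k = d k * x k.
Proof.
move=> dB x k; have B0 : 0 <= B by rewrite (le_trans (cabs_ge0 (d 0%N))).
apply: (cplx_cvg_unique (@matrix_op_cvg _ _ (diag_bound dB) x k)).
apply: cvg_near_cst; exists k.+1 => // N /= kN.
rewrite (bigD1_seq k)/= ?mem_index_iota ?iota_uniq// /diag_matrix eqxx.
by rewrite big1 ?addr0// => i; rewrite eq_sym => /negbTE ->; rewrite mul0r.
Qed.

Lemma adjointE T S : is_adjoint T S -> adjoint T = S.
Proof.
move=> TS; rewrite /adjoint; case: xgetP => [S' _ TS'|/(_ S)]; last by [].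
apply/funext => y; apply/eqP; rewrite -subr_eq0; apply/eqP; apply: dot_eq0 => x.
by rewrite dotBr -TS -TS' subrr.
Qed.

(** [functional_eq0] is applied twice, first in the right argument against a unit vector, then in
    the left one. *)
Lemma is_adjoint_ext A B T S : opb A T -> opb B S ->
  (forall m n, l2dot (T (unit_vector m)) (unit_vector n) =
     l2dot (unit_vector m) (S (unit_vector n))) ->
  is_adjoint T S.
Proof.
move=> hA hB units; have [_ _ nA] := hA; have [_ _ nB] := hB.
move=> x y; apply/eqP; rewrite -subr_eq0; apply/eqP.
pose L1 m y := l2dot (T (unit_vector m)) y - l2dot (unit_vector m) (S y).
have sq2 (u v : C) : cabs (u - v) ^+ 2 <= 2 * cabs u ^+ 2 + 2 * cabs v ^+ 2.
  by have := cabs_sqD_le (-1) v u; rewrite mulN1r addrC cabsN cabs1 expr1n; lra.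
have L1_0 m z : L1 m z = 0.
  apply: (@functional_eq0 _ (L1 m) (2 * nrm2 (T (unit_vector m)) + 2 * B ^+ 2)).
  - by move=> c u v; rewrite /L1 (opb_lin hB) !dotDr !dotZr;
    move: (l2dot _ u) (l2dot _ v) (l2dot _ (S u)) (l2dot _ (S v)) => p q r s; ring.
  - move=> u; apply: (le_trans (sq2 _ _)).
    have h1 := cauchy_schwarz (T (unit_vector m)) u.
    have h2 := cauchy_schwarz (unit_vector m) (S u).
    rewrite nrm2_unit mul1r in h2; have h3 := nB u.
    have -> : (2 * nrm2 (T (unit_vector m)) + 2 * B ^+ 2) * nrm2 u =
      2 * (nrm2 (T (unit_vector m)) * nrm2 u) + 2 * (B ^+ 2 * nrm2 u) by ring.
    lra.
  - by move=> n; rewrite /L1 units subrr.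
(* The inner product is conjugate linear on the left; conjugating makes the functional linear. *)
pose L2 x := (l2dot (T x) y - l2dot x (S y))^*.
suff : L2 x = 0 by move=> /eqP; rewrite /L2 conjC_eq0 => /eqP.
have cabs_c := @cabs_conj R.
apply: (@functional_eq0 _ L2 (2 * (A ^+ 2 * nrm2 y) + 2 * nrm2 (S y))).
- move=> c u v; rewrite /L2 (opb_lin hA) !dotDl !dotZl.
  move: (l2dot _ y) (l2dot _ y) (l2dot u _) (l2dot v _) => p q r s.
  by rewrite !conjB !conjD !conjM !conjCK; ring.
- move=> u; rewrite /L2 cabs_c; apply: (le_trans (sq2 _ _)).
  have h1 := cauchy_schwarz (T u) y.
  have h2 := cauchy_schwarz u (S y).
  have h3 : nrm2 (T u) * nrm2 y <= A ^+ 2 * nrm2 u * nrm2 y.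
    by rewrite ler_wpM2r ?nrm2_ge0.
  have -> : (2 * (A ^+ 2 * nrm2 y) + 2 * nrm2 (S y)) * nrm2 u =
    2 * (A ^+ 2 * nrm2 u * nrm2 y) + 2 * (nrm2 u * nrm2 (S y)) by ring.
  lra.
- by move=> n; rewrite /L2 [X in X^*](L1_0 n y) conjC0.
Qed.

Lemma inverseE T S : is_inverse T S -> inverse T = S.
Proof.
move=> TS; have [_ TS1 ST1] := TS.
rewrite /inverse; case: xgetP => [S' _ [_ TS' ST']|/(_ S)]; last by [].
apply/funext => y; have /(congr1 (fun f => f y)) /= yE := TS1.
by rewrite -{1}yE; have /(congr1 (fun f => f (S y))) /= -> := ST'.
Qed.

(** Surjectivity comes from the fixed point iteration y = x - T y. The lower bound (1 - q) ||x|| <=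
    ||x + T x|| gives injectivity and the bound on the inverse. *)
Lemma neumann_inverse (T : l2 -> l2) (q : R) : 0 <= q < 1 -> opb q T ->
  exists S, is_inverse (idfun + T) S.
Proof.
move=> /andP[q0 q1] hT; have [_ _ Tq] := hT.
have q1' : 0 < 1 - q by rewrite subr_gt0.
have Tq' x : l2norm (T x) <= q * l2norm x.
  by rewrite l2norm_le ?mulr_ge0 ?l2norm_ge0// exprMn l2norm_sqr.
have lower x : (1 - q) * l2norm x <= l2norm (x + T x).
  have := l2normD (x + T x) (- T x); rewrite addrK.
  have -> : l2norm (- T x) = l2norm (T x).
    by rewrite /l2norm -!/(nrm2 _) nrm2N.
  have := Tq' x; lra.
have inj x y : x + T x = y + T y -> x = y.
  move=> xy; apply/eqP; rewrite -subr_eq0; apply/eqP; apply: nrm2_eq0.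
  have : (1 - q) * l2norm (x - y) <= 0.
    apply: (le_trans (lower _)); rewrite (opbB hT) addrACA -opprD xy subrr.
    by rewrite l2norm_le// nrm2_0 expr0n.
  rewrite pmulr_rle0// => h; rewrite -l2norm_sqr.
  by have /eqP -> : l2norm (x - y) == 0; [rewrite eq_le h l2norm_ge0|rewrite expr0n].
have surj x : exists y, y + T y = x.
  (* Partial sums of the Neumann series applied to x; each increment is the image of the previous
     one under - T. *)
  pose s n := iter n (fun z => x - T z) 0.
  have sB n : l2norm (s n.+1 - s n) <= l2norm x * q ^+ n.
    elim: n => [|n IH].
      by rewrite /s /= (opb0 hT) subr0 subr0 expr0 mulr1.
    rewrite {1}/s iterS -/(s n.+1) {2}/s iterS -/(s n).
    rewrite opprB addrC addrA subrK -(opbB hT) (le_trans (Tq' _))//.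
    rewrite exprS mulrCA ler_wpM2l//.
    by rewrite l2norm_le ?mulr_ge0 ?l2norm_ge0 ?exprn_ge0// nrm2BC
       -l2norm_le ?mulr_ge0 ?l2norm_ge0 ?exprn_ge0.
  have [|y yE] := l2_complete _ (l2norm_ge0 x) sB; first by rewrite q0.
  exists y; apply/eqP; rewrite -subr_eq0; apply/eqP; apply: nrm2_eq0.
  have H n : l2norm (y + T y - x) <= 2 * (l2norm x * q ^+ n / (1 - q)).
    have -> : y + T y - x = (y - s n.+1) + T (y - s n).
      rewrite (opbB hT) {1}/s iterS -/(s n) opprB addrACA.
      by congr (_ + _); rewrite addrAC subrr sub0r.
    apply: (le_trans (l2normD _ _)); rewrite mulr2n mulrDl mul1r lerD//.
      apply: (le_trans (yE n.+1)); rewrite ler_wpM2r ?invr_ge0 ?(ltW q1')//.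
      by rewrite ler_wpM2l ?l2norm_ge0// exprS ler_piMl ?exprn_ge0// ltW.
    apply: (le_trans (Tq' _)); apply: le_trans (yE n).
    by rewrite ler_piMl ?l2norm_ge0// ltW.
  have cv : (fun n => 2 * (l2norm x * q ^+ n / (1 - q))) @ \oo --> 2 * (l2norm x * 0 / (1 - q)).
    apply: cvgM; first exact: cvg_cst.
    apply: cvgM; last exact: cvg_cst.
    apply: cvgM; first exact: cvg_cst.
    by apply: cvg_expr; rewrite ger0_norm.
  rewrite mulr0 mul0r mulr0 in cv.
  have : l2norm (y + T y - x) <= 0 by apply: (cvgr_to_ge cv); apply: nearW; exact: H.
  rewrite l2norm_le// expr0n => h; apply: le_anti.
  by rewrite h nrm2_ge0.
pose S x := sval (cid (surj x)).
have SE x : S x + T (S x) = x by exact: (svalP (cid (surj x))).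
exists S; split.
- apply/bounded_opP; exists (1 - q)^-1; split.
  + by rewrite invr_ge0 ltW.
  + move=> c x y; apply: inj; rewrite SE (opb_lin hT) addrACA -scalerDr !SE.
    by [].
  + move=> x; have := lower (S x); rewrite SE => h.
    rewrite -l2norm_sqr -[nrm2 x]l2norm_sqr -exprMn.
  rewrite lerXn2r ?nnegrE ?l2norm_ge0 ?mulr_ge0 ?l2norm_ge0 ?invr_ge0 ?(ltW q1')//.
    by rewrite ler_pdivlMl.
- by apply/funext => x; exact: SE.
- apply/funext => x; apply: inj.
  exact: (SE (x + T x)).
Qed.

(** What needs an argument is uniqueness. A positive root S of D^2 commutes with D^2, hence with D;
    then y = S x - D x satisfies (S + D) y = 0, and D >= e > 0 together with S >= 0 forces y = 0. *)
Lemma positive_sqrt_diag (d : nat -> R) (B e : R) : 0 < e ->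
  (forall n, e <= d n <= B) ->
  positive_sqrt (matrix_op (diag_matrix (fun n => real_complex R (d n) ^+ 2))) =
  matrix_op (diag_matrix (fun n => real_complex R (d n))).
Proof.
move=> e0 dB.
have d0 n : 0 < d n by case/andP: (dB n) => + _; exact: lt_le_trans.
pose D := matrix_op (diag_matrix (fun n => real_complex R (d n))).
have dc n : cabs (real_complex R (d n)) <= B.
  by rewrite cabs_toC gtr0_norm//; case/andP: (dB n).
have d2c n : cabs (real_complex R (d n) ^+ 2) <= B ^+ 2.
  by rewrite cabsX lerXn2r ?nnegrE ?cabs_ge0// (le_trans _ (dc 0%N))// cabs_ge0.
have DE x k : D x k = real_complex R (d k) * x k by exact: (diag_opE dc).
have hD : opb B D by exact: (diag_opb dc).
rewrite -/D; clearbody D.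
have dotD x : exists2 r, l2dot x (D x) = real_complex R r & e * nrm2 x <= r.
  have dk k : (x k)^* * (D x) k = real_complex R (d k * cabs (x k) ^+ 2).
    by rewrite DE [LHS]mulrCA conjM_cabs -toCM.
  have rp N : complex.Re (\sum_(0 <= k < N) (x k)^* * (D x) k) >= e * psum x N.
    rewrite Re_sum /psum mulr_sumr; apply: ler_sum => k _.
    by rewrite dk /= ler_wpM2r ?sqr_ge0//; case/andP: (dB k).
  have im N : complex.Im (\sum_(0 <= k < N) (x k)^* * (D x) k) = 0.
    by rewrite Im_sum big1// => k _; rewrite dk.
  have cd := @cvg_dot _ x (D x).
  exists (complex.Re (l2dot x (D x))).
    apply: cplx_eq => //=; apply: (real_cvg_unique (cvg_Im cd)).
    by under eq_fun do rewrite im; exact: cvg_cst.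
  have h1 : (fun N => e * psum x N) @ \oo --> e * nrm2 x.
    by apply: cvgM; [exact: cvg_cst|exact: cvg_psum].
  by apply: (ler_cvg_to h1 (cvg_Re cd)); apply: nearW.
have PD : is_positive_sqrt (matrix_op (diag_matrix (fun n => real_complex R (d n) ^+ 2))) D.
  split.
  - by apply/bounded_opP; exists B.
  - move=> x; have [r -> hr] := dotD x; rewrite ler0c (le_trans _ hr)//.
    by rewrite mulr_ge0 ?nrm2_ge0 ?(ltW e0).
  - apply/funext => x; apply: l2_eq => k.
    by rewrite (diag_opE d2c) [LHS](DE (D x)) DE mulrA expr2.
rewrite /positive_sqrt; case: xgetP => [S _ PS|/(_ D)]; last by [].
have [/bounded_opP[A hS] Spos SS] := PS.
have SSE x k : (S (S x)) k = real_complex R (d k) ^+ 2 * x k.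
  by rewrite -(diag_opE d2c); have /(congr1 (fun f => f x)) /= -> := SS.
(* Computing S^3 e_n in two ways gives (d_k^2 - d_n^2) (S e_n)_k = 0. As the d's are positive, S e_n
   only has coordinates k with d_k = d_n. *)
have SDn n : S (D (unit_vector n)) = D (S (unit_vector n)).
  have Dn : D (unit_vector n) = real_complex R (d n) *: unit_vector n.
    apply: l2_eq => k; rewrite DE.
    rewrite [RHS](_ : _ = real_complex R (d n) * unit_vector n k)// !unit_vectorE.
    by case: eqP => [->|]; rewrite ?mulr0.
  rewrite Dn (opbZ hS); apply: l2_eq => k; rewrite DE.
  rewrite [LHS](_ : _ = real_complex R (d n) * (S (unit_vector n)) k)//.
  have [->|Sk0] := eqVneq ((S (unit_vector n)) k) 0; first by rewrite !mulr0.
  congr (_ * _).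
  have E1 : S (S (S (unit_vector n))) k = real_complex R (d k) ^+ 2 * (S (unit_vector n)) k.
    exact: SSE.
  have E2 : S (S (unit_vector n)) = real_complex R (d n) ^+ 2 *: unit_vector n.
    apply: l2_eq => j; rewrite SSE.
    rewrite [RHS](_ : _ = real_complex R (d n) ^+ 2 * unit_vector n j)// !unit_vectorE.
    by case: eqP => [->|]; rewrite ?mulr0.
  rewrite E2 (opbZ hS) [LHS](_ : _ = real_complex R (d n) ^+ 2 * (S (unit_vector n)) k)// in E1.
  move/(mulIf Sk0): E1; rewrite -!toCX => -[] /eqP.
  by rewrite eqrXn2 ?(ltW (d0 _))// => /eqP ->.
have SD : S \o D = D \o S.
  by apply: (opb_ext (opb_comp hS hD) (opb_comp hD hS)) => n; exact: SDn.
apply/funext => x; apply/eqP; rewrite -subr_eq0; apply/eqP.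
set y := S x - D x.
(* (S + D) (S - D) = S^2 - D^2 = 0, thanks to the commutation. *)
have Sy : S y + D y = 0.
  rewrite /y (opbB hS) (opbB hD).
  have /(congr1 (fun f => f x)) /= -> := SD.
  rewrite addrA subrK; apply/eqP; rewrite subr_eq0; apply/eqP.
  by apply: l2_eq => k; rewrite SSE !DE mulrA expr2.
have : l2dot y (S y) + l2dot y (D y) = 0 by rewrite -dotDr Sy dot0r.
have [r -> hr] := dotD y.
have := Spos y; case: (l2dot y (S y)) => p p' /=; rewrite lecE /= => /andP[_ p0] [h _].
apply: nrm2_eq0; apply/eqP; rewrite eq_le nrm2_ge0 andbT.
have : e * nrm2 y <= 0 by lra.
by rewrite pmulr_rle0.
Qed.

End operator_theory.

(** * The Hessenberg matrix and the ORF recurrence *)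

Section hessenberg_matrix.
Context {R : realType}.
Local Notation C := (cplx R).
Context (a : nat -> C) (a0 : a 0%N = 1) (a1 : forall n, `|a n.+1| < 1).

Lemma rho_toC n : rho a n = real_complex R (Num.sqrt (1 - cabs (a n) ^+ 2)).
Proof.
have h : 0 <= 1 - cabs (a n) ^+ 2.
  rewrite subr_ge0 expr_le1 ?cabs_ge0//.
  by case: n => [|n]; [rewrite a0 cabs1|rewrite ltW// -norm_lt1].
rewrite /rho normE -toCX.
have -> : 1 - real_complex R (cabs (a n) ^+ 2) = real_complex R (Num.sqrt (1 - cabs (a n) ^+ 2)) ^+ 2 :> C.
  by rewrite -toCX sqr_sqrtr// toCB.
by rewrite sqrCK// ler0c sqrtr_ge0.
Qed.

Definition rhor n : R := Num.sqrt (1 - cabs (a n) ^+ 2).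

Lemma rhorS n : 0 < rhor n.+1 /\ rhor n.+1 ^+ 2 = 1 - cabs (a n.+1) ^+ 2.
Proof.
have h : 0 < 1 - cabs (a n.+1) ^+ 2.
  by rewrite subr_gt0 expr_lt1 ?cabs_ge0// -norm_lt1.
by rewrite /rhor sqrtr_gt0 sqr_sqrtr// ltW.
Qed.

(* Coordinates of [phi_n^*] in the basis [phi_0, ..., phi_n] when [alpha = 0]. *)
Definition star_coef (n k : nat) : C :=
  if (k <= n)%N then (\prod_(k.+1 <= j < n.+1) rho a j) * (a k)^* else 0.

Lemma star_coef00 : star_coef 0 0 = 1.
Proof. by rewrite /star_coef /= big_geq// mul1r a0 conjC1. Qed.

Lemma star_coefS_le n k : (k <= n)%N ->
  star_coef n.+1 k = rho a n.+1 * star_coef n k.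
Proof.
move=> kn; rewrite /star_coef kn (leqW kn) big_nat_recr//=.
by rewrite mulrAC mulrC.
Qed.

Lemma star_coefSS n : star_coef n.+1 n.+1 = (a n.+1)^*.
Proof. by rewrite /star_coef leqnn big_geq// mul1r. Qed.

Lemma hessenberg_le n k : (k <= n)%N ->
  hessenberg a k n = - a n.+1 * star_coef n k.
Proof. by move=> kn; rewrite /hessenberg /star_coef kn mulrA. Qed.

Lemma hessenberg_S n : hessenberg a n.+1 n = rho a n.+1.
Proof. by rewrite /hessenberg ltnn eqxx. Qed.

Lemma hessenberg_gt n k : (n.+1 < k)%N -> hessenberg a k n = 0.
Proof.
move=> nk; rewrite /hessenberg leqNgt (ltn_trans (ltnSn n) nk) /=.
by rewrite gtn_eqF.
Qed.

(* The first [N] columns of [hessenberg a], bordered by the column [star_coef N], form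
   a unitary matrix. *)
Lemma hessenberg_rotation (u : nat -> C) N c :
  psum (fun k => \sum_(0 <= n < N) hessenberg a k n * u n + c * star_coef N k) N.+1 =
  psum u N + cabs c ^+ 2.
Proof.
elim: N c => [|N IH] c.
  by rewrite /psum big_nat1 !big_geq// add0r add0r star_coef00 mulr1.
(* Passing from N to N + 1 is one plane rotation: (u_N, c) goes to (c', d) under the unitary matrix
   with entries - a, rho, rho, conj a. The coordinate [d] is final, and [c'] becomes the border
   coefficient at stage N. *)
pose c' := - a N.+1 * u N + c * rho a N.+1.
pose d := rho a N.+1 * u N + c * (a N.+1)^*.
rewrite psumS.
have -> : psum (fun k => \sum_(0 <= n < N.+1) hessenberg a k n * u n + c * star_coef N.+1 k) N.+1 =
   psum (fun k => \sum_(0 <= n < N) hessenberg a k n * u n + c' * star_coef N k) N.+1.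
  apply: eq_big_nat => k /andP[_ kN]; congr (cabs _ ^+ 2).
  rewrite big_nat_recr//= hessenberg_le// star_coefS_le// /c'; ring.
rewrite IH [X in X + c * _](_ : _ = rho a N.+1 * u N); last first.
  rewrite big_nat_recr//= hessenberg_S big1_seq ?add0r// => i /andP[_].
  by rewrite mem_index_iota => /andP[_ iN]; rewrite hessenberg_gt ?mul0r.
rewrite star_coefSS -/d psumS -!addrA; congr (_ + _).
have [_ r2] := rhorS N.
have -> : cabs c' ^+ 2 + cabs d ^+ 2 =
   (cabs (a N.+1) ^+ 2 + rhor N.+1 ^+ 2) * (cabs (u N) ^+ 2 + cabs c ^+ 2).
  rewrite /c' /d rho_toC -/(rhor _) !sqr_cabs !(ReD,ImD,ReM,ImM,ReN,ImN,Re_conj,Im_conj) /=.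
  ring.
by rewrite r2 [_ + (1 - _)]addrC subrK mul1r.
Qed.

(** The rotation with border coefficient 0 is an isometry; rows beyond N vanish on the first N
    columns, so the truncation K is arbitrary. *)
Lemma hessenberg_contraction (u : nat -> C) N K :
  psum (fun k => \sum_(0 <= n < N) hessenberg a k n * u n) K <= 1 ^+ 2 * psum u N.
Proof.
rewrite expr1n mul1r; set f := (fun k => _).
have fN : psum f N.+1 = psum u N.
  have := hessenberg_rotation u N 0; rewrite cabs0 expr0n addr0 => <-.
  by apply: eq_bigr => k _; rewrite mul0r addr0.
have fi i : psum f (N.+1 + i)%N = psum f N.+1.
  elim: i => [|i IH]; first by rewrite addn0.
  rewrite addnS psumS IH /f big1_seq ?cabs0 ?expr0n ?addr0// => n /andP[_].
  rewrite mem_index_iota => /andP[_ nN].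
  rewrite hessenberg_gt ?mul0r//; apply: leq_trans (leq_addr i N.+1); exact: nN.
by rewrite -fN -(fi K) psum_le// leq_addl.
Qed.

End hessenberg_matrix.

(** * The ORF recurrence in Hessenberg form *)

Section orf_recurrence.
Context {R : realType}.
Local Notation C := (cplx R).
Local Notation T := (borel_cplx R).
Local Notation circ := (@unit_circle R : set (borel_cplx R)).
Context (alpha : nat -> C) (alpha_disk : forall n, `|alpha n| < 1).
Context (mu : probability T R) (phi : nat -> C -> C) (a : nat -> C).
Context (phi_orf : is_orf mu alpha phi a).

Lemma orf_a0 : a 0%N = 1. Proof. by case: phi_orf. Qed.
Lemma orf_a1 n : `|a n.+1| < 1. Proof. by case: phi_orf => _ _ _ _ /(_ n)[]. Qed.

Lemma toCV (r : R) : real_complex R r^-1 = (real_complex R r)^-1 :> C.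
Proof. exact: fmorphV. Qed.

Definition eta n : R := Num.sqrt (1 - cabs (alpha n) ^+ 2).

Lemma eta_gt0 n : 0 < eta n.
Proof.
by rewrite sqrtr_gt0 subr_gt0 expr_lt1 ?cabs_ge0// -norm_lt1.
Qed.

Lemma eta_le1 n : eta n <= 1.
Proof. by rewrite -sqrtr1 ler_wsqrtr// lerBlDr lerDl sqr_ge0. Qed.

Lemma eta2 n : eta n ^+ 2 = 1 - cabs (alpha n) ^+ 2.
Proof.
rewrite sqr_sqrtr// subr_ge0 expr_le1 ?cabs_ge0// ltW// -norm_lt1.
exact: alpha_disk.
Qed.

(** Because varpi_n(alpha_n) = eta_n^2, the normalizing factor is a quotient of successive eta's,
    which the scaling of [orf_u] absorbs. *)
Lemma orf_normE n :
  orf_norm alpha a n = real_complex R (eta n.+1 / eta n / rhor a n.+1).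
Proof.
have vE k : varpi alpha k (alpha k) = real_complex R (eta k ^+ 2) :> C.
  by rewrite /varpi conjM_cabs eta2 toCB.
have [r0 r2] := rhorS orf_a1 n.
rewrite /orf_norm !vE normE -toCX.
have -> : 1 - real_complex R (cabs (a n.+1) ^+ 2) = real_complex R (rhor a n.+1 ^+ 2) :> C.
  by rewrite r2 toCB.
rewrite -!(fmorphV (real_complex R)) -!toCM.
have -> : eta n.+1 ^+ 2 * (eta n ^+ 2)^-1 * (rhor a n.+1 ^+ 2)^-1 =
    (eta n.+1 / eta n / rhor a n.+1) ^+ 2 by rewrite !exprMn !exprVn.
by rewrite toCX sqrCK// ler0c !divr_ge0// ltW// eta_gt0.
Qed.

(* In this normalization the ORF recurrence becomes the one of the orthogonal
   polynomials with the same parameters [a], with [orf_v] in place of [z * phi_n]. *)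
Definition orf_u n z : C := varpi alpha n z * phi n z / real_complex R (eta n).
Definition orf_us n z : C :=
  varpi alpha n z * upper_star alpha n (phi n) z / real_complex R (eta n).
Definition orf_v n z : C := varpi_star alpha n z * phi n z / real_complex R (eta n).

(** The first line of the recurrence is solved for [orf_v]; substituting it into the second and
    using rho^2 = 1 - |a|^2 eliminates [orf_v], so [orf_us] can be unrolled in terms of [orf_u]
    alone. *)
Lemma orf_step n z : regular_point alpha n.+1 z ->
  orf_v n z = rho a n.+1 * orf_u n.+1 z - a n.+1 * orf_us n z /\
  orf_us n.+1 z = rho a n.+1 * orf_us n z + (a n.+1)^* * orf_u n.+1 z.
Proof.
move=> zr; case: phi_orf => _ _ _ _ /(_ n)[_ /(_ z zr)[E1 E2]].
have [v0 _] := zr n (leqnSn n); have [v1 _] := zr n.+1 (leqnn _).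
rewrite /orf_v /orf_u /orf_us E2 E1 orf_normE (rho_toC orf_a0 orf_a1) -/(rhor a _).
have [r0 r2] := rhorS orf_a1 n.
have e0 := eta_gt0 n; have e1 := eta_gt0 n.+1.
have r2' : real_complex R (rhor a n.+1) ^+ 2 = 1 - (a n.+1)^* * a n.+1 :> C.
  by rewrite conjM_cabs -toCX r2 toCB.
have c0 (x : R) : 0 < x -> real_complex R x != 0 :> C.
  by move=> x0; rewrite -cabs_eq0 cabs_toC normr_eq0 gt_eqF.
have {}r0 := c0 _ r0; have {}e0 := c0 _ e0; have {}e1 := c0 _ e1.
rewrite !toCM !toCV /zeta.
move: (upper_star _ _ _ _) (phi n z) (varpi_star alpha n z) => us p vs.
move: (varpi alpha n z) (varpi alpha n.+1 z) v0 v1 => v v' v0 v1.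
move: (real_complex R (eta n)) (real_complex R (eta n.+1)) e0 e1 => h h' h0 h1.
move: (real_complex R (rhor a n.+1)) r0 r2' => r r0 r2'.
move: (a n.+1) (a n.+1)^* r2' => b b' r2'.
split; first by field; rewrite v0 v1 r0 h0 h1.
apply/eqP; rewrite -subr_eq0; apply/eqP.
transitivity (v * us / (h * r) * (1 - b' * b - r ^+ 2)).
  by field; rewrite v0 v1 r0 h0 h1.
by rewrite r2' subrr mulr0.
Qed.

Lemma orf_us_sum n z : regular_point alpha n z ->
  orf_us n z = \sum_(0 <= k < n.+1) star_coef a n k * orf_u k z.
Proof.
elim: n => [|n IH] zr.
  rewrite big_nat1 (star_coef00 orf_a0) mul1r /orf_us /orf_u /upper_star.
  have phi0 t : phi 0%N t = 1 by case: phi_orf => _ _ + _ _; apply.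
  by rewrite /lower_star !phi0 conjC1 blaschke0 mulr1.
have [_ ->] := orf_step zr.
rewrite IH; last by move=> k kn; apply: zr; exact: leqW.
rewrite [RHS]big_nat_recr//= star_coefSS; congr (_ + _).
rewrite mulr_sumr; apply: eq_big_nat => k /andP[_]; rewrite ltnS => kn.
by rewrite star_coefS_le// mulrA.
Qed.

Lemma orf_recurrence n z : regular_point alpha n.+1 z ->
  orf_v n z = \sum_(0 <= k < n.+2) hessenberg a k n * orf_u k z.
Proof.
move=> zr; have [-> _] := orf_step zr.
rewrite orf_us_sum; last by move=> k kn; apply: zr; exact: leqW.
rewrite [RHS]big_nat_recr//= hessenberg_S addrC; congr (_ + _).
rewrite mulr_sumr -sumrN; apply: eq_big_nat => k /andP[_]; rewrite ltnS => kn.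
by rewrite hessenberg_le// -mulNr mulrA.
Qed.

End orf_recurrence.

(** * Multiplication operators in the basis of the ORF *)

Section multiplication_operators.
Context {R : realType}.
Local Notation C := (cplx R).
Local Notation T := (borel_cplx R).
Local Notation l2 := (l2 R).
Local Notation circ := (@unit_circle R : set (borel_cplx R)).
Context (alpha : nat -> C)
  (alpha_disk : forall n, `|alpha n| < 1)
  (alpha_compact : sup (range (fun n => cabs (alpha n))) < 1).
Context (mu : probability T R) (w : C -> R).
Context (mu1 : mu circ = 1%E) (hw : ac_density mu w) (nlog : ~ log_integrable w).
Context (phi : nat -> C -> C) (a : nat -> C) (phi_orf : is_orf mu alpha phi a).

Let mufin : (mu circ < +oo)%E. Proof. by rewrite mu1 ltry. Qed.

Lemma orf_span n f : in_span phi n f <-> in_span (blaschke alpha) n f.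
Proof. by case: phi_orf. Qed.

Lemma orf0 z : phi 0%N z = 1. Proof. by case: phi_orf. Qed.

Lemma orf_orthonormal j k :
  circle_integral mu (fun z => (phi j z)^* * phi k z) = (j == k)%:R.
Proof. by case: phi_orf. Qed.

Lemma orf_rational n : rational_fun alpha (phi n).
Proof. by exists n; apply/orf_span; exact: in_span_basis. Qed.

Lemma cB_orf n : cB (phi n).
Proof. exact: (cB_rational alpha_disk (orf_rational n)). Qed.

Lemma rational_orf f : rational_fun alpha f -> exists N c,
  forall z, f z = \sum_(0 <= k < N) c k * phi k z.
Proof. by move=> [n /orf_span[c fE]]; exists n.+1, c. Qed.

Definition orf_sum (c : nat -> C) N z : C := \sum_(0 <= k < N) c k * phi k z.

Lemma cB_orf_sum c N : cB (orf_sum c N).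
Proof. by apply: cB_sum => i; apply: cBM (cB_cst _) (cB_orf i). Qed.

Definition coef (f : C -> C) n : C := circle_integral mu (fun z => (phi n z)^* * f z).

Arguments coef : simpl never.
Local Arguments cabs : simpl never.

Let cB_conj_orf n : cB (fun z => (phi n z)^*). Proof. exact: cB_conj (cB_orf n). Qed.

Lemma coef_ext f g : (forall z, circ z -> f z = g z) -> coef f = coef g.
Proof. by move=> fg; apply/funext => n; apply: ci_ext => z cz; rewrite fg. Qed.

Lemma coef_lin c f g n : cB f -> cB g ->
  coef (fun z => c * f z + g z) n = c * coef f n + coef g n.
Proof.
move=> bf bg; have bpf := cBM (cB_conj_orf n) bf; have bpg := cBM (cB_conj_orf n) bg.
rewrite /coef -(ciZ mufin)// -(ciD mufin)//; last exact: cBM (cB_cst c) bpf.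
by apply: ci_ext => z _; ring.
Qed.

Lemma coef_sum (u : nat -> C) (F : nat -> C -> C) N n : (forall i, cB (F i)) ->
  coef (fun z => \sum_(0 <= i < N) u i * F i z) n = \sum_(0 <= i < N) u i * coef (F i) n.
Proof.
move=> bF; elim: N => [|N IH].
  rewrite [RHS]big_geq//; apply: etrans (ci0 mu); apply: ci_ext => z _.
  by rewrite big_geq// mulr0.
rewrite big_nat_recr//= -IH addrC -coef_lin//; last first.
  by apply: cB_sum => i; apply: cBM (cB_cst _) (bF i).
by congr (coef _ n); apply/funext => z; rewrite big_nat_recr//= addrC.
Qed.

Lemma nsq_expand f g : cB f -> cB g ->
  nsq mu (fun z => f z - g z) = nsq mu f + nsq mu g -
    2 * complex.Re (circle_integral mu (fun z => (g z)^* * f z)).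
Proof.
move=> bf bg; have bf' := cB_conj bf; have bg' := cB_conj bg.
rewrite ciE /= -(cintZ mufin); last by case: (cBM bg' bf).
rewrite -(cintD mufin) -?(cintB mufin).
- by apply: cint_ext => z _; rewrite !sqr_cabs ReB ImB ReM Re_conj Im_conj; ring.
- by apply: bBD; exact: bB_cabs2.
- by apply: bBZ; case: (cBM bg' bf).
- exact: bB_cabs2.
- exact: bB_cabs2.
Qed.

Lemma coef_orf_sum c N n : coef (orf_sum c N) n = if (n < N)%N then c n else 0.
Proof.
rewrite coef_sum; last exact: cB_orf.
have E i : coef (phi i) n = (n == i)%:R by exact: orf_orthonormal.
case: ifPn => nN.
  rewrite (bigD1_seq n)/= ?mem_index_iota ?iota_uniq// E eqxx mulr1 big1 ?addr0//.
  by move=> i; rewrite eq_sym => /negbTE ni; rewrite E ni mulr0.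
apply: big1_seq => i /andP[_]; rewrite mem_index_iota => /andP[_ iN].
by rewrite E; case: eqP => [ni|]; [move: nN; rewrite ni iN|rewrite mulr0].
Qed.

Lemma ip_orf_sum c N f : cB f ->
  circle_integral mu (fun z => (orf_sum c N z)^* * f z) =
  \sum_(0 <= k < N) (c k)^* * coef f k.
Proof.
move=> bf; rewrite -[LHS]conjCK -(ci_conj mufin); last first.
  exact: cBM (cB_conj (cB_orf_sum c N)) bf.
transitivity ((\sum_(0 <= k < N) c k * circle_integral mu (fun z => (f z)^* * phi k z))^*).
  congr (_^*).
  elim: N => [|N IH].
    rewrite [RHS]big_geq//; apply: etrans (ci0 mu); apply: ci_ext => z _.
    by rewrite /orf_sum big_geq// conjC0 mul0r conjC0.
  rewrite big_nat_recr//= -IH addrC -(ciZ mufin); last exact: cBM (cB_conj bf) (cB_orf N).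
  rewrite -(ciD mufin); last 2 first.
  - by apply: cBM (cB_cst _) _; exact: cBM (cB_conj bf) (cB_orf N).
  - by apply: cB_conj; apply: cBM bf; apply: cB_conj; exact: cB_orf_sum.
  apply: ci_ext => z _; rewrite /orf_sum big_nat_recr//= !conjM !conjCK.
  by rewrite mulrDl addrC; congr (_ + _); rewrite mulrAC mulrA.
rewrite conj_sum; apply: eq_bigr => k _; rewrite conjM; congr (_ * _).
rewrite -(ci_conj mufin); last exact: cBM (cB_conj bf) (cB_orf k).
by apply: ci_ext => z _; rewrite conjM conjCK mulrC.
Qed.

Lemma nsq_orf_sum c N : nsq mu (orf_sum c N) = psum c N.
Proof.
apply: (@complexI R); rewrite -ci_nsq ip_orf_sum; last exact: cB_orf_sum.
rewrite toC_sum; apply: eq_big_nat => k /andP[_ kN].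
by rewrite coef_orf_sum kN conjM_cabs.
Qed.

(** Pythagoras: the residual of f past its first N coefficients, plus the distance inside the span.
    Taking c to be the coefficients gives [bessel]; a lower bound valid for every c gives
    [parseval]. *)
Lemma nsq_orf_sumB c N f : cB f ->
  nsq mu (fun z => f z - orf_sum c N z) =
    nsq mu f - psum (coef f) N + psum (fun k => c k - coef f k) N.
Proof.
move=> bf; rewrite nsq_expand//; last exact: cB_orf_sum.
rewrite nsq_orf_sum ip_orf_sum// Re_sum mulr_sumr /psum -!addrA; congr (_ + _).
rewrite -sumrN -!sumrN -!big_split /=; apply: eq_bigr => k _.
rewrite !sqr_cabs ReB ImB ReM Re_conj Im_conj; ring.
Qed.

Lemma bessel f N : cB f -> psum (coef f) N <= nsq mu f.
Proof.
move=> bf; have := nsq_orf_sumB (coef f) N bf.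
rewrite [X in _ + X](_ : _ = 0) ?addr0; last first.
  by rewrite /psum big1// => k _; rewrite subrr cabs0 expr0n.
by move=> E; have := nsq_ge0 mu (fun z => f z - orf_sum (coef f) N z); rewrite E subr_ge0.
Qed.

Fact orfT_key : unit. Proof. exact: tt. Qed.

(* Locked, as is [mul_op] below: otherwise failing unification problems unfold
   the integrals. *)
Definition orfT : (C -> C) -> l2 :=
  locked_with orfT_key (fun f => insubd (0 : l2) (coef f)).

Lemma orfTE f n : cB f -> orfT f n = coef f n.
Proof.
move=> bf; rewrite /orfT locked_withE val_insubd ifT//; apply: l2_mem.
by apply/sq_summableP; exists (nsq mu f) => N; exact: bessel.
Qed.

(** Completeness of the ORF. A gap in Bessel's inequality would bound from below the squared
    distance of f to all ORF sums, against [rational_dense]. *)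
Lemma parseval f : cB f -> nrm2 (orfT f) = nsq mu f.
Proof.
move=> bf; have pE N : psum (orfT f) N = psum (coef f) N.
  by apply: eq_bigr => k _; rewrite orfTE.
apply: le_anti; apply/andP; split.
  by apply: nrm2_le => N; rewrite pE bessel.
rewrite leNgt; apply/negP; rewrite -subr_gt0 => e0.
have [g /rational_orf[N [c gE]] [bg fg]] :=
  rational_dense alpha_disk alpha_compact mu1 hw nlog bf e0.
move: fg; have -> : (fun z => f z - g z) = (fun z => f z - orf_sum c N z).
  by apply/funext => z; rewrite gE.
rewrite nsq_orf_sumB//; have := psum_ge0 (fun k => c k - coef f k) N.
have := @psum_nrm2 _ (orfT f) N; rewrite pE; lra.
Qed.

Lemma orfT_lin c f g : cB f -> cB g ->
  orfT (fun z => c * f z + g z) = c *: orfT f + orfT g.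
Proof.
move=> bf bg; apply: l2_eq => n.
rewrite orfTE ?coef_lin//; last by apply: cBD => //; apply: cBM => //; exact: cB_cst.
by rewrite -!orfTE.
Qed.

Lemma orfT_ext f g : (forall z, circ z -> f z = g z) -> orfT f = orfT g.
Proof. by move=> fg; rewrite /orfT locked_withE (coef_ext fg). Qed.

Lemma orfTB f g : cB f -> cB g -> orfT (fun z => f z - g z) = orfT f - orfT g.
Proof.
move=> bf bg; have -> : orfT f - orfT g = -1 *: orfT g + orfT f by rewrite scaleN1r addrC.
apply: etrans (orfT_lin (-1) bg bf).
by apply: orfT_ext => z _; rewrite mulN1r addrC.
Qed.

Lemma orfTZ c f : cB f -> orfT (fun z => c * f z) = c *: orfT f.
Proof.
move=> bf; apply: l2_eq => n.
rewrite orfTE; last exact: cBM (cB_cst c) bf.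
rewrite [RHS](_ : _ = c * orfT f n)// orfTE//.
have c0 : coef (fun=> 0) n = 0.
  by apply: etrans (ci0 mu); apply: ci_ext => z _; rewrite mulr0.
rewrite -[RHS]addr0 -c0 -coef_lin//; last exact: cB_cst.
by congr (coef _ n); apply/funext => z; rewrite addr0.
Qed.

Lemma orfT_orf n : orfT (phi n) = unit_vector n.
Proof.
apply: l2_eq => k; rewrite orfTE; last exact: cB_orf.
by rewrite unit_vectorE; exact: orf_orthonormal.
Qed.

Lemma orfT_orf_sum c N : orfT (orf_sum c N) = fvec c N.
Proof.
apply: l2_eq => k; rewrite orfTE; last exact: cB_orf_sum.
by rewrite coef_orf_sum fvecE.
Qed.

Fact mul_op_key : unit. Proof. exact: tt. Qed.

(** Not defined through [orfT], whose values on bounded functions need not fill [l2]; the matrix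
    makes sense on every vector. *)
Definition mul_op : (C -> C) -> l2 -> l2 := locked_with mul_op_key
  (fun g => matrix_op (fun k n => coef (fun z => g z * phi n z) k)).

Lemma mul_opE g : mul_op g = matrix_op (fun k n => coef (fun z => g z * phi n z) k).
Proof. by rewrite /mul_op locked_withE. Qed.

(** A finite section sends u to the first coefficients of g times an ORF sum, so Bessel's inequality
    and |g| <= B suffice. *)
Lemma mul_op_bound g (B : R) : cB g -> (forall z, circ z -> cabs (g z) <= B) ->
  forall u N K,
  psum (fun k => \sum_(0 <= n < N) coef (fun z => g z * phi n z) k * u n) K <=
    B ^+ 2 * psum u N.
Proof.
move=> bg gB u N K.
have bgp : cB (fun z => g z * orf_sum u N z) by exact: cBM bg (cB_orf_sum u N).
have -> : psum (fun k => \sum_(0 <= n < N) coef (fun z => g z * phi n z) k * u n) K =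
    psum (coef (fun z => g z * orf_sum u N z)) K.
  apply: eq_bigr => k _; congr (cabs _ ^+ 2).
  transitivity (coef (fun z => \sum_(0 <= n < N) u n * (g z * phi n z)) k).
    rewrite coef_sum; last by move=> i; exact: cBM bg (cB_orf i).
    by apply: eq_bigr => n _; rewrite mulrC.
  apply: ci_ext => z _; congr (_ * _); rewrite /orf_sum mulr_sumr.
  by apply: eq_bigr => n _; rewrite mulrCA.
apply: (le_trans (bessel K bgp)); rewrite -nsq_orf_sum.
exact: (nsqM mufin (cB_orf_sum u N) bg gB).
Qed.

Lemma mul_op_opb g : cB g -> exists B, opb B (mul_op g).
Proof.
move=> bg; have [B B0 gB] := cB_bound bg; exists B; rewrite mul_opE.
exact: (matrix_op_opb B0 (mul_op_bound bg gB)).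
Qed.

Lemma mul_op_unit g n : cB g -> mul_op g (unit_vector n) = orfT (fun z => g z * phi n z).
Proof.
move=> bg; have [B B0 gB] := cB_bound bg; apply: l2_eq => k.
rewrite mul_opE (matrix_op_unit (mul_op_bound bg gB)) orfTE//.
exact: cBM bg (cB_orf n).
Qed.

Lemma mul_op_ext g h : (forall z, circ z -> g z = h z) -> mul_op g = mul_op h.
Proof.
move=> gh; rewrite !mul_opE; congr matrix_op; apply/funext => k; apply/funext => n.
by apply: ci_ext => z cz; rewrite gh.
Qed.

Lemma mul_op_ae g h (N : set T) : cB g -> cB h -> measurable N -> mu N = 0%E ->
  (forall z, circ z -> ~ N z -> g z = h z) -> mul_op g = mul_op h.
Proof.
move=> bg bh mN N0 gh; rewrite !mul_opE; congr matrix_op.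
apply/funext => k; apply/funext => n; apply/eqP; rewrite -subr_eq0; apply/eqP.
have bk := cB_conj_orf k; have bn := cB_orf n.
rewrite -[X in _ - X]mul1r -mulNr addrC -coef_lin; [|exact: cBM|exact: cBM].
have b := cBM bk (cBD (cBM (cB_cst (-1)) (cBM bh bn)) (cBM bg bn)).
rewrite /coef ciE; have [br bi] := b.
apply: cplx_eq => /=.
  rewrite (cint_null mufin mN N0 br)// => z cz Nz.
  by rewrite gh// mulN1r addNr mulr0.
rewrite (cint_null mufin mN N0 bi)// => z cz Nz.
by rewrite gh// mulN1r addNr mulr0.
Qed.

Lemma mul_op_orf_sum g c N : cB g ->
  mul_op g (fvec c N) = orfT (fun z => g z * orf_sum c N z).
Proof.
move=> bg; have [B hB] := mul_op_opb bg.
rewrite /fvec (opb_sum hB); apply: l2_eq => k; rewrite l2_sumE orfTE; last first.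
  exact: cBM bg (cB_orf_sum c N).
transitivity (coef (fun z => \sum_(0 <= n < N) c n * (g z * phi n z)) k).
  rewrite coef_sum; last by move=> i; exact: cBM bg (cB_orf i).
  apply: eq_bigr => n _; rewrite (opbZ hB) mul_op_unit//.
  rewrite [LHS](_ : _ = c n * orfT (fun z => g z * phi n z) k)// orfTE//.
  exact: cBM bg (cB_orf n).
apply: ci_ext => z _; congr (_ * _); rewrite /orf_sum mulr_sumr.
by apply: eq_bigr => n _; rewrite mulrCA.
Qed.

(** Exact for ORF sums by linearity, then extended by density: both sides are bounded in the L2 norm
    of f. The lemma is needed because g [phi_n] is in general no finite ORF sum, as happens in
    [mul_opM]. *)
Lemma mul_op_orfT g f : cB g -> cB f -> mul_op g (orfT f) = orfT (fun z => g z * f z).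
Proof.
move=> bg bf; have [B0 B00 gB] := cB_bound bg.
have hB : opb B0 (mul_op g) by rewrite mul_opE; exact: (matrix_op_opb B00 (mul_op_bound bg gB)).
have [_ _ mB] := hB.
apply/eqP; rewrite -subr_eq0; apply/eqP; apply: nrm2_eq0.
apply: le_anti; rewrite nrm2_ge0 andbT leNgt; apply/negP => e0.
set e := nrm2 _ in e0.
(* The defect is at most 4 B0^2 times the approximation error; the added 1 covers B0 = 0. *)
have d0 : 0 < e / (4 * B0 ^+ 2 + 1).
  by rewrite divr_gt0// ltr_wpDl ?mulr_ge0 ?sqr_ge0.
have [h /rational_orf[N [c hE]] [bh fh]] :=
  rational_dense alpha_disk alpha_compact mu1 hw nlog bf d0.
have {}hE : h = orf_sum c N by apply/funext.
rewrite hE in bh fh.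
have E1 : mul_op g (orfT f - orfT (orf_sum c N)) =
    mul_op g (orfT f) - orfT (fun z => g z * orf_sum c N z).
  apply: etrans (opbB hB _ _) _; congr (_ - _).
  by rewrite orfT_orf_sum; exact: mul_op_orf_sum.
have E2 : orfT (fun z => g z * (f z - orf_sum c N z)) =
    orfT (fun z => g z * f z) - orfT (fun z => g z * orf_sum c N z).
  apply: etrans (orfTB (cBM bg bf) (cBM bg bh)).
  by apply: orfT_ext => z _; rewrite mulrBr.
have E : mul_op g (orfT f) - orfT (fun z => g z * f z) =
   mul_op g (orfT f - orfT (orf_sum c N)) +
   - orfT (fun z => g z * (f z - orf_sum c N z)).
  have grp (V : zmodType) (x y z : V) : x - y = (x - z) + - (y - z).
    by rewrite opprB addrA subrK.
  by rewrite E1 E2; exact: grp.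
have h1 : nrm2 (mul_op g (orfT f - orfT (orf_sum c N))) <=
    B0 ^+ 2 * nsq mu (fun z => f z - orf_sum c N z).
  have -> : nsq mu (fun z => f z - orf_sum c N z) = nrm2 (orfT f - orfT (orf_sum c N)).
    apply: etrans (esym (parseval (cBB bf bh))) _; congr nrm2; exact: orfTB.
  exact: mB.
have bfh := cBB bf bh.
have h2 : nrm2 (- orfT (fun z => g z * (f z - orf_sum c N z))) <=
    B0 ^+ 2 * nsq mu (fun z => f z - orf_sum c N z).
  by rewrite nrm2N parseval; [exact: (nsqM mufin bfh bg gB)|exact: cBM].
have h3 : e <= 4 * B0 ^+ 2 * nsq mu (fun z => f z - orf_sum c N z).
  by rewrite /e E; apply: (le_trans (nrm2D_le _ _)); lra.
move: fh; rewrite ltr_pdivlMr; last by rewrite ltr_wpDl ?mulr_ge0 ?sqr_ge0.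
have := nsq_ge0 mu (fun z => f z - orf_sum c N z); lra.
Qed.

Lemma mul_opM g h : cB g -> cB h -> mul_op g \o mul_op h = mul_op (fun z => g z * h z).
Proof.
move=> bg bh; have [A hA] := mul_op_opb bg; have [B hB] := mul_op_opb bh.
have [D hD] := mul_op_opb (cBM bg bh).
apply: (opb_ext (opb_comp hA hB) hD) => n /=.
apply: etrans (congr1 (mul_op g) (mul_op_unit n bh)) _.
apply: etrans (mul_op_orfT bg (cBM bh (cB_orf n))) _.
apply: etrans (esym (mul_op_unit n (cBM bg bh))).
by apply: orfT_ext => z _; rewrite mulrA.
Qed.

Lemma mul_op_lin c g h : cB g -> cB h -> forall x,
  mul_op (fun z => c * g z + h z) x = c *: mul_op g x + mul_op h x.
Proof.
move=> bg bh x; have [A hA] := mul_op_opb bg; have [B hB] := mul_op_opb bh.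
have bgh : cB (fun z => c * g z + h z) by apply: cBD => //; exact: cBM (cB_cst c) bg.
have [D hD] := mul_op_opb bgh.
suff E : mul_op (fun z => c * g z + h z) = (fun y => c *: mul_op g y) + mul_op h.
  by rewrite E.
apply: (opb_ext hD (opb_add (opb_scale c hA) hB)) => n.
apply: etrans (mul_op_unit n bgh) _.
transitivity (c *: orfT (fun z => g z * phi n z) + orfT (fun z => h z * phi n z)).
  apply: etrans (orfT_lin c (cBM bg (cB_orf n)) (cBM bh (cB_orf n))).
  by apply: orfT_ext => z _; ring.
rewrite -(mul_op_unit n bg) -(mul_op_unit n bh).
by [].
Qed.

Lemma mul_op1 : mul_op (fun=> 1) = idfun.
Proof.
have [A hA] := mul_op_opb (cB_cst 1).
apply: (opb_ext hA (@opb_id R)) => n.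
by rewrite mul_op_unit; [rewrite -orfT_orf; apply: orfT_ext => z _; rewrite mul1r|exact: cB_cst].
Qed.

Lemma mul_op_adjoint g : cB g -> is_adjoint (mul_op g) (mul_op (fun z => (g z)^*)).
Proof.
move=> bg; have bg' := cB_conj bg.
have [A hA] := mul_op_opb bg; have [B hB] := mul_op_opb bg'.
have units m n : l2dot (mul_op g (unit_vector m)) (unit_vector n) =
    l2dot (unit_vector m) (mul_op (fun z => (g z)^*) (unit_vector n)).
  have E1 : l2dot (mul_op g (unit_vector m)) (unit_vector n) =
      (coef (fun z => g z * phi m z) n)^*.
    rewrite -dot_conj dot_unit (mul_op_unit m bg); congr (_^*).
    exact: orfTE (cBM bg (cB_orf m)).
  have E2 : l2dot (unit_vector m) (mul_op (fun z => (g z)^*) (unit_vector n)) =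
      coef (fun z => (g z)^* * phi n z) m.
    by rewrite dot_unit (mul_op_unit n bg'); exact: orfTE (cBM bg' (cB_orf n)).
  rewrite E1 E2 /coef -(ci_conj mufin).
    apply: ci_ext => z _; rewrite !conjM conjCK.
    by move: (phi n z) (phi m z)^* (g z)^* => x y t; ring.
  by apply: cBM (cB_conj_orf n) _; exact: cBM bg (cB_orf m).
exact: (is_adjoint_ext hA hB).
Qed.

(** Coordinate k is the inner product of x with the image of the unit vector k under multiplication
    by conj g. The bound involves g only through an integral, to which dominated convergence
    applies. *)
Lemma mul_op_coord g x k : cB g ->
  cabs (mul_op g x k) ^+ 2 <= nsq mu (fun z => (g z)^* * phi k z) * nrm2 x.
Proof.
move=> bg; have bg' := cB_conj bg.
have b := cBM bg' (cB_orf k).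
have E1 := mul_op_adjoint bg' (unit_vector k) x.
have E2 : mul_op (fun z => ((g z)^*)^*) = mul_op g.
  by apply: mul_op_ext => z _; rewrite conjCK.
rewrite E2 dot_unit in E1; rewrite -E1 -(parseval b) -(mul_op_unit k bg').
exact: cauchy_schwarz.
Qed.

(** Continuity of the functional calculus under bounded pointwise limits, coordinate by coordinate;
    this suffices to identify limits in [eigen_point]. *)
Lemma mul_op_cvg (g : nat -> C -> C) h (B : R) x k : (forall n, cB (g n)) -> cB h ->
  (forall n z, circ z -> cabs (h z - g n z) <= B) ->
  (forall z, circ z -> cabs (h z - g n z) @[n --> \oo] --> 0) ->
  (fun n => mul_op (g n) x k) @ \oo --> mul_op h x k.
Proof.
move=> bg bh hB h0.
have bhg n : cB (fun z => h z - g n z) by exact: cBB.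
have [P P0 pP] := cB_bound (cB_orf k).
pose e n := nsq mu (fun z => (h z - g n z)^* * phi k z).
have e0 : e @ \oo --> (0 : R).
  have -> : 0 = cint mu (fun=> 0) by rewrite cint_cst mul0r.
  apply: (@cint_cvg _ _ mufin _ _ ((B * P) ^+ 2)) => [n|n z cz|z cz].
  - by apply: bB_cabs2; exact: cBM (cB_conj (bhg n)) (cB_orf k).
  - rewrite ger0_norm ?sqr_ge0// cabsM cabs_conj.
    have := hB n z cz; have := pP z cz; move=> h1 h2.
    rewrite lerXn2r ?nnegrE ?mulr_ge0 ?cabs_ge0 ?ler_pM ?cabs_ge0//.
    by rewrite (le_trans (cabs_ge0 (h z - g n z))).
  - have -> : 0 = (0 * cabs (phi k z)) * (0 * cabs (phi k z)) :> R by rewrite !mul0r.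
    under eq_fun do rewrite cabsM cabs_conj expr2.
    by apply: cvgM; (apply: cvgM; [exact: h0|exact: cvg_cst]).
have cv : (fun n => Num.sqrt (e n * nrm2 x)) @ \oo --> (0 : R).
  have -> : 0 = Num.sqrt (0 * nrm2 x) by rewrite mul0r sqrtr0.
  apply: continuous_cvg; first exact: sqrt_continuous.
  by apply: cvgM; [exact: e0|exact: cvg_cst].
apply: (cvg_cplx_cabs _ cv) => n.
have E1 : mul_op (fun z => 1 * (h z - g n z) + g n z) = mul_op h.
  by apply: mul_op_ext => z _; rewrite mul1r subrK.
have E := mul_op_lin 1 (bhg n) (bg n) x; rewrite E1 in E.
have Ek : mul_op h x k = 1 * mul_op (fun z => h z - g n z) x k + mul_op (g n) x k.
  exact: (congr1 (fun y : l2 => y k) E).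
have -> : mul_op h x k - mul_op (g n) x k = mul_op (fun z => h z - g n z) x k.
  move: Ek; move: (mul_op h x k) (mul_op (g n) x k) (mul_op _ x k) => p q r ->.
  by rewrite mul1r addrK.
rewrite -(@ler_pXn2r _ 2) ?nnegrE ?cabs_ge0 ?sqrtr_ge0//.
rewrite sqr_sqrtr ?mulr_ge0 ?nrm2_ge0 ?nsq_ge0//.
exact: mul_op_coord.
Qed.

End multiplication_operators.

(** * Analytic continuation of the recurrence *)

Section poles.
Context {R : realType}.
Local Notation C := (cplx R).
Local Notation T := (borel_cplx R).
Local Notation circ := (@unit_circle R : set (borel_cplx R)).
Context (alpha : nat -> C) (alpha0 : alpha 0%N = 0)
  (alpha_disk : forall n, `|alpha n| < 1).
Context (mu : probability T R) (mu1 : mu circ = 1%E).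
Context (phi : nat -> C -> C) (a : nat -> C) (phi_orf : is_orf mu alpha phi a).

Lemma cvg_id_dnbhs (l : C) : (fun t : C => t) t @[t --> l^'] --> l.
Proof. by move=> A; exact: nbhs_dnbhs. Qed.

Lemma cvg_varpi (l : C) n : varpi alpha n t @[t --> l^'] --> varpi alpha n l.
Proof.
apply: cvgB; first exact: cvg_cst.
by apply: cvgM; [exact: cvg_cst|exact: cvg_id_dnbhs].
Qed.

Lemma cvg_varpi_star (l : C) n : varpi_star alpha n t @[t --> l^'] --> varpi_star alpha n l.
Proof. by apply: cvgB; [exact: cvg_id_dnbhs|exact: cvg_cst]. Qed.

Lemma cvg_blaschke (l : C) m : (forall k, (k <= m)%N -> varpi alpha k l != 0) ->
  forall n, (n <= m)%N -> blaschke alpha n t @[t --> l^'] --> blaschke alpha n l.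
Proof.
move=> vl; elim=> [|n IH] nm.
  rewrite blaschke0; under eq_fun do rewrite blaschke0; exact: cvg_cst.
rewrite blaschkeS; under eq_fun do rewrite blaschkeS.
apply: cvgM; first exact: IH (ltnW nm).
apply: cvgM; first exact: cvg_varpi_star.
by apply: cvgV; [exact: vl|exact: cvg_varpi].
Qed.

Lemma cvg_blaschke_sum (l : C) m (c : nat -> C) :
  (forall k, (k <= m)%N -> varpi alpha k l != 0) ->
  forall n, (n <= m.+1)%N ->
  \sum_(0 <= k < n) c k * blaschke alpha k t @[t --> l^'] -->
  \sum_(0 <= k < n) c k * blaschke alpha k l.
Proof.
move=> vl; elim=> [|n IH] nm.
  rewrite big_geq//; under eq_fun do rewrite big_geq//; exact: cvg_cst.
rewrite big_nat_recr//; under eq_fun do rewrite big_nat_recr//.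
apply: cvgD; first exact: IH (ltnW nm).
by apply: cvgM; [exact: cvg_cst|exact: cvg_blaschke vl _ _].
Qed.

Lemma cvg_orf (l : C) m : (forall k, (k <= m)%N -> varpi alpha k l != 0) ->
  forall n, (n <= m)%N -> phi n t @[t --> l^'] --> phi n l.
Proof.
move=> vl n nm; have [c cE] : in_span (blaschke alpha) n (phi n).
  by apply/(orf_span phi_orf); exact: in_span_basis.
rewrite cE; under eq_fun do rewrite cE.
exact: cvg_blaschke_sum vl _ _.
Qed.

Lemma near_neq0 (F : set_system C) (FF : Filter F) (f : C -> C) (y : C) :
  y != 0 -> f t @[t --> F] --> y -> \forall t \near F, f t != 0.
Proof.
move=> y0 /cvgrPdist_lt/(_ `|y|); rewrite normr_gt0 => /(_ y0).
apply: filterS => t h; apply/eqP => f0.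
by move: h; rewrite f0 subr0 ltxx.
Qed.

Lemma near_regular (l : C) m : (forall k, (k <= m)%N -> varpi alpha k l != 0) ->
  \forall t \near l^', regular_point alpha m t.
Proof.
move=> vl.
have step k : (k <= m)%N -> \forall t \near l^', varpi alpha k t != 0 /\ varpi_star alpha k t != 0.
  move=> km; apply: filterI; first exact: near_neq0 (vl k km) (@cvg_varpi l k).
  have [s0|s0] := eqVneq (varpi_star alpha k l) 0; last exact: near_neq0 s0 (@cvg_varpi_star l k).
  move: s0; rewrite /varpi_star => /eqP; rewrite subr_eq0 => /eqP <-.
  have : \forall t \near l^', t != l by exact: nbhs_dnbhs_neq.
  by apply: filterS => t; rewrite subr_eq0.
have H j : (j <= m)%N -> \forall t \near l^', regular_point alpha j t.
  elim: j => [|j IH] jm.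
    by apply: filterS (step 0%N jm) => t h k; rewrite leqn0 => /eqP ->.
  apply: filterS2 (IH (ltnW jm)) (step j.+1 jm) => t h1 h2 k.
  by rewrite leq_eqVlt => /orP[/eqP ->|]; [|exact: h1].
exact: H.
Qed.

(** The recurrence is given at regular points only, which excludes the points alpha_k. Near a point
    where no varpi_k vanishes, both sides are continuous and regular points accumulate, so the
    identity persists. *)
Lemma orf_recurrence_ext n (l : C) :
  (forall k, (k <= n.+1)%N -> varpi alpha k l != 0) ->
  orf_v alpha phi n l = \sum_(0 <= k < n.+2) hessenberg a k n * orf_u alpha phi k l.
Proof.
move=> vl.
pose G t := orf_v alpha phi n t - \sum_(0 <= k < n.+2) hessenberg a k n * orf_u alpha phi k t.
have cG : G t @[t --> l^'] --> G l.
  apply: cvgB.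
    apply: cvgM (@cvg_cst _ _ _ _ _); apply: cvgM; first exact: cvg_varpi_star.
    exact: cvg_orf vl _ (leqnSn n).
  have : forall j, (j <= n.+2)%N ->
    \sum_(0 <= k < j) hessenberg a k n * orf_u alpha phi k t @[t --> l^'] -->
    \sum_(0 <= k < j) hessenberg a k n * orf_u alpha phi k l.
    elim=> [|j IH] jn.
      rewrite big_geq//; under eq_fun do rewrite big_geq//; exact: cvg_cst.
    rewrite big_nat_recr//; under eq_fun do rewrite big_nat_recr//.
    apply: cvgD; first exact: IH (ltnW jn).
    apply: cvgM; first exact: cvg_cst.
    apply: cvgM (@cvg_cst _ _ _ _ _); apply: cvgM; first exact: cvg_varpi.
    exact: cvg_orf vl _ jn.
  exact.
have [//|Gl] := eqVneq (G l) 0; first by rewrite /G => /eqP; rewrite subr_eq0 => /eqP.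
have FF : ProperFilter (l^') by exact: Proper_dnbhs_numFieldType.
have [t [/= Gt tr]] := @filter_ex _ _ FF _
  (filterI (near_neq0 (@dnbhs_filter _ l) Gl cG) (near_regular vl)).
exfalso; move: Gt.
by rewrite /G (orf_recurrence alpha_disk phi_orf tr) subrr eqxx.
Qed.

(** Otherwise [phi n] lies in the span of its predecessors, so is orthogonal to itself. For n = 0
    the function is the constant 1. *)
Lemma orf_lead n (c : nat -> C) :
  (forall z, phi n z = \sum_(0 <= k < n.+1) c k * blaschke alpha k z) -> c n != 0.
Proof.
move=> cE; apply/eqP => cn0; case: n => [|n] in cE cn0 *.
  have := cE 0; rewrite big_nat1 cn0 mul0r (orf0 phi_orf).
  by move/eqP; rewrite oner_eq0.
have [d dE] : in_span phi n (phi n.+1).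
  by apply/(orf_span phi_orf); exists c => z; rewrite cE big_nat_recr//= cn0 mul0r addr0.
have := coef_orf_sum alpha_disk mu1 phi_orf d n.+1 n.+1.
rewrite ltnn => h; have := orf_orthonormal phi_orf n.+1 n.+1; rewrite eqxx.
have -> : circle_integral mu (fun z => (phi n.+1 z)^* * phi n.+1 z) =
    coef mu phi (orf_sum phi d n.+1) n.+1.
  by apply: ci_ext => z _; rewrite dE.
by rewrite h => /esym/eqP; rewrite oner_eq0.
Qed.

(** At the first index where varpi vanishes (not 0, since alpha_0 = 0) the ORF has a true pole: the
    earlier terms converge, while the last one has a simple zero below and, by [orf_lead], a nonzero
    limit above. *)
Lemma not_pole_varpi (l : C) : (forall n, ~ is_pole (phi n) l) ->
  forall k, varpi alpha k l != 0.
Proof.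
move=> np k; apply/negP => vk0.
have ex : exists k, varpi alpha k l == 0 by exists k.
case: (ex_minnP ex) => -[v0 _|{vk0}k vk0 kmin].
  by move: v0; rewrite /varpi alpha0 conjC0 mul0r subr0 oner_eq0.
have vl j : (j <= k)%N -> varpi alpha j l != 0.
  by move=> jk; apply/negP => /kmin; rewrite ltnNge jk.
apply: (np k.+1); rewrite /is_pole.
have [c cE] : in_span (blaschke alpha) k.+1 (phi k.+1).
  by apply/(orf_span phi_orf); exact: in_span_basis.
have ck0 := orf_lead cE.
have al : (alpha k.+1)^* * l = 1.
  by apply/esym/eqP; rewrite -subr_eq0.
(* A zero of varpi is the reflection 1 / conj alpha, outside the closed disk, so no numerator factor
   z - alpha_j can vanish there. *)
have l1 : 1 < cabs l.
  have := alpha_cabs alpha_disk k.+1; have := congr1 (@cabs R) al.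
  rewrite cabsM cabs_conj cabs1 => h1 h2.
  have := cabs_ge0 l; have := cabs_ge0 (alpha k.+1); nra.
have sl j : varpi_star alpha j l != 0.
  rewrite /varpi_star subr_eq0; apply/eqP => lj.
  by have := alpha_cabs alpha_disk j; rewrite -lj; lra.
have Bl : blaschke alpha k l != 0.
  elim: k {vk0 kmin cE ck0 al} vl => [|j IH] vl; first by rewrite blaschke0 oner_neq0.
  rewrite blaschkeS mulf_neq0//; first by apply: IH => i ij; apply: vl; exact: leqW.
  by rewrite mulf_neq0// invr_eq0 vl.
pose g t := c k.+1 * blaschke alpha k t * varpi_star alpha k.+1 t.
pose s t := \sum_(0 <= j < k.+1) c j * blaschke alpha j t.
have gl : g l != 0 by rewrite /g !mulf_neq0.
have cg : g t @[t --> l^'] --> g l.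
  apply: cvgM; last exact: cvg_varpi_star.
  by apply: cvgM; [exact: cvg_cst|exact: cvg_blaschke vl _ _].
have cs : s t @[t --> l^'] --> s l by exact: (@cvg_blaschke_sum l k c vl k.+1 (leqnn _)).
have cv : varpi alpha k.+1 t @[t --> l^'] --> 0.
  by rewrite -(eqP vk0); exact: cvg_varpi.
have phiE t : phi k.+1 t = s t + g t / varpi alpha k.+1 t.
  by rewrite cE big_nat_recr//= blaschkeS /g /zeta !mulrA.
apply/cvgryPge => A.
have b0 : 0 < cabs (g l) / 2 by rewrite divr_gt0// cabs_gt0.
(* Near l the polar part exceeds A' in modulus and the rest is at most |s(l)| + 1, which leaves |A|
   + 1. *)
pose A' := `|A| + cabs (s l) + 2.
have A'0 : 0 < A' by rewrite /A' ltr_wpDl ?addr_ge0 ?cabs_ge0.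
have toC0 (x : R) : 0 < x -> 0 < real_complex R x :> C by rewrite ltcR.
have near_lt (f : C -> C) (y : C) (e : R) : f t @[t --> l^'] --> y -> 0 < e ->
    \forall t \near l^', cabs (y - f t) < e.
  move=> fy e0; have /cvgrPdist_lt/(_ _ (toC0 _ e0)) := fy.
  by apply: filterS => t; rewrite norm_lt_toC ?toC0.
have d0 : 0 < cabs (g l) / 2 / A' by rewrite divr_gt0.
have n1 := near_lt g (g l) _ cg b0.
have n2 := near_lt s (s l) 1 cs ltr01.
have n3 := near_lt _ _ _ cv d0.
have n4 : \forall t \near l^', t != l by exact: nbhs_dnbhs_neq.
apply: filterS (filterI (filterI n1 n2) (filterI n3 n4)) => t [[h1 h2] [h3 tl]].
have vt0 : varpi alpha k.+1 t != 0.
  apply/negP => vt.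
  have ht : (alpha k.+1)^* * t = 1 by apply/esym/eqP; rewrite -subr_eq0.
  have ac0 : (alpha k.+1)^* != 0.
    by apply/eqP => h0; move/eqP: ht; rewrite h0 mul0r eq_sym oner_eq0.
  by move/eqP: tl; apply; apply: (mulfI ac0); rewrite ht al.
rewrite phiE sub0r cabsN in h3 *.
have g1 : cabs (g l) / 2 < cabs (g t).
  have : cabs (g l) <= cabs (g l - g t) + cabs (g t) by rewrite -{1}(subrK (g t) (g l)) cabsD.
  lra.
have s1 : cabs (s t) <= cabs (s l) + 1.
  have : cabs (s t) <= cabs (s t - s l) + cabs (s l) by rewrite -{1}(subrK (s l) (s t)) cabsD.
  rewrite cabsBC; lra.
have v0 : 0 < cabs (varpi alpha k.+1 t) by rewrite cabs_gt0.
have q1 : A' <= cabs (g t / varpi alpha k.+1 t).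
  rewrite cabsM cabsV ler_pdivlMr//.
  by move: h3; rewrite ltr_pdivlMr// mulrC => h3; lra.
have : cabs (g t / varpi alpha k.+1 t) <= cabs (s t + g t / varpi alpha k.+1 t) + cabs (s t).
  have := cabsD (s t + g t / varpi alpha k.+1 t) (- s t).
  by rewrite cabsN [s t + _]addrC addrK.
have := ler_norm A; move: q1; rewrite /A'; lra.
Qed.

End poles.

(** * The Moebius transform of the Hessenberg matrix *)

Fact diag_op_key : unit. Proof. exact: tt. Qed.

Section diagonal_operators.
Context {R : realType}.
Local Notation C := (cplx R).
Local Notation l2 := (l2 R).
Context (d : nat -> C) (B : R) (dB : forall n, cabs (d n) <= B).

Definition diag_op : l2 -> l2 := locked_with diag_op_key (matrix_op (diag_matrix d)).

Lemma diag_op_unlock : diag_op = matrix_op (diag_matrix d).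
Proof. exact: locked_withE. Qed.

Lemma diag_op_coord x k : diag_op x k = d k * x k.
Proof. by rewrite diag_op_unlock (diag_opE dB). Qed.

Lemma opb_diag_op : opb B diag_op.
Proof. by rewrite diag_op_unlock; exact: diag_opb. Qed.

End diagonal_operators.

Section mobius_transform.
Context {R : realType}.
Local Notation C := (cplx R).
Local Notation l2 := (l2 R).
Context (alpha : nat -> C)
  (alpha_disk : forall n, `|alpha n| < 1)
  (alpha_compact : sup (range (fun n => cabs (alpha n))) < 1).
Context (H : l2 -> l2) (hH : opb 1 H).

Let A := diag_op alpha.
Let A' := diag_op (fun n => (alpha n)^*).
Let N := diag_op (fun n => real_complex R (eta alpha n)).
Let Ni := diag_op (fun n => real_complex R (eta alpha n)^-1).

Lemma diag_op_adjoint (d : nat -> C) (B : R) : (forall n, cabs (d n) <= B) ->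
  is_adjoint (diag_op d) (diag_op (fun n => (d n)^*)).
Proof.
move=> dB; have dB' n : cabs (d n)^* <= B by rewrite cabs_conj.
apply: (is_adjoint_ext (opb_diag_op dB) (opb_diag_op dB')) => m n.
rewrite -dot_conj !dot_unit (diag_op_coord dB) (diag_op_coord dB') conjM !unit_vectorE.
rewrite [in RHS]eq_sym; case: eqVneq => [->|_]; last by rewrite conjC0 !mulr0.
by rewrite conjC1.
Qed.

(** Compactness of the parameters inside the disk makes the defect operators invertible. *)
Lemma eta_bound : exists2 e : R, 0 < e & forall n, e <= eta alpha n <= 1.
Proof.
have [r /andP[r0 r1] ar] := alpha_bound alpha_disk alpha_compact.
exists (Num.sqrt (1 - r ^+ 2)).
  by rewrite sqrtr_gt0 subr_gt0 expr_lt1.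
move=> n; rewrite eta_le1 andbT; apply: ler_wsqrtr.
by rewrite lerD2l lerN2 lerXn2r ?nnegrE ?cabs_ge0.
Qed.

Let alpha_le n : cabs (alpha n) <= 1. Proof. by rewrite ltW// alpha_cabs. Qed.
Let alpha_le' n : cabs (alpha n)^* <= 1. Proof. by rewrite cabs_conj alpha_le. Qed.
Let eta_le n : cabs (real_complex R (eta alpha n) : C) <= 1.
Proof. by rewrite cabs_toC gtr0_norm ?eta_le1//; exact: eta_gt0. Qed.

Let etaV_bound : exists B, forall n, cabs (real_complex R (eta alpha n)^-1 : C) <= B.
Proof.
have [e e0 he] := eta_bound; exists e^-1 => n.
have /andP[h1 _] := he n.
by rewrite cabs_toC normfV gtr0_norm ?(lt_le_trans e0)// lef_pV2 ?posrE ?(lt_le_trans e0).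
Qed.

Lemma N_opE x k : N x k = real_complex R (eta alpha k) * x k.
Proof. exact: (diag_op_coord eta_le). Qed.

Lemma Ni_opE x k : Ni x k = real_complex R (eta alpha k)^-1 * x k.
Proof. by have [B hB] := etaV_bound; exact: (diag_op_coord hB). Qed.

Lemma Ni_opb : exists B, opb B Ni.
Proof. by have [B hB] := etaV_bound; exists B; exact: (opb_diag_op hB). Qed.

Let eta_VK n : real_complex R (eta alpha n)^-1 * real_complex R (eta alpha n) = 1 :> C.
Proof. by rewrite -toCM mulVf// gt_eqF// eta_gt0. Qed.

Lemma Ni_NK : Ni \o N = idfun.
Proof.
by apply/funext => x; apply: l2_eq => k; rewrite /= Ni_opE N_opE mulrA eta_VK mul1r.
Qed.

Lemma N_NiK : N \o Ni = idfun.
Proof.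
by apply/funext => x; apply: l2_eq => k; rewrite /= N_opE Ni_opE mulrCA mulrA eta_VK mul1r.
Qed.

Let adjA : adjoint A = A'. Proof. exact: adjointE (diag_op_adjoint alpha_le). Qed.

Let adjA' : adjoint A' = A.
Proof.
rewrite (adjointE (diag_op_adjoint alpha_le')); congr diag_op.
by apply/funext => n; rewrite conjCK.
Qed.

(** Serves both defects at once: [A \o A'] and [A' \o A] are each diagonal with entries |alpha_k|^2,
    and 1 - |alpha_k|^2 = eta_k^2. *)
Let sqrtE (S T : l2 -> l2) : (forall x k, S x k = alpha k * (T x k) /\ T x k = (alpha k)^* * x k \/
    S x k = (alpha k)^* * (T x k) /\ T x k = alpha k * x k) ->
  positive_sqrt (idfun - S) = N.
Proof.
move=> ST; have [e e0 he] := eta_bound.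
rewrite (_ : idfun - S = diag_op (fun n => real_complex R (eta alpha n) ^+ 2)).
  by rewrite /N !diag_op_unlock; exact: (positive_sqrt_diag e0 he).
apply/funext => x; apply: l2_eq => k.
have b n : cabs (real_complex R (eta alpha n) ^+ 2 : C) <= 1.
  by rewrite cabsX exprn_ile1 ?cabs_ge0.
rewrite (diag_op_coord b) [LHS](_ : _ = x k - S x k)// -toCX (eta2 alpha_disk) toCB -conjM_cabs.
by case: (ST x k) => -[-> ->]; ring.
Qed.

Let defectA : defect A = N.
Proof.
rewrite /defect adjA; apply: (@sqrtE _ A') => x k; left.
by split; [exact: (diag_op_coord alpha_le)|exact: (diag_op_coord alpha_le')].
Qed.

Let defectA' : defect A' = N.
Proof.
rewrite /defect adjA'; apply: (@sqrtE _ A) => x k; right.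
by split; [exact: (diag_op_coord alpha_le')|exact: (diag_op_coord alpha_le)].
Qed.

Let invN : inverse N = Ni.
Proof.
apply: inverseE; split; [|exact: N_NiK|exact: Ni_NK].
by have [B hB] := Ni_opb; apply/bounded_opP; exists B.
Qed.

(** Both defects are the diagonal operator [N], and the Neumann series applies as ||A' H|| <= r < 1.
    Of the middle inverse S only the right inverse property is retained, all that the next two
    lemmas call for. *)
Lemma mobius_diag : exists S, [/\ exists B, opb B S,
  (idfun + (A' \o H)) \o S = idfun & mobius A H = Ni \o (H + A) \o S \o N].
Proof.
have [r /andP[r0 r1] ar] := alpha_bound alpha_disk alpha_compact.
have hA' : opb r A' by apply: opb_diag_op => n; rewrite cabs_conj.
have hq : opb (r * 1) (A' \o H) by exact: opb_comp.
have [|S hS] := @neumann_inverse _ (A' \o H) (r * 1) _ hq; first by rewrite mulr1 r0.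
have [/bounded_opP bS S1 _] := hS.
exists S; split=> //.
by rewrite /mobius adjA defectA defectA' invN (inverseE hS).
Qed.

(** Composing the hypothesis with S and [N] on the right restores the transform; the hypothesis
    itself contains no inverse of an unknown operator and can be tested on unit vectors. *)
Lemma mobius_eq (M : l2 -> l2) :
  M \o Ni \o (idfun + (A' \o H)) = Ni \o (H + A) -> mobius A H = M.
Proof.
move=> ME; have [S [_ S1 ->]] := mobius_diag.
apply/funext => x.
have S1x := congr1 (fun f => f (N x)) S1.
have MEx := congr1 (fun f => f (S (N x))) ME.
rewrite [LHS](_ : _ = (Ni \o (H + A)) (S (N x)))// -MEx.
rewrite [LHS](_ : _ = M (Ni (((idfun + (A' \o H)) \o S) (N x))))// S1x.
by have /(congr1 (fun f => f x)) /= -> := Ni_NK.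
Qed.

(** The counterpart of [mobius_eq] for a single functional. It is meant for a v in [l2] not known to
    come from a function on the circle, so the identity on unit vectors is extended by
    [functional_eq0]. *)
Lemma mobius_left_eigen (v : l2) (lambda : C) :
  (forall n, lambda * l2dot v (Ni ((idfun + (A' \o H)) (unit_vector n))) =
     l2dot v (Ni ((H + A) (unit_vector n)))) ->
  forall x, l2dot v (mobius A H x) = lambda * l2dot v x.
Proof.
move=> ve; have [S [_ S1 ->]] := mobius_diag.
have [B hNi] := Ni_opb.
have hA : opb 1 A by exact: opb_diag_op.
have hA' : opb 1 A' by exact: opb_diag_op.
have h1 : opb (B * (1 + 1)) (Ni \o (H + A)) by exact: (opb_comp hNi (opb_add hH hA)).
have h2 : opb (B * (1 + 1 * 1)) (Ni \o (idfun + (A' \o H))).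
  exact: (opb_comp hNi (opb_add (@opb_id R) (opb_comp hA' hH))).
move: h1 h2; set P := Ni \o (H + A); set Q := Ni \o (idfun + (A' \o H)) => h1 h2.
have L0 y : l2dot v (P y) - lambda * l2dot v (Q y) = 0.
  have [_ _ n1] := h1; have [_ _ n2] := h2.
  pose L y := l2dot v (P y) - lambda * l2dot v (Q y).
  apply: (@functional_eq0 _ L (2 * (nrm2 v * (B * (1 + 1)) ^+ 2) +
     2 * cabs lambda ^+ 2 * (nrm2 v * (B * (1 + 1 * 1)) ^+ 2))).
  - move=> c x z; rewrite /L (opb_lin h1) (opb_lin h2) !dotDr !dotZr.
    move: (l2dot v (P x)) (l2dot v (P z)) (l2dot v (Q x)) (l2dot v (Q z)) => p q r s; ring.
  - move=> x; rewrite /L addrC -mulNr.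
    apply: (le_trans (cabs_sqD_le _ _ _)); rewrite cabsN.
    have c1 := cauchy_schwarz v (P x); have c2 := cauchy_schwarz v (Q x).
    have k1 : cabs (l2dot v (P x)) ^+ 2 <= nrm2 v * ((B * (1 + 1)) ^+ 2 * nrm2 x).
      by apply: (le_trans c1); rewrite ler_wpM2l ?nrm2_ge0.
    have k2 : cabs (l2dot v (Q x)) ^+ 2 <= nrm2 v * ((B * (1 + 1 * 1)) ^+ 2 * nrm2 x).
      by apply: (le_trans c2); rewrite ler_wpM2l ?nrm2_ge0.
    have k3 : 2 * cabs lambda ^+ 2 * cabs (l2dot v (Q x)) ^+ 2 <=
        2 * cabs lambda ^+ 2 * (nrm2 v * ((B * (1 + 1 * 1)) ^+ 2 * nrm2 x)).
      by rewrite ler_wpM2l// mulr_ge0 ?sqr_ge0.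
    move: (cabs (l2dot v (P x)) ^+ 2) (cabs (l2dot v (Q x)) ^+ 2) k1 k3 => p q k1 k3.
    have -> : (2 * (nrm2 v * (B * (1 + 1)) ^+ 2) +
        2 * cabs lambda ^+ 2 * (nrm2 v * (B * (1 + 1 * 1)) ^+ 2)) * nrm2 x =
      2 * (nrm2 v * ((B * (1 + 1)) ^+ 2 * nrm2 x)) +
      2 * cabs lambda ^+ 2 * (nrm2 v * ((B * (1 + 1 * 1)) ^+ 2 * nrm2 x)) by ring.
    lra.
  - by move=> n; rewrite /L [X in _ * X](_ : _ = l2dot v (Ni ((idfun + (A' \o H)) (unit_vector n))))//
      ve subrr.
move=> x; have /eqP := L0 (S (N x)); rewrite subr_eq0 => /eqP.
rewrite [X in l2dot v X](_ : _ = (Ni \o (H + A) \o S \o N) x)// => ->.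
congr (_ * l2dot v _).
have S1x := congr1 (fun f => f (N x)) S1.
rewrite [LHS](_ : _ = Ni (((idfun + (A' \o H)) \o S) (N x)))// S1x.
by have /(congr1 (fun f => f x)) /= -> := Ni_NK.
Qed.

End mobius_transform.

(** * The Moebius transform as multiplication by z *)

Section orf_operator.
Context {R : realType}.
Local Notation C := (cplx R).
Local Notation T := (borel_cplx R).
Local Notation l2 := (l2 R).
Local Notation circ := (@unit_circle R : set (borel_cplx R)).
Context (alpha : nat -> C)
  (alpha_disk : forall n, `|alpha n| < 1)
  (alpha_compact : sup (range (fun n => cabs (alpha n))) < 1).
Context (mu : probability T R) (mu1 : mu circ = 1%E).
Context (phi : nat -> C -> C) (a : nat -> C) (phi_orf : is_orf mu alpha phi a).

Local Notation H := (matrix_op (hessenberg a)).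
Local Notation A := (diag_op alpha).
Local Notation A' := (diag_op (fun n => (alpha n)^*)).
Local Notation Ni := (diag_op (fun n => real_complex R (eta alpha n)^-1)).

Let hess := hessenberg_contraction (orf_a0 phi_orf) (orf_a1 phi_orf).

Let hH : opb 1 H. Proof. exact: (matrix_op_opb ler01 hess). Qed.

Let alpha_le n : cabs (alpha n) <= 1. Proof. by rewrite ltW// alpha_cabs. Qed.
Let alpha_le' n : cabs (alpha n)^* <= 1. Proof. by rewrite cabs_conj alpha_le. Qed.

Definition den_coef n k : C :=
  real_complex R (eta alpha k)^-1 * ((k == n)%:R + (alpha k)^* * hessenberg a k n).
Definition num_coef n k : C :=
  real_complex R (eta alpha k)^-1 * (hessenberg a k n + alpha k * (k == n)%:R).

Lemma den_vec n : Ni ((idfun + (A' \o H)) (unit_vector n)) = fvec (den_coef n) n.+2.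
Proof.
apply: l2_eq => k; rewrite fvecE (Ni_opE alpha_disk alpha_compact).
have E : ((idfun + (A' \o H)) (unit_vector n)) k = unit_vector n k + A' (H (unit_vector n)) k by [].
rewrite E.
rewrite (diag_op_coord alpha_le') (matrix_op_unit hess) unit_vectorE.
case: ifPn => //; rewrite -leqNgt => nk.
by rewrite hessenberg_gt// mulr0 addr0 gtn_eqF ?mulr0// (leq_trans _ nk).
Qed.

Lemma num_vec n : Ni ((H + A) (unit_vector n)) = fvec (num_coef n) n.+2.
Proof.
apply: l2_eq => k; rewrite fvecE (Ni_opE alpha_disk alpha_compact).
have E : ((H + A) (unit_vector n)) k = H (unit_vector n) k + A (unit_vector n) k by [].
rewrite E.
rewrite (diag_op_coord alpha_le) (matrix_op_unit hess) unit_vectorE.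
case: ifPn => //; rewrite -leqNgt => nk.
by rewrite hessenberg_gt// gtn_eqF ?mulr0 ?addr0 ?mulr0// (leq_trans _ nk).
Qed.

(** Pure regrouping at a single point: z (delta + conj alpha h) - (h + alpha delta) = delta (z -
    alpha) - h (1 - conj alpha z). Being pointwise, it serves both on the circle and at a point
    lambda elsewhere. *)
Lemma orf_sum_recurrence n z :
  orf_v alpha phi n z = \sum_(0 <= k < n.+2) hessenberg a k n * orf_u alpha phi k z ->
  z * orf_sum phi (den_coef n) n.+2 z = orf_sum phi (num_coef n) n.+2 z.
Proof.
move=> rec; apply/eqP; rewrite -subr_eq0; apply/eqP.
transitivity (orf_v alpha phi n z - \sum_(0 <= k < n.+2) hessenberg a k n * orf_u alpha phi k z);
  last by rewrite rec subrr.
have -> : orf_v alpha phi n z = \sum_(0 <= k < n.+2) (k == n)%:R * orf_v alpha phi k z.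
  have nI : n \in index_iota 0 n.+2 by rewrite mem_index_iota /= ltnS leqnSn.
  rewrite (bigD1_seq n nI (iota_uniq _ _)) /=.
  by rewrite eqxx mul1r big1 ?addr0// => i /negbTE ->; rewrite mul0r.
rewrite /orf_sum mulr_sumr -!sumrB; apply: eq_bigr => k _.
rewrite /den_coef /num_coef /orf_v /orf_u toCV /varpi /varpi_star.
move: ((k == n)%:R) (hessenberg a k n) (phi k z) ((alpha k)^*) ((real_complex R (eta alpha k))^-1 : C).
by move=> d h p a' e; ring.
Qed.

(** Every point of the circle is regular, so there the recurrence states column by column the
    identity required by [mobius_eq]. *)
Lemma mobius_orf : mobius A H = mul_op mu phi (fun z => z).
Proof.
have bz := @cB_id R.
have [B hB] := mul_op_opb alpha_disk mu1 phi_orf bz.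
apply: (mobius_eq alpha_disk alpha_compact hH).
have [D hNi] := Ni_opb alpha_disk alpha_compact.
have hA : opb 1 A by exact: opb_diag_op.
have hA' : opb 1 A' by exact: opb_diag_op.
apply: (opb_ext (opb_comp (opb_comp hB hNi) (opb_add (@opb_id R) (opb_comp hA' hH)))
  (opb_comp hNi (opb_add hH hA))) => n.
apply: etrans (congr1 (mul_op mu phi (fun z => z)) (den_vec n)) _.
apply: etrans (esym (num_vec n)).
apply: etrans (mul_op_orf_sum alpha_disk mu1 phi_orf _ _ bz) _.
apply: etrans (orfT_orf_sum alpha_disk mu1 phi_orf _ _).
apply: orfT_ext => z cz; apply: orf_sum_recurrence.
apply: (orf_recurrence alpha_disk phi_orf) => k _; split.
  exact: varpi_circ.
exact: varpi_star_circ.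
Qed.

End orf_operator.

(** * Spectrum and eigenvalues *)

Section spectral_theory.
Context {R : realType}.
Local Notation C := (cplx R).
Local Notation T := (borel_cplx R).
Local Notation l2 := (l2 R).
Local Notation circ := (@unit_circle R : set (borel_cplx R)).
Context (alpha : nat -> C) (alpha0 : alpha 0%N = 0)
  (alpha_disk : forall n, `|alpha n| < 1)
  (alpha_compact : sup (range (fun n => cabs (alpha n))) < 1).
Context (mu : probability T R) (w : C -> R).
Context (mu1 : mu circ = 1%E) (hw : ac_density mu w) (nlog : ~ log_integrable w).
Context (phi : nat -> C -> C) (a : nat -> C) (phi_orf : is_orf mu alpha phi a).

Local Notation M g := (mul_op mu phi g).
Local Notation V := (mul_op mu phi (fun z => z)).
Local Notation U f := (orfT mu phi f).

Let mufin : (mu circ < +oo)%E. Proof. by rewrite mu1 ltry. Qed.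

Let MM := mul_opM alpha_disk alpha_compact mu1 hw nlog phi_orf.
Let Mopb := mul_op_opb alpha_disk mu1 phi_orf.
Let Madj := mul_op_adjoint alpha_disk mu1 phi_orf.
Let MU := mul_op_orfT alpha_disk alpha_compact mu1 hw nlog phi_orf.
Let UE := orfTE alpha_disk mu1 phi_orf.
Let UZ := orfTZ alpha_disk mu1 phi_orf.
Let Upars := parseval alpha_disk alpha_compact mu1 hw nlog phi_orf.
Let bphi := cB_orf alpha_disk phi_orf.
Let bz := @cB_id R.

Lemma mul_op_unitary : unitary_op V.
Proof.
have adjV : adjoint V = M (fun z => z^*) by exact: (adjointE (Madj bz)).
have bz' := cB_conj bz.
split; rewrite ?adjV.
- by apply/bounded_opP; exact: Mopb.
- rewrite (MM bz' bz) -(mul_op1 alpha_disk mu1 phi_orf).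
  by apply: mul_op_ext => z cz; rewrite circ_conjM.
- rewrite (MM bz bz') -(mul_op1 alpha_disk mu1 phi_orf).
  by apply: mul_op_ext => z cz; rewrite mulrC circ_conjM.
Qed.

Lemma mul_op_resolvent (l : C) : (fun x => l *: x) - V = M (fun z => l - z).
Proof.
have [B hB] := Mopb bz.
have blz : cB (fun z : C => l - z) by exact: cBB (cB_cst l) bz.
have [D hD] := Mopb blz.
have bl : cB (fun z : C => l) by exact: cB_cst.
have E : M (fun z => l - z) = (fun x => -1 *: V x) + (fun x => l *: idfun x).
  apply: (opb_ext hD (opb_add (opb_scale (-1) hB) (opb_scale l (@opb_id R)))) => n.
  apply: etrans (mul_op_unit alpha_disk mu1 phi_orf n blz) _.
  have b1 := cBM bz (bphi n); have b2 := bphi n.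
  transitivity (-1 *: U (fun z => z * phi n z) + l *: U (phi n)).
    rewrite -(UZ l b2); have b3 := cBM bl b2.
    apply: etrans (orfT_lin alpha_disk mu1 phi_orf (-1) b1 b3).
    by apply: orfT_ext => z _; ring.
  rewrite -(mul_op_unit alpha_disk mu1 phi_orf n bz) (orfT_orf alpha_disk mu1 phi_orf).
  by [].
rewrite E; apply/funext => x; apply: l2_eq => k.
have -> : (((fun x : l2 => l *: x) - V) x) k = l * x k - V x k by [].
have -> : (((fun x0 : l2 => -1 *: V x0) + (fun x0 : l2 => l *: idfun x0)) x) k =
  -1 * V x k + l * x k by [].
by move: (V x k) (x k) => p q; ring.
Qed.

Definition indc (D : set T) (z : C) : C := real_complex R (\1_D z).

Lemma cB_indc (D : set T) : measurable D -> cB (indc D).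
Proof. by move=> mD; apply: cB_toC; exact: bB_ind. Qed.

Lemma indcE (D : set T) z : indc D z = (z \in D)%:R.
Proof. by rewrite /indc indicE; case: (_ \in _). Qed.

Lemma indc1 (D : set T) z : D z -> indc D z = 1.
Proof. by move=> Dz; rewrite indcE mem_set. Qed.

Lemma indc0 (D : set T) z : ~ D z -> indc D z = 0.
Proof. by move=> Dz; rewrite indcE memNset. Qed.

Lemma mu_circI (D : set T) : measurable D -> mu (D `&` circ) = mu D.
Proof.
move=> mD; have mc := @measurable_circ R.
have muC : mu (~` circ) = 0%E by rewrite probability_setC// mu1 subee.
rewrite [RHS](measureDI mu mD mc) [X in (X + _)%E](_ : _ = 0%E) ?add0e//.
apply/eqP; rewrite eq_le measure_ge0 andbT -muC le_measure// inE.
  exact: measurableD.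
exact: measurableC.
Qed.

Lemma nsq_indc (D : set T) : measurable D -> nsq mu (indc D) = fine (mu D).
Proof.
move=> mD; rewrite -mu_circI// -(cint_ind mu mD); apply: cint_ext => z _.
by rewrite indcE indicE; case: (_ \in _); rewrite ?cabs1 ?cabs0 ?expr1n ?expr0n.
Qed.

Lemma ci_indc (D : set T) : measurable D ->
  circle_integral mu (indc D) = real_complex R (fine (mu D)).
Proof.
move=> mD; rewrite ciE; apply: cplx_eq => /=.
  by rewrite -(mu_circI mD); exact: cint_ind.
by rewrite cint_cst mul0r.
Qed.

Lemma mu_fineK (D : set T) : measurable D -> (fine (mu D))%:E = mu D.
Proof. by move=> mD; rewrite fineK// fin_num_measure. Qed.

Definition disc (l : C) (r : R) : set T := [set z : C | cabs (l - z) < r].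

Lemma open_disc l r : open (disc l r : set C).
Proof.
rewrite openE => z /= zr; rewrite /disc /= in zr.
have r0 : 0 < r - cabs (l - z) by rewrite subr_gt0.
apply: filterS (nbhs_cplx z r0) => t /= zt; rewrite /disc /=.
have -> : l - t = (l - z) + (z - t) by rewrite addrA subrK.
by apply: le_lt_trans (cabsD _ _) _; lra.
Qed.

Lemma measurable_disc l r : measurable (disc l r).
Proof. exact: open_measurable_cplx (@open_disc l r). Qed.

(** The function h, equal to l - z off W and to 1 on W, stays at distance min r 1 from 0, so it has
    a bounded inverse, which is then cut off on W. *)
Lemma cB_reciprocal (l : C) (W : set T) (r : R) : measurable W -> 0 < r ->
  disc l r `<=` W -> exists2 g, cB g & forall z, g z * (l - z) = indc (~` W) z.
Proof.
move=> mW r0 rW; have mWc := measurableC mW.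
have blz : cB (fun z : C => l - z) by exact: cBB (cB_cst l) bz.
pose h z : C := indc (~` W) z * (l - z) + indc W z.
have bh : cB h by apply: cBD; [apply: cBM blz; exact: cB_indc|exact: cB_indc].
have hr : 0 < Num.min r 1 by rewrite lt_min r0 ltr01.
have bih : cB (fun z => (h z)^-1).
  apply: (cB_inv hr bh) => z _; rewrite /h !indcE in_setC.
  case: (boolP (z \in W)) => [_|zW] /=.
    by rewrite mul0r add0r cabs1 ge_min lexx orbT.
  rewrite mul1r addr0 ge_min; apply/orP; left; rewrite leNgt; apply/negP => lr.
  by move/negP: zW; apply; rewrite inE; exact: rW.
exists (fun z => indc (~` W) z * (h z)^-1); first by apply: cBM bih; exact: cB_indc.
move=> z; rewrite /h !indcE in_setC; case: (boolP (z \in W)) => [_|zW] /=.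
  by rewrite !mul0r.
have z0 : l - z != 0.
  rewrite subr_eq0; apply/eqP => lz; move/negP: zW; apply; rewrite inE; apply: rW.
  by rewrite /disc /= lz subrr cabs0.
by rewrite !mul1r addr0 mulVf.
Qed.

(** On the support, indicators of small discs are approximate eigenvectors. Off it, 1 / (l - z) cut
    off on a null neighbourhood is a bounded multiplier that inverts l - V almost everywhere. *)
Lemma support_spectrum : msupport mu = spectrum V.
Proof.
apply/seteqP; split => l; rewrite /spectrum /msupport /=.
  move=> supp [S]; rewrite mul_op_resolvent => -[/bounded_opP[D hS] _ SM].
  have [D0 _ SD] := hS.
  (* For an inverse with bound D, radius 1 / (D + 1) makes D r < 1: l - V shrinks the indicator of
     the disc by a factor r, and the inverse cannot make up for it. *)
  pose r := (D + 1)^-1.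
  have D1 : 0 < D + 1 by rewrite ltr_wpDl.
  have r0 : 0 < r by rewrite invr_gt0.
  have mB := measurable_disc l r.
  have muB : (0 < mu (disc l r))%E.
    by apply: (supp (disc l r)); [exact: open_disc|rewrite /disc /= subrr cabs0].
  have bf := cB_indc mB.
  have blz : cB (fun z : C => l - z) by exact: cBB (cB_cst l) bz.
  have n0 : 0 < nrm2 (U (indc (disc l r))).
    by rewrite (Upars bf) nsq_indc// -lte_fin mu_fineK.
  have n1 : nrm2 (M (fun z => l - z) (U (indc (disc l r)))) <= r ^+ 2 * nrm2 (U (indc (disc l r))).
    rewrite (MU blz bf) (Upars (cBM blz bf)) (Upars bf).
    pose f z := indc (disc l r) z * (l - z).
    rewrite -(cintZ mufin); last exact: bB_cabs2.
    apply: (cint_le mufin).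
    - by apply: bB_cabs2; exact: cBM.
    - by apply: bBZ; exact: bB_cabs2.
    move=> z _; have [zr|zr] := pselect (disc l r z).
      rewrite indc1// mulr1 cabs1 expr1n mulr1.
      by rewrite lerXn2r ?nnegrE ?cabs_ge0// ltW.
    by rewrite indc0// mulr0 cabs0 expr0n mulr0.
  have E : S (M (fun z => l - z) (U (indc (disc l r)))) = U (indc (disc l r)).
    exact: (congr1 (fun f => f (U (indc (disc l r)))) SM).
  have := SD (M (fun z => l - z) (U (indc (disc l r)))); rewrite E => n2.
  have r2 : D ^+ 2 * r ^+ 2 < 1.
    rewrite -exprMn expr_lt1//; last by rewrite mulr_ge0// ltW.
    by rewrite /r ltr_pdivrMr// mul1r ltrDl.
  move: n0 n1 n2; move: (nrm2 _) (nrm2 _) => p q n0 n1 n2.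
  have := ler_wpM2l (sqr_ge0 D) n1; nra.
move=> nS W oW Wl; rewrite lt_neqAle measure_ge0 andbT; apply/eqP => /esym muW.
apply: nS; rewrite mul_op_resolvent.
have mW := open_measurable_cplx oW.
have [e e0 He] : exists2 e : R, 0 < e & disc l e `<=` W.
  have /nbhs_ballP[e /= e0 He] : nbhs l W by exact: open_nbhs_nbhs.
  exists (complex.Re e); first by move: e0; rewrite ltcE => /andP[].
  by move=> t zt; apply: He; rewrite -ball_normE /= norm_lt_toC.
(* Since W is null, g (l - z) = 1 almost everywhere, which is equality of operators by
   [mul_op_ae]. *)
have [g bg gE] := cB_reciprocal mW e0 He.
have blz : cB (fun z : C => l - z) by exact: cBB (cB_cst l) bz.
have M1 : M (indc (~` W)) = idfun.
  rewrite -(mul_op1 alpha_disk mu1 phi_orf).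
  apply: (mul_op_ae alpha_disk mu1 phi_orf _ (cB_cst 1) mW muW).
    by apply: cB_indc; exact: measurableC.
  by move=> z _ nWz; rewrite indcE mem_set.
exists (M g); split.
- by apply/bounded_opP; exact: Mopb.
- rewrite (MM blz bg) -M1; apply: mul_op_ext => z _.
  by rewrite mulrC gE.
- by rewrite (MM bg blz) -M1; apply: mul_op_ext => z _; rewrite gE.
Qed.

(** The matrix of this projection has rank one, with entries conj phi_k(l) phi_n(l) mu({l}); as
    phi_0 = 1, row k is conj phi_k(l) times row 0. *)
Lemma mul_op_point (l : C) x k :
  M (indc [set l]) x k = (phi k l)^* * M (indc [set l]) x 0%N.
Proof.
have ml := measurable_point l; have bl := cB_indc ml.
have [B B0 gB] := cB_bound bl.
have bound := mul_op_bound alpha_disk mu1 phi_orf bl gB.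
have cE j n : coef mu phi (fun z => indc [set l] z * phi n z) j =
    (phi j l)^* * (phi n l * real_complex R (fine (mu [set l]))).
  rewrite mulrA -ci_indc// -(ciZ mufin)//; apply: ci_ext => z _.
  rewrite indcE; case: (boolP (z \in [set l])) => [|_].
    by rewrite inE /= => ->; rewrite mul1r mulr1.
  by rewrite mul0r !mulr0.
have cv j := @matrix_op_cvg _ _ _ bound x j.
rewrite mul_opE; apply: (cplx_cvg_unique (cv k)).
have c0 := cv 0%N.
have -> : (fun N => \sum_(0 <= n < N) coef mu phi (fun z => indc [set l] z * phi n z) k * x n) =
   (fun N => (phi k l)^* *
     \sum_(0 <= n < N) coef mu phi (fun z => indc [set l] z * phi n z) 0%N * x n).
  apply/funext => N; rewrite mulr_sumr; apply: eq_bigr => n _.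
  by rewrite !cE (orf0 phi_orf) conjC1 mul1r -!mulrA.
exact: (cvgM (@cvg_cst _ _ _ _ _) c0).
Qed.

(** Outside a disc around l, the factor l - z can be divided out, so (l - V) x = 0 kills the part of
    x living there. Shrinking the discs leaves only the part at the point l, for an arbitrary x in
    [l2]. *)
Lemma eigen_point (l : C) x : V x = l *: x -> x = M (indc [set l]) x.
Proof.
move=> Vx; have ml := measurable_point l.
have blz : cB (fun z : C => l - z) by exact: cBB (cB_cst l) bz.
have Mx0 : M (fun z => l - z) x = 0.
  rewrite -mul_op_resolvent; apply: l2_eq => k.
  have -> : (((fun x : l2 => l *: x) - V) x) k = l * x k - V x k by [].
  by rewrite Vx; exact: subrr.
pose W n := disc l n.+1%:R^-1.
have mW n : measurable (W n) by exact: measurable_disc.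
have W0 n : M (indc (~` W n)) x = 0.
  have r0 : 0 < n.+1%:R^-1 :> R by rewrite invr_gt0 ltr0n.
  have [g bg gE] := cB_reciprocal (mW n) r0 (fun z h => h).
  have -> : M (indc (~` W n)) = M g \o M (fun z => l - z).
    by rewrite (MM bg blz); apply: mul_op_ext => z _; rewrite gE.
  have [B hB] := Mopb bg.
  apply: etrans (congr1 (M g) Mx0) _; exact: opb0 hB.
have bW n : cB (indc (~` W n)) by apply: cB_indc; exact: measurableC.
have bl' : cB (indc (~` [set l])) by apply: cB_indc; exact: measurableC.
have L0 : M (indc (~` [set l])) x = 0.
  apply: l2_eq => k.
  have cv : (fun n => M (indc (~` W n)) x k) @ \oo --> M (indc (~` [set l])) x k.
    apply: (@mul_op_cvg _ _ alpha_disk alpha_compact _ _ mu1 hw nlog _ _ phi_orf _ _ 2 x k bW bl').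
      move=> n z _; apply: (le_trans (cabsD _ _)); rewrite cabsN !indcE.
      by case: (_ \in _); case: (_ \in _); rewrite ?cabs1 ?cabs0; lra.
    move=> z _; have [->|zl] := eqVneq z l.
      have -> : (fun n => cabs (indc (~` [set l]) l - indc (~` W n) l)) = (fun=> 0);
        last exact: cvg_cst.
      apply/funext => n; rewrite indc0; last by move=> h; apply: h.
      rewrite indc0 ?subrr ?cabs0// => h; apply: h.
      by rewrite /W /disc /= subrr cabs0 invr_gt0 ltr0n.
    apply: cvg_near_cst.
    have d0 : 0 < cabs (l - z) by rewrite cabs_gt0 subr_eq0 eq_sym.
    have [N hN] : exists N : nat, (cabs (l - z))^-1 <= N%:R.
      by exists (Num.bound (cabs (l - z))^-1); rewrite ltW// archi_boundP// invr_ge0 cabs_ge0.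
    exists N => // n Nn; rewrite indc1; last by apply/eqP.
    rewrite indc1 ?subrr ?cabs0// /W /disc /=; apply/negP.
    rewrite -leNgt invf_ple ?posrE ?ltr0n//.
    by rewrite (le_trans hN)// ler_nat (leq_trans Nn).
  have cv0 : (fun n => M (indc (~` W n)) x k) @ \oo --> (0 : C).
    have -> : (fun n => M (indc (~` W n)) x k) = (fun=> 0); last exact: cvg_cst.
    by apply/funext => n; rewrite W0.
  exact: (cplx_cvg_unique cv cv0).
have bl := cB_indc ml.
have E1 : M (fun z => 1 * indc [set l] z + indc (~` [set l]) z) = idfun.
  rewrite -(mul_op1 alpha_disk mu1 phi_orf); apply: mul_op_ext => z _.
  by rewrite mul1r !indcE in_setC; case: (_ \in _); rewrite /= ?addr0 ?add0r.
have := mul_op_lin alpha_disk mu1 phi_orf 1 bl bl' x.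
rewrite E1 L0 => E; apply: l2_eq => k.
apply: etrans (congr1 (fun y : l2 => y k) E) _.
have -> : (1 *: M (indc [set l]) x + 0 : l2) k = 1 * M (indc [set l]) x k + 0 by [].
by rewrite mul1r addr0.
Qed.

Lemma eigen_coord (l : C) x k : V x = l *: x -> x k = (phi k l)^* * x 0%N.
Proof. by move=> Vx; rewrite {1}(eigen_point Vx) mul_op_point -(eigen_point Vx). Qed.

Lemma eigen_mass (l : C) x : V x = l *: x -> x != 0 -> (0 < mu [set l])%E.
Proof.
move=> Vx x0; rewrite lt_neqAle measure_ge0 andbT; apply/eqP => /esym mul0.
move/eqP: x0; apply; rewrite (eigen_point Vx).
have ml := measurable_point l; have bl := cB_indc ml.
have -> : M (indc [set l]) = M (fun=> 0).
  apply: (mul_op_ae alpha_disk mu1 phi_orf bl (cB_cst 0) ml mul0) => z _ zl.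
  by rewrite indcE memNset.
have b0 := cB_cst 0 : cB (fun=> 0 : C).
have [B hB] := Mopb b0.
have E : M (fun=> 0) = (fun y => 0 *: idfun y).
  apply: (opb_ext hB (opb_scale 0 (@opb_id R))) => n.
  apply: etrans (mul_op_unit alpha_disk mu1 phi_orf n b0) _.
  apply: etrans (UZ 0 (bphi n)) _; rewrite !scale0r; by [].
by rewrite E scale0r.
Qed.

(** With m = mu({l}), the indicator of the point has coordinates m conj phi_n(l) and squared norm m;
    dividing by m gives the vector, of squared norm 1 / m. *)
Lemma mass_vector (l : C) : (0 < mu [set l])%E -> exists v : l2,
  [/\ forall n, v n = (phi n l)^*, V v = l *: v & (nrm2 v)^-1 = fine (mu [set l])].
Proof.
move=> mul; have ml := measurable_point l; have bl := cB_indc ml.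
set m := fine (mu [set l]).
have m0 : 0 < m by rewrite -lte_fin mu_fineK.
pose y := U (indc [set l]).
have yE k : y k = (phi k l)^* * real_complex R m.
  rewrite /y UE// /coef -ci_indc// -(ciZ mufin)//; apply: ci_ext => z _.
  rewrite indcE; case: (boolP (z \in [set l])) => [|_]; last by rewrite !mulr0.
  by rewrite inE /= => ->.
have Vy : V y = l *: y.
  rewrite /y (MU bz bl) -(UZ l bl); apply: orfT_ext => z _.
  rewrite indcE; case: (boolP (z \in [set l])) => [|_]; last by rewrite !mulr0.
  by rewrite inE /= => ->.
have ny : nrm2 y = m by rewrite /y (Upars bl) nsq_indc.
pose c : C := real_complex R m^-1.
have [B hB] := Mopb bz.
exists (c *: y); split.
- move=> n; have -> : (c *: y : l2) n = c * y n by [].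
  by rewrite yE mulrCA /c -toCM mulVf ?gt_eqF// mulr1.
- by rewrite (opbZ hB) Vy !scalerA mulrC.
- rewrite nrm2Z ny cabs_toC ger0_norm ?invr_ge0 ?(ltW m0)//.
  by rewrite expr2 -mulrA mulVf ?gt_eqF// mulr1 invrK.
Qed.

Lemma sq_sum_conj (u v : nat -> C) : (forall n, u n = (v n)^*) -> sq_sum u = sq_sum v.
Proof. by move=> uv; apply: eq_eseriesr => n _; rewrite uv cabs_conj. Qed.

Lemma mass_sq_summable (l : C) : (0 < mu [set l])%E -> sq_summable (fun n => phi n l).
Proof.
move=> /mass_vector[v [vE _ _]].
by rewrite /sq_summable -(sq_sum_conj vE); exact: l2_summable.
Qed.

Lemma mass_formula (l : C) : (0 < mu [set l])%E ->
  mu [set l] = ((sq_sum (fun n => phi n l))^-1)%E.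
Proof.
move=> mul; have [v [vE _ nv]] := mass_vector mul.
(* The extended inverse treats 0 separately; it is excluded because the mass would vanish. *)
rewrite -(sq_sum_conj vE) -nrm2E inver -(mu_fineK (measurable_point l)) -nv ifF//.
apply/eqP => n0; move: mul; rewrite -(mu_fineK (measurable_point l)) -nv n0 invr0.
by rewrite ltxx.
Qed.

Lemma mass_eigenspace (l : C) (v : l2) : (forall n, v n = (phi n l)^*) -> V v = l *: v ->
  op_eigenspace V l = spanned_line v.
Proof.
move=> vE Vv; have [B hB] := Mopb bz.
apply/seteqP; split => x; rewrite /op_eigenspace /spanned_line /=.
  move=> Vx; exists (x 0%N); apply: l2_eq => k.
  rewrite [RHS](_ : _ = x 0%N * v k)// vE mulrC; exact: eigen_coord.
by move=> [c ->]; rewrite (opbZ hB) Vv !scalerA mulrC.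
Qed.

Lemma vector_neq0 (l : C) (v : l2) : (forall n, v n = (phi n l)^*) -> v != 0.
Proof.
move=> vE; apply/eqP => v0; have := vE 0%N; rewrite v0 (orf0 phi_orf) conjC1.
by move=> /esym/eqP; rewrite oner_eq0.
Qed.

Lemma sq_summable_mass (l : C) : (forall n, ~ is_pole (phi n) l) ->
  sq_summable (fun n => phi n l) -> (0 < mu [set l])%E.
Proof.
move=> np sl.
have vl := not_pole_varpi alpha0 alpha_disk mu1 phi_orf np.
have sv : (fun n => (phi n l)^*) \in @sq_summable_pred R.
  apply: l2_mem; rewrite /sq_summable (@sq_sum_conj _ (fun n => phi n l))//.
pose v : l2 := L2 sv.
have vE n : v n = (phi n l)^* by [].
have dotv c N : l2dot v (fvec c N) = orf_sum phi c N l.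
  rewrite /fvec /orf_sum; elim: N => [|N IH]; first by rewrite !big_geq// dot0r.
  rewrite !big_nat_recr//= dotDr IH dotZr; congr (_ + _ * _).
  by rewrite -dot_conj dot_unit vE conjCK.
have hH : opb 1 (matrix_op (hessenberg a)).
  apply: (matrix_op_opb ler01).
  exact: hessenberg_contraction (orf_a0 phi_orf) (orf_a1 phi_orf).
(* The bounded sequence [v] makes the recurrence a left eigenvalue equation for [V];
   [V] being unitary, [v] is then an eigenvector and [|l| = 1]. *)
have lefteig x : l2dot v (V x) = l * l2dot v x.
  rewrite -(mobius_orf alpha_disk alpha_compact mu1 phi_orf).
  apply: (mobius_left_eigen alpha_disk alpha_compact hH) => n.
  rewrite (den_vec alpha_disk alpha_compact phi_orf) (num_vec alpha_disk alpha_compact phi_orf).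
  rewrite !dotv; apply: orf_sum_recurrence.
  by apply: (orf_recurrence_ext alpha_disk phi_orf) => k _.
have bz' := cB_conj bz.
have VV' x : V (M (fun z => z^*) x) = x.
  have := MM bz bz'; have -> : M (fun z => z * z^*) = idfun.
    rewrite -(mul_op1 alpha_disk mu1 phi_orf); apply: mul_op_ext => z cz.
    by rewrite mulrC circ_conjM.
  by move/(congr1 (fun f => f x)).
have V'V x : M (fun z => z^*) (V x) = x.
  have := MM bz' bz; have -> : M (fun z => z^* * z) = idfun.
    rewrite -(mul_op1 alpha_disk mu1 phi_orf); apply: mul_op_ext => z cz.
    by rewrite circ_conjM.
  by move/(congr1 (fun f => f x)).
(* Substituting x = V^-1 y in the left eigenvalue equation gives l <v, V^-1 y> = <v, y> for all y,
   where V^-1 is the adjoint. *)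
have vV : v = l^* *: V v.
  apply/eqP; rewrite -subr_eq0; apply/eqP; apply: dot_eq0 => y.
  rewrite -dot_conj dotBl dotZl conjCK (Madj bz).
  by rewrite -lefteig VV' subrr conjC0.
have nV : nrm2 (V v) = nrm2 v.
  by have := Madj bz v (V v); rewrite V'V !dot_self => -[].
have v0 := vector_neq0 vE.
have nv := nrm2_gt0 v0.
have l1 : l * l^* = 1.
  have := congr1 nrm2 vV; rewrite nrm2Z nV cabs_conj => h.
  have {}h : cabs l ^+ 2 = 1.
    by apply: (mulIf (lt0r_neq0 nv)); rewrite -h mul1r.
  by rewrite mulrC conjM_cabs h.
apply: (eigen_mass _ v0).
by rewrite {2}vV scalerA l1 scale1r.
Qed.

End spectral_theory.

(** * Uniqueness of the spectral measure *)

Section bounded_functionals.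
Context {R : realType}.
Local Notation C := (cplx R).
Local Notation T := (borel_cplx R).
Local Notation circ := (@unit_circle R : set (borel_cplx R)).
Implicit Types (L : (C -> C) -> C) (f g : C -> C).

(** Integration against a complex measure on the circle, reduced to what is needed of it: locality
    on the circle, linearity, dominated convergence. The polarized forms <x, E y> are handled this
    way, with no complex measure to construct. *)
Definition bfunctional L : Prop :=
  [/\ forall f g, (forall z, circ z -> f z = g z) -> L f = L g,
      forall c f g, cB f -> cB g -> L (fun z => c * f z + g z) = c * L f + L g &
      forall (f : nat -> C -> C) g M, (forall n, cB (f n)) ->
        (forall n z, circ z -> cabs (f n z) <= M) ->
        (forall z, circ z -> f n z @[n --> \oo] --> g z) ->
        L (f n) @[n --> \oo] --> L g].

(** Real functions follow from [bB_rect], and the real and imaginary parts are recombined by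
    linearity. *)
Lemma bfunctional_uniq L1 L2 : bfunctional L1 -> bfunctional L2 ->
  (forall D : set T, measurable D -> L1 (indc D) = L2 (indc D)) ->
  forall f, cB f -> L1 f = L2 f.
Proof.
move=> [ext1 lin1 lim1] [ext2 lin2 lim2] ind.
have real (f : C -> R) : bB f ->
    L1 (fun z => real_complex R (f z)) = L2 (fun z => real_complex R (f z)).
  move: f; apply: bB_rect.
  - move=> f g fg.
    have e z : circ z -> real_complex R (f z) = real_complex R (g z) by move=> cz; rewrite fg.
    by rewrite -(ext1 _ _ e) -(ext2 _ _ e).
  - exact: ind.
  - move=> r f g bf bg f12 g12.
    have cf := cB_toC bf; have cg := cB_toC bg.
    have e z : circ z -> real_complex R r * real_complex R (f z) + real_complex R (g z) =
      real_complex R (r * f z + g z) by rewrite toCD toCM.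
    by rewrite -(ext1 _ _ e) -(ext2 _ _ e) lin1// lin2// f12 g12.
  - move=> f g M bf f12 fM fg.
    have cf n := cB_toC (bf n).
    have h1 n z : circ z -> cabs (real_complex R (f n z)) <= M.
      by move=> cz; rewrite cabs_toC fM.
    have h2 z : circ z -> real_complex R (f n z) @[n --> \oo] --> (real_complex R (g z) : C).
      by move=> cz; apply: cvg_cplx => /=; [exact: fg|exact: cvg_cst].
    have c1 := @lim1 _ (fun z => real_complex R (g z)) M cf h1 h2.
    have c2 := @lim2 _ (fun z => real_complex R (g z)) M cf h1 h2.
    apply: (cplx_cvg_unique c1).
    by have -> : (fun n => L1 (fun z => real_complex R (f n z))) =
      (fun n => L2 (fun z => real_complex R (f n z))) by apply/funext.
move=> f [bre bim].
have e z : circ z -> (Complex 0 1 : C) * real_complex R (complex.Im (f z)) +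
    real_complex R (complex.Re (f z)) = f z.
  by move=> _; apply: cplx_eq; rewrite ?ReD ?ImD ?ReM ?ImM /=; ring.
rewrite -(ext1 _ _ e) -(ext2 _ _ e).
by rewrite lin1 ?lin2 ?real//; exact: cB_toC.
Qed.

Lemma bfunctional_ci (m : {measure set T -> \bar R}) : (m circ < +oo)%E ->
  bfunctional (circle_integral m).
Proof.
move=> mfin; split=> [f g|c f g bf bg|f g M bf fM fg].
- exact: ci_ext.
- by rewrite ciD ?ciZ//; apply: cBM => //; exact: cB_cst.
- apply: cvg_cplx => /=.
    apply: (@cint_cvg _ m mfin (fun n z => complex.Re (f n z)) _ M).
    + by move=> n; case: (bf n).
    + by move=> n z cz; apply: le_trans (Re_le_cabs _) (fM n z cz).
    + by move=> z cz; apply: cvg_Re; exact: fg.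
  apply: (@cint_cvg _ m mfin (fun n z => complex.Im (f n z)) _ M).
  + by move=> n; case: (bf n).
  + by move=> n z cz; apply: le_trans (Im_le_cabs _) (fM n z cz).
  + by move=> z cz; apply: cvg_Im; exact: fg.
Qed.

Lemma bfunctionalD L1 L2 : bfunctional L1 -> bfunctional L2 ->
  bfunctional (fun f => L1 f + L2 f).
Proof.
move=> [ext1 lin1 lim1] [ext2 lin2 lim2]; split=> [f g fg|c f g bf bg|f g M bf fM fg].
- by rewrite (ext1 _ _ fg) (ext2 _ _ fg).
- by rewrite lin1// lin2//; ring.
- exact: (cvgD (@lim1 _ _ _ bf fM fg) (@lim2 _ _ _ bf fM fg)).
Qed.

Lemma bfunctionalZ a L : bfunctional L -> bfunctional (fun f => a * L f).
Proof.
move=> [ext lin lim]; split=> [f g fg|c f g bf bg|f g M bf fM fg].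
- by rewrite (ext _ _ fg).
- by rewrite lin//; ring.
- exact: (cvgM (@cvg_cst _ _ _ _ _) (@lim _ _ _ bf fM fg)).
Qed.

Lemma bfunctionalM h L : cB h -> bfunctional L -> bfunctional (fun f => L (fun z => f z * h z)).
Proof.
move=> bh [ext lin lim]; split=> [f g fg|c f g bf bg|f g M bf fM fg].
- by apply: ext => z cz; rewrite fg.
- rewrite -lin; [|exact: cBM|exact: cBM].
  by apply: ext => z _; rewrite mulrDl mulrA.
- have [B B0 hB] := cB_bound bh.
  apply: (lim _ _ (M * B)) => [n|n z cz|z cz].
  + exact: cBM.
  + by rewrite cabsM ler_pM ?cabs_ge0 ?fM ?hB.
  + by apply: cvgM; [exact: fg|exact: cvg_cst].
Qed.

End bounded_functionals.

(** * Polarized spectral integrals *)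

Section spectral_measure.
Context {R : realType}.
Local Notation C := (cplx R).
Local Notation T := (borel_cplx R).
Local Notation l2 := (l2 R).
Local Notation circ := (@unit_circle R : set (borel_cplx R)).
Local Notation ii := (Complex 0 1 : C).

(** Polarization: a quarter of the sum of conj c q(x + c y) over the fourth roots of unity c. Signs
    are written as scalar factors so that [bfunctionalZ] and [bfunctionalD] apply term by term. *)
Definition polar (q : l2 -> C) (x y : l2) : C :=
  4%:R^-1 * (q (x + y) + (-1) * q (x + (-1) *: y)
    + ((- ii) * q (x + ii *: y) + ii * q (x + (- ii) *: y))).

Lemma polar_dot (A : l2 -> l2) x y : linear A ->
  polar (fun u => l2dot u (A u)) x y = l2dot x (A y).
Proof.
move=> linA.
have qE c : l2dot (x + c *: y) (A (x + c *: y)) = l2dot x (A x) + c * l2dot x (A y)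
    + (c^* * l2dot y (A x) + c^* * c * l2dot y (A y)).
  have -> : A (x + c *: y) = c *: A y + A x by rewrite addrC linA.
  rewrite dotDr !dotDl !dotZr !dotZl.
  by move: (l2dot x _) (l2dot x _) (l2dot y _) (l2dot y _) => *; ring.
have i2 : ii * ii = -1 by apply: cplx_eq; rewrite ?ReM ?ImM /=; ring.
have ci : ii^* = - ii by apply: cplx_eq; rewrite ?Re_conj ?Im_conj /= ?oppr0.
rewrite /polar -{1 2}(scale1r y) !qE !conjN conjC1 ci opprK.
move: (l2dot x _) (l2dot x _) (l2dot y _) (l2dot y _) => s p r t.
move: ii i2 => i i2.
transitivity (4%:R^-1 * (2 * s + 2 * t - 2 * (i * i) * s + 2 * (i * i) * t)).
  by ring.
by rewrite i2; field.
Qed.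

Context (V W : l2 -> l2) (B : R) (hV : opb B V)
  (VW : forall x y, l2dot x (V y) = l2dot (W x) y).
Context (E : set T -> l2 -> l2) (hE : is_spectral_measure V E).

Let Emeas x : exists nu : {measure set T -> \bar R},
  (forall D, measurable D ->
     nu D \is a fin_num /\ l2dot x (E D x) = real_complex R (fine (nu D))) /\
  l2dot x (V x) = circle_integral nu idfun.
Proof. by case: hE. Qed.

Definition nu x : {measure set T -> \bar R} := projT1 (cid (Emeas x)).

Lemma nuP x D : measurable D -> l2dot x (E D x) = real_complex R (fine (nu x D)).
Proof. by move=> mD; rewrite /nu; case: cid => m /= [/(_ D mD)[]]. Qed.

Lemma nu_id x : l2dot x (V x) = circle_integral (nu x) idfun.
Proof. by rewrite /nu; case: cid => m /= []. Qed.

Lemma nu_fin x : (nu x circ < +oo)%E.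
Proof.
rewrite /nu; case: cid => m /= [/(_ _ (@measurable_circ R))[h _] _].
by move: h; rewrite fin_numE ltey => /andP[].
Qed.

Lemma E_linear D : measurable D -> linear (E D).
Proof. by case: hE => h _ _ _ /h[[]]. Qed.

(** [circle_integral] sees only the circle; multiplicativity and the value of E on the circle reduce
    D to its trace there. *)
Lemma nu_circ x D : measurable D -> l2dot x (E D x) = circle_integral (nu x) (indc D).
Proof.
move=> mD; have mc := @measurable_circ R; have [_ E1 EI _] := hE.
have -> : E D = E (D `&` circ) by rewrite EI// E1.
rewrite (nuP x (measurableI _ _ mD mc)) ciE; apply: cplx_eq => /=.
  by rewrite cint_ind.
by rewrite cint_cst mul0r.
Qed.

(* [<x, (\int g dE) y>], by polarization. *)
Definition pint g x y : C := polar (fun u => circle_integral (nu u) g) x y.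

Lemma pint_bfunctional x y : bfunctional (fun g => pint g x y).
Proof.
have h u := bfunctional_ci (nu_fin u).
apply: bfunctionalZ; apply: bfunctionalD; apply: bfunctionalD => //;
  by apply: bfunctionalZ.
Qed.

Lemma pint_indc D x y : measurable D -> pint (indc D) x y = l2dot x (E D y).
Proof.
move=> mD; rewrite -(polar_dot x y (E_linear mD)); congr polar.
by apply/funext => u; rewrite nu_circ.
Qed.

Lemma pint_id x y : pint idfun x y = l2dot x (V y).
Proof.
have [_ linV _] := hV; rewrite -(polar_dot x y linV); congr polar.
by apply/funext => u; rewrite nu_id.
Qed.

(** On the diagonal the polarized integral gives back the measure: both functionals take the value
    <x, E(D) x> on indicators. *)
Lemma pint_self g x : cB g -> pint g x x = circle_integral (nu x) g.
Proof.
apply: (bfunctional_uniq (pint_bfunctional x x) (bfunctional_ci (nu_fin x))).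
by move=> D mD; rewrite pint_indc// nu_circ.
Qed.

(** If S is the integral of f dE, then S V is that of z f. Moving S to the left through S' lets
    [pint_id] turn V into the integral of z; the two functionals of g then need only agree on
    indicators. *)
Lemma pint_comp S S' f : cB f -> (forall x y, l2dot x (S y) = pint f x y) ->
  (forall x y, l2dot x (S y) = l2dot (S' x) y) ->
  forall x y, l2dot x (S (V y)) = pint (fun z => z * f z) x y.
Proof.
move=> bf Sf SS' x y; have [_ _ EI _] := hE.
(* The case of E(D) in place of V. By uniqueness in f it is enough to take f the indicator of D',
   where it is E(D') E(D) = E(D' [&] D). *)
have SE D u v : measurable D -> l2dot u (S (E D v)) = pint (fun z => indc D z * f z) u v.
  move=> mD; rewrite Sf; have bD := cB_indc mD.
  have bM := bfunctionalM bD (pint_bfunctional u v).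
  rewrite (bfunctional_uniq (pint_bfunctional u (E D v)) bM _ bf) => [|D' mD'].
    by case: (pint_bfunctional u v) => ext _ _; apply: ext => z _; rewrite mulrC.
  rewrite pint_indc//.
  have -> : (fun z => indc D' z * indc D z) = indc (D' `&` D).
    by apply/funext => z; rewrite !indcE in_setI; do 2![case: (_ \in _)]; rewrite ?mulr1 ?mulr0.
  by rewrite pint_indc ?EI//; exact: measurableI.
rewrite SS' -pint_id.
have bM := bfunctionalM bf (pint_bfunctional x y).
apply: (bfunctional_uniq (pint_bfunctional _ _) bM _ (@cB_id R)) => D mD.
by rewrite pint_indc// -SS' SE.
Qed.

Lemma pint_power k x y : l2dot x (iter k V y) = pint (fun z => z ^+ k) x y.
Proof.
elim: k x y => [|k IH] x y.
  have [_ E1 _ _] := hE; rewrite /= -[y in LHS]/(idfun y) -E1.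
  rewrite -pint_indc; last exact: measurable_circ.
  case: (pint_bfunctional x y) => ext _ _; apply: ext => z cz.
  by rewrite indc1.
have bk : cB (fun z : C => z ^+ k) by exact: cBX (@cB_id R).
have adj u v : l2dot u (iter k V v) = l2dot (iter k W u) v.
  by elim: (k) u v => [//|j IHj] u v; rewrite iterSr IHj /= VW.
rewrite iterSr (pint_comp bk IH adj).
by case: (pint_bfunctional x y) => ext _ _; apply: ext => z _; rewrite exprS.
Qed.

(** Moments of order k >= 0 suffice: both measures being positive, they give equal integrals to real
    parts of polynomials, hence to everything in [bcl], indicators included. *)
Lemma spectral_measure_uniq (mu : {measure set T -> \bar R}) x :
  (mu circ < +oo)%E ->
  (forall k, l2dot x (iter k V x) = circle_integral mu (fun z => z ^+ k)) ->
  forall D, measurable D -> l2dot x (E D x) = circle_integral mu (indc D).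
Proof.
move=> mufin mom D mD; rewrite nu_circ//.
have nufin := nu_fin x.
have poly (p : {poly C}) : circle_integral (nu x) (fun z => p.[z]) =
    circle_integral mu (fun z => p.[z]).
  have e (m : {measure set T -> \bar R}) : (m circ < +oo)%E ->
      circle_integral m (fun z => p.[z]) =
      \sum_(i < size p) p`_i * circle_integral m (fun z => z ^+ i).
    move=> mfin; have -> : (fun z : C => p.[z]) = (fun z => \sum_(i < size p) p`_i * z ^+ i).
      by apply/funext => z; rewrite horner_coef.
    rewrite ci_sum//=; last by move=> i; apply: cBM; [exact: cB_cst|exact: cBX (@cB_id R)].
    by apply: eq_bigr => i _; rewrite ciZ//; exact: cBX (@cB_id R).
  rewrite !e//; apply: eq_bigr => i _; congr (_ * _).
  by rewrite -mom pint_power pint_self//; exact: cBX (@cB_id R).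
have real (f : C -> R) : bcl f -> cint (nu x) f = cint mu f.
  elim=> [p|{}f g M bf IH fM fg]; first by have := poly p; rewrite !ciE => -[].
  have bb n := bcl_bB (bf n).
  apply: (real_cvg_unique (@cint_cvg _ _ nufin _ _ _ bb fM fg)).
  have -> : (fun n => cint (nu x) (f n)) = (fun n => cint mu (f n)) by apply/funext.
  exact: (@cint_cvg _ _ mufin _ _ _ bb fM fg).
rewrite !ciE; congr Complex; last by rewrite !cint_cst !mul0r.
by apply: real; apply: bB_bcl; exact: bB_ind.
Qed.

End spectral_measure.

Section moments.
Context {R : realType}.
Local Notation C := (cplx R).
Local Notation T := (borel_cplx R).
Local Notation l2 := (l2 R).
Local Notation circ := (@unit_circle R : set (borel_cplx R)).
Context (alpha : nat -> C) (alpha_disk : forall n, `|alpha n| < 1)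
  (alpha_compact : sup (range (fun n => cabs (alpha n))) < 1).
Context (mu : probability T R) (w : C -> R).
Context (mu1 : mu circ = 1%E) (hw : ac_density mu w) (nlog : ~ log_integrable w).
Context (phi : nat -> C -> C) (a : nat -> C) (phi_orf : is_orf mu alpha phi a).

(** As phi_0 = 1, the unit vector 0 is the transform of the constant 1, so V^k sends it to the
    transform of z^k, whose coordinate 0 is the plain integral. *)
Lemma mul_op_moment k :
  l2dot (unit_vector 0) (iter k (mul_op mu phi (fun z => z)) (unit_vector 0)) =
    circle_integral mu (fun z => z ^+ k).
Proof.
have bX j : cB (fun z : C => z ^+ j) by exact: cBX (@cB_id R).
have -> : iter k (mul_op mu phi (fun z => z)) (unit_vector 0) = orfT mu phi (fun z => z ^+ k).
  elim: k => [|k IH] /=.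
    rewrite -(orfT_orf alpha_disk mu1 phi_orf); apply: orfT_ext => z _.
    by rewrite (orf0 phi_orf).
  rewrite IH (mul_op_orfT alpha_disk alpha_compact mu1 hw nlog phi_orf (@cB_id R) (bX k)).
  by apply: orfT_ext => z _; rewrite exprS.
rewrite dot_unit (orfTE alpha_disk mu1 phi_orf)//; apply: ci_ext => z _.
by rewrite (orf0 phi_orf) conjC1 mul1r.
Qed.

End moments.

Theorem theorem4p2 (R : realType) (alpha : nat -> cplx R)
    (mu : probability (borel_cplx R) R) (w : cplx R -> R)
    (phi : nat -> cplx R -> cplx R) (a : nat -> cplx R)
    (alpha0 : alpha 0%N = 0)
    (alpha_disk : forall n, `|alpha n| < 1)
    (alpha_compact : sup (range (fun n => cabs (alpha n))) < 1)
    (mu_circle : measure_on_circle mu)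
    (w_density : ac_density mu w)
    (log_w : ~ log_integrable w)
    (phi_orf : is_orf mu alpha phi a) :
  let V := mobius (matrix_op (diag_matrix alpha)) (matrix_op (hessenberg a)) in
  [/\ unitary_op V,
      forall E : set (borel_cplx R) -> l2 R -> l2 R, is_spectral_measure V E ->
        forall D : set (borel_cplx R), measurable D ->
          real_complex R (fine (mu D)) = matrix_entry (E D) 0%N 0%N,
      msupport mu = spectrum V,
      (forall lambda, is_mass_point mu lambda <-> is_eigenvalue V lambda) /\
      (forall lambda, is_eigenvalue V lambda ->
         geometric_multiplicity_one V lambda) &
      (forall lambda, (forall n, ~ is_pole (phi n) lambda) ->
         (is_mass_point mu lambda <-> sq_summable (fun n => phi n lambda))) /\
      (forall lambda, is_mass_point mu lambda ->
         (exists v : l2 R, (forall n, v n = (phi n lambda)^*) /\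
            op_eigenspace V lambda = spanned_line v) /\
         mu [set lambda] = ((sq_sum (fun n => phi n lambda))^-1)%E)].
Proof.
have [mu1 _] := mu_circle.
have VE := mobius_orf alpha_disk alpha_compact mu1 phi_orf.
rewrite diag_op_unlock in VE; move=> V; rewrite /V VE {V VE}.
set V := mul_op mu phi (fun z => z).
have spec := eigen_mass alpha_disk alpha_compact mu1 w_density log_w phi_orf.
have vec := mass_vector alpha_disk alpha_compact mu1 w_density log_w phi_orf.
have line := mass_eigenspace alpha_disk alpha_compact mu1 w_density log_w phi_orf.
have eig lambda : is_mass_point mu lambda <-> is_eigenvalue V lambda.
  split=> [/vec[v [vE Vv _]]|[x x0 Vx]]; last exact: spec Vx x0.
  by exists v => //; exact: (vector_neq0 phi_orf vE).
split; [exact: (mul_op_unitary alpha_disk alpha_compact mu1 w_density log_w phi_orf)| | |split|].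
- move=> E hE D mD; have [B hB] := mul_op_opb alpha_disk mu1 phi_orf (@cB_id R).
  have mufin : (mu (@unit_circle R) < +oo)%E by rewrite mu1 ltry.
  have Vadj x y : l2dot x (V y) = l2dot (mul_op mu phi (fun z => z^*) x) y.
    by rewrite -dot_conj (mul_op_adjoint alpha_disk mu1 phi_orf (@cB_id R)) dot_conj.
  have := spectral_measure_uniq hB Vadj hE mufin
    (mul_op_moment alpha_disk alpha_compact mu1 w_density log_w phi_orf) mD.
  by rewrite dot_unit (ci_indc mu1 mD) /matrix_entry => ->.
- exact: (support_spectrum alpha_disk alpha_compact mu1 w_density log_w phi_orf).
- exact: eig.
- move=> lambda /eig/vec[v [vE Vv _]]; exists v; first exact: (vector_neq0 phi_orf vE).
  exact: line.
- split=> [lambda np|lambda ml].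
    split; first exact: (mass_sq_summable alpha_disk alpha_compact mu1 w_density log_w phi_orf).
    exact: (sq_summable_mass alpha0 alpha_disk alpha_compact mu1 w_density log_w phi_orf np).
  split; last exact: (mass_formula alpha_disk alpha_compact mu1 w_density log_w phi_orf).
  by have [v [vE Vv _]] := vec lambda ml; exists v; split=> //; exact: line.
Qed.
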